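(* Let $A\to M$ be a Lie algebroid. (1) There is a one-to-one correspondence between isomorphism classes of (bounded or semibounded) $A$-modules and isomorphism classes of (bounded or semibounded) $\infty$-representations of $A$. (2) For any bounded or semibounded graded vector bundle $\mathcal{E}=\bigoplus_i E_i[-i]\to M$, there is a one-to-one correspondence between statomorphism classes of $A$-modules with standard graded vector bundle $\mathcal{E}$ and gauge-equivalence classes of $\infty$-representations of $A$ on $\mathcal{E}$. In both cases the correspondence sends the class of an $A$-module $(\mathcal{B},Q)$ with standard graded vector bundle $\mathcal{E}$ to the class of the $\infty$-representation $\mathcal{D}=\Theta\circ Q\circ\Theta^{-1}$ of $A$ on $\mathcal{E}$, where $\Theta:\mathcal{B}\to\pi_A^*\mathcal{E}$ is any decomposition of $\mathcal{B}$.
   Context: $A[1]$ is the graded manifold with underlying manifold $M$ and function algebra $C^\infty(A[1])=\Omega(A):=\bigwedge\Gamma(A^* )$, with Lie algebroid differential $d_A$. Let $\pi_A:A[1]\to M$ be the projection and $0_A:M\to A[1]$ the zero embedding (its pullback annihilates positive degree functions). A vector bundle $\mathcal{B}\to A[1]$ (in graded manifolds) is given by its sheaf of sections $\Gamma(\mathcal{B})$, a locally free $\mathbb{Z}$-graded $\Omega(A)$-module of finite rank $\mathrm{rk}_i(\mathcal{B})$ in each degree $i$. Its standard graded vector bundle is $\mathcal{E}=0_A^*\mathcal{B}=\bigoplus_i E_i[-i]$, where the $E_i$ are vector bundles over $M$ and $\Gamma(E_i[-i])$ is $\Gamma(E_i)$ in degree $i$; $\mathrm{rk}_i(\mathcal{B})=\mathrm{rk}(E_i)$.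 $\mathcal{B}$ (or $\mathcal{E}$) is bounded if $\mathrm{rk}(E_i)=0$ outside a finite range of $i$, and semibounded if $\mathrm{rk}(E_i)=0$ for all $i$ sufficiently small, or for all $i$ sufficiently large. A-modules. An $A$-module is a vector bundle $\mathcal{B}\to A[1]$ with a degree $1$ operator $Q$ on $\Gamma(\mathcal{B})$ such that $Q^2=0$ and $Q(\alpha\beta)=(d_A\alpha)\beta+(-1)^p\alpha(Q\beta)$ for $\alpha\in\Omega^p(A)$, $\beta\in\Gamma(\mathcal{B})$. A morphism $(\mathcal{B},Q)\to(\mathcal{B}',Q')$ is a (degree-preserving) linear map $\psi:\mathcal{B}\to\mathcal{B}'$ covering the identity of $A[1]$ with $\psi Q=Q'\psi$; an isomorphism is an invertible morphism. Decompositions and statomorphisms. Since $\pi_A\circ 0_A=\mathrm{id}_M$, canonically $0_A^*\pi_A^*\mathcal{E}=\mathcal{E}$. A decomposition of $\mathcal{B}$ is an isomorphism $\Theta:\mathcal{B}\to\pi_A^*\mathcal{E}$ of vector bundles over $A[1]$ with $0_A^*\Theta=\mathrm{id}_{\mathcal{E}}$. Decompositions exist. A statomorphism of $\mathcal{B}$ is a vector bundle automorphism $\Psi$ of $\mathcal{B}$ over $A[1]$ with $0_A^*\Psi=\mathrm{id}_{\mathcal{E}}$. Two $A$-module structures $Q,Q'$ on $\mathcal{B}$ are statomorphic if there is a statomorphism $\psi$ with $\psi Q=Q'\psi$. More generally, $A$-modules $(\mathcal{B},Q)$ and $(\mathcal{B}',Q')$ with standard graded vector bundle $\mathcal{E}$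 (i.e. with given identifications $0_A^*\mathcal{B}=\mathcal{E}=0_A^*\mathcal{B}'$) are in the same statomorphism class if there is an $A$-module isomorphism $\psi:\mathcal{B}\to\mathcal{B}'$ inducing the identity on $\mathcal{E}$. $\infty$-representations. For a graded vector bundle $\mathcal{E}=\bigoplus_i E_i[-i]\to M$, put $\Omega(A;\mathcal{E})=\Omega(A)\otimes_{C^\infty(M)}\Gamma(\mathcal{E})=\Gamma(\pi_A^*\mathcal{E})$, graded so that $\Omega^p(A)\otimes\Gamma(E_i[-i])$ has degree $p+i$. An $\infty$-representation (representation up to homotopy) of $A$ on $\mathcal{E}$ is a degree $1$ operator $\mathcal{D}$ on $\Omega(A;\mathcal{E})$ with $\mathcal{D}^2=0$ and $\mathcal{D}(\alpha\omega)=(d_A\alpha)\omega+(-1)^p\alpha(\mathcal{D}\omega)$ for $\alpha\in\Omega^p(A)$, $\omega\in\Omega(A;\mathcal{E})$. It is (semi)bounded if $\mathcal{E}$ is. A morphism from $\mathcal{D}$ on $\mathcal{E}$ to $\mathcal{D}'$ on $\mathcal{E}'$ is a (degree-preserving) $\Omega(A)$-module morphism $\phi:\Omega(A;\mathcal{E})\to\Omega(A;\mathcal{E}')$ with $\phi\circ\mathcal{D}=\mathcal{D}'\circ\phi$; an isomorphism is an invertible morphism. Let $\mu:\Omega(A;\mathcal{E})\to\Gamma(\mathcal{E})$ be the projection with kernel $\bigoplus_{p>0}\Omega^p(A)\otimes\Gamma(\mathcal{E})$. A gauge transformation is a degree-preserving $\Omega(A)$-module automorphism $u$ of $\Omega(A;\mathcal{E})$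 with $\mu\circ u=\mu$. $\infty$-representations $\mathcal{D},\mathcal{D}'$ on $\mathcal{E}$ are gauge-equivalent if $\mathcal{D}'=u^{-1}\mathcal{D}u$ for some gauge transformation $u$. *)

(* Defs.v *)
From HB Require Import structures.
From Stdlib Require Import RelationClasses.
From mathcomp Require Import all_boot all_order all_algebra.
From mathcomp Require Import all_classical all_reals all_analysis.
Set Implicit Arguments.
Unset Strict Implicit.
Unset Printing Implicit Defensive.
Import Order.TTheory GRing.Theory Num.Theory numFieldNormedType.Exports.
Local Open Scope classical_set_scope.
Local Open Scope ring_scope.

Fixpoint Ck (R : realType) n (k : nat) (U : set 'rV[R]_n) (f : 'rV[R]_n -> R)
    : Prop :=
  (forall v, U v -> {for v, continuous f}) /\
  match k with
  | 0%N => True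
  | k'.+1 => forall i : 'I_n,
      (forall v, U v -> derivable f v (delta_mx 0 i)) /\
      Ck k' U (fun v => 'D_(delta_mx 0 i) f v)
  end.

Record chart (R : realType) (n : nat) (T : topologicalType) := Chart {
  cdom : set T;
  ccod : set 'rV[R]_n;
  cmap : T -> 'rV[R]_n;
  cinv : 'rV[R]_n -> T;
  cdom_open : open cdom;
  ccod_open : open ccod;
  cmap_cod : forall x, cdom x -> ccod (cmap x);
  cinv_dom : forall v, ccod v -> cdom (cinv v);
  cmapK : forall x, cdom x -> cinv (cmap x) = x;
  cinvK : forall v, ccod v -> cmap (cinv v) = v;
  cmap_cont : forall x, cdom x -> {for x, continuous cmap};
  cinv_cont : forall v, ccod v -> {for v, continuous cinv} }.

Record manifold (R : realType) (n : nat) := Manifold {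
  pt :> topologicalType;
  pt_hausdorff : hausdorff_space pt;
  pt_countable : @second_countable pt;
  atlas : set (chart R n pt);
  atlas_cover : forall x : pt, exists2 c, atlas c & cdom c x;
  atlas_smooth : forall c d, atlas c -> atlas d -> forall (j : 'I_n) k,
    Ck k (ccod c `&` cinv c @^-1` cdom d) (fun v => cmap d (cinv c v) 0 j) }.

Definition smooth_on (R : realType) n (M : manifold R n) (U : set M)
    (f : M -> R) :=
  forall c, @atlas _ _ M c -> forall k,
    Ck k (ccod c `&` cinv c @^-1` U) (fun v => f (cinv c v)).

Definition smooth_at (R : realType) n (M : manifold R n) (f : M -> R) (x : M) :=
  exists U : set M, [/\ open U, U x & smooth_on U f].

(** A vector bundle is a family of vector spaces together with the predicate
    "[s] is smooth in a neighbourhood of [x]" on its (set-theoretic) sections;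
    around each point there is a frame with respect to which the smooth
    sections are those with smooth coefficients. *)
Record vbundle (R : realType) n (M : manifold R n) := VBundle {
  fib :> M -> lmodType R;
  vrk : nat;
  vsmooth : (forall x, fib x) -> M -> Prop;
  vframe : forall x : M,
    exists (U : set M) (e : 'I_vrk -> forall y, fib y),
    [/\ open U, U x,
        forall y, U y -> forall v : fib y,
          exists! c : 'rV[R]_vrk, v = \sum_i c 0 i *: e i y
      & forall y, U y -> forall s : (forall z, fib z),
          vsmooth s y <->
          exists c : 'I_vrk -> M -> R, (forall i, smooth_at (c i) y) /\
            \forall z \near y, s z = \sum_i c i z *: e i z] }.

Definition gsmooth R n (M : manifold R n) (A : vbundle M)
    (s : forall x, A x) := forall x, vsmooth s x.

(** Tangent vectors at [x] are the derivations at [x] of the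
    algebra of smooth functions, so that [anchor] is a smooth bundle map from
    [A] to the tangent bundle. The values of [bracket] and [anchor] are only
    relevant on smooth sections and smooth functions. *)
Record lie_algebroid R n (M : manifold R n) := LieAlgebroid {
  la_bundle :> vbundle M;
  bracket : (forall x, la_bundle x) -> (forall x, la_bundle x) ->
            (forall x, la_bundle x);
  anchor : forall x, la_bundle x -> (M -> R) -> R;
  anchor_linear : forall x f, (forall y, smooth_at f y) -> forall c u v,
    anchor (c *: u + v : la_bundle x) f = c * anchor u f + anchor v f;
  anchor_tangent_linear : forall x (u : la_bundle x) f g c,
    (forall y, smooth_at f y) -> (forall y, smooth_at g y) ->
    anchor u (fun y => c * f y + g y) = c * anchor u f + anchor u g;
  anchor_tangent_leibniz : forall x (u : la_bundle x) f g,
    (forall y, smooth_at f y) -> (forall y, smooth_at g y) ->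
    anchor u (fun y => f y * g y) = f x * anchor u g + g x * anchor u f;
  anchor_smooth : forall a f, gsmooth a -> (forall y, smooth_at f y) ->
    forall y, smooth_at (fun x => anchor (a x) f) y;
  bracket_smooth : forall a b, gsmooth a -> gsmooth b -> gsmooth (bracket a b);
  bracket_linear : forall c a b d, gsmooth a -> gsmooth b -> gsmooth d ->
    forall x, bracket (fun y => c *: a y + b y) d x =
              c *: bracket a d x + bracket b d x;
  bracket_alt : forall a b, gsmooth a -> gsmooth b ->
    forall x, bracket a b x = - bracket b a x;
  bracket_jacobi : forall a b d, gsmooth a -> gsmooth b -> gsmooth d ->
    forall x, bracket a (bracket b d) x + bracket b (bracket d a) x +
              bracket d (bracket a b) x = 0;
  bracket_leibniz : forall a b f, gsmooth a -> gsmooth b ->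
    (forall y, smooth_at f y) ->
    forall x, bracket a (fun y => f y *: b y) x =
              f x *: bracket a b x + anchor (a x) f *: b x }.

(** Alternating forms of all degrees at once: the [p]-form component of [w] is
    its restriction to sequences of size [p]. *)
Definition alternating (R : realType) (V W : lmodType R) (w : seq V -> W) :=
  (forall s t c u v, w (s ++ (c *: u + v) :: t) =
     c *: w (s ++ u :: t) + w (s ++ v :: t)) /\
  (forall s t r u, w (s ++ u :: t ++ u :: r) = 0).

Definition args R n (M : manifold R n) (A : vbundle M)
    (a : nat -> forall x, A x) (p : nat) (x : M) : seq (A x) :=
  mkseq (fun i => a i x) p.

(** [w] is, over [U], a smooth form on [A] with values in the family [W], the
    predicate [sm] specifying the smooth sections of [W]. *)
Definition is_form R n (M : manifold R n) (A : vbundle M)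
    (W : M -> lmodType R) (sm : (forall x, W x) -> M -> Prop)
    (U : set M) (w : forall x, seq (A x) -> W x) :=
  forall x, U x -> alternating (@w x) /\
    forall (a : nat -> forall y, A y) p, (forall i, vsmooth (a i) x) ->
      sm (fun y => w y (args a p y)) x.

Definition sform R n (M : manifold R n) (A : vbundle M) :=
  forall x : M, seq (A x) -> R.

(** [Omega U p] is the space of [p]-forms over [U], forms being considered up
    to equality over [U]. *)
Definition Omega R n (M : manifold R n) (A : vbundle M) (U : set M) (p : nat)
    (al : sform A) :=
  @is_form R n M A (fun _ => R^o) (@smooth_at R n M) U al /\
  forall x, U x -> forall s, size s <> p -> al x s = 0.

Definition constform R n (M : manifold R n) (A : vbundle M) (c : R) : sform A :=
  fun x s => if s is [::] then c else 0.

(** The sign exponent of the shuffle putting the entries selected by [m]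
    first. *)
Definition inversions (m : bitseq) : nat :=
  (\sum_(j < size m | nth false m j) count negb (take j m))%N.

Definition wedge R n (M : manifold R n) (A : vbundle M) (W : M -> lmodType R)
    (al : sform A) (w : forall x, seq (A x) -> W x) : forall x, seq (A x) -> W x :=
  fun x s => \sum_(m : (size s).-tuple bool)
    (-1) ^+ inversions m *:
      (al x (mask m s) *: w x (mask (map negb m) s)).

Definition wedges R n (M : manifold R n) (A : vbundle M) (al be : sform A) :
  sform A := @wedge R n M A (fun _ => R^o) al be.

Definition del (T : Type) (i : nat) (s : seq T) := take i s ++ drop i.+1 s.

(** The value of the differential of [al] on the sections
    [a 0, ..., a p], at [x]. *)
Definition koszul R n (M : manifold R n) (A : lie_algebroid M) (al : sform A)
    (a : nat -> forall x, A x) (p : nat) (x : M) : R :=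
  \sum_(i < p.+1) (-1) ^+ i *
     anchor (a i x) (fun y => al y (del i (args a p.+1 y))) +
  \sum_(i < p.+1) \sum_(j < p.+1 | (i < j)%N) (-1) ^+ (i + j) *
     al x (bracket (a i) (a j) x :: del i (del j (args a p.+1 x))).

(** The Lie algebroid differential: for a global form [al], the unique global
    form given by the Koszul formula (which is function-linear in each
    argument). *)
Definition dA R n (M : manifold R n) (A : lie_algebroid M) (al : sform A) :
    sform A :=
  xget ((fun _ _ => 0) : sform A)
    [set be : sform A |
      @is_form R n M A (fun _ => R^o) (@smooth_at R n M) setT be /\
      (forall x, be x [::] = 0) /\
      forall a p x, (forall i, gsmooth (a i)) ->
        be x (args a p.+1 x) = koszul al a p x].

(** The data of a sheaf on [M] of graded modules over the forms on [A]:
    [res U V k] is the restriction of sections of degree [k], relevant when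
    [V `<=` U], and [act U k l al] is multiplication by [al], relevant when
    [al] is a form over [U] of degree [l - k]. *)
Record gsheaf R n (M : manifold R n) (A : vbundle M) := GSheaf {
  sec : set M -> int -> lmodType R;
  res : forall (U V : set M) k, sec U k -> sec V k;
  act : forall (U : set M) k l, sform A -> sec U k -> sec U l }.
Arguments sec {R n M A} _ U k.
Arguments res {R n M A} _ U V k _.
Arguments act {R n M A} _ U k l al _.

(** The module generators of degree [i] range over ['I_(r i)].  As forms have
    degree between [0] and the rank of [A], only the generators of degrees
    [k - rank A, ..., k] contribute to sections of degree [k]. *)
Definition gcomb R n (M : manifold R n) (A : vbundle M) (B : gsheaf A)
    (r : int -> nat) (U V : set M) (e : forall i, 'I_(r i) -> sec B U i)
    (k : int) (c : forall i, 'I_(r i) -> sform A) : sec B V k :=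
  \sum_(p < (vrk A).+1) \sum_(j < r (k - p%:Z))
    act B V (k - p%:Z) k (c _ j) (res B U V _ (e _ j)).

(** [B] is the sheaf of sections of a vector bundle over A[1] of rank [r i] in
    degree [i].  Local freeness is required on a neighbourhood which may depend
    on a (symmetric, finite) range of degrees, in accordance with graded vector
    bundles over [M] being arbitrary families of vector bundles; if [r]
    vanishes outside a finite range this is freeness on one neighbourhood. *)
Record is_gbundle R n (M : manifold R n) (A : vbundle M) (B : gsheaf A)
    (r : int -> nat) : Prop := IsGBundle {
  res_linear : forall U V k, open U -> open V -> V `<=` U ->
    linear (res B U V k);
  res_id : forall U k s, open U -> res B U U k s = s;
  res_comp : forall U V W k s, open U -> open V -> open W ->
    V `<=` U -> W `<=` V -> res B V W k (res B U V k s) = res B U W k s;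
  sec_glue : forall (C : set (set M)) k (s : forall V, sec B V k),
    (forall V, C V -> open V) ->
    (forall V W, C V -> C W ->
       res B V (V `&` W) k (s V) = res B W (V `&` W) k (s W)) ->
    exists! t : sec B (\bigcup_(V in C) V) k,
      forall V, C V -> res B (\bigcup_(V in C) V) V k t = s V;
  act_ext : forall U k l (al be : sform A) s, open U ->
    (forall x, U x -> al x = be x) -> act B U k l al s = act B U k l be s;
  act_linear : forall U k p al, open U -> Omega U p al ->
    linear (act B U k (k + p%:Z) al);
  act_add : forall U k p al be s, open U -> Omega U p al -> Omega U p be ->
    act B U k (k + p%:Z) (fun x t => al x t + be x t) s =
    act B U k (k + p%:Z) al s + act B U k (k + p%:Z) be s;
  act_const : forall U k c s, open U ->
    act B U k k (constform c) s = c *: s;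
  act_wedge : forall U k p q l m al be s, open U ->
    Omega U p al -> Omega U q be -> l = k + q%:Z -> m = l + p%:Z ->
    act B U k m (wedges al be) s = act B U l m al (act B U k l be s);
  act_res : forall U V k p al s, open U -> open V -> V `<=` U ->
    Omega U p al ->
    res B U V _ (act B U k (k + p%:Z) al s) =
    act B V k (k + p%:Z) al (res B U V k s);
  locally_free : forall (x : M) (N : nat),
    exists (U : set M) (e : forall i, 'I_(r i) -> sec B U i),
    [/\ open U, U x
      & forall V k, open V -> V `<=` U -> (`|k| <= N%:Z)%R ->
        (forall s : sec B V k, exists c : forall i, 'I_(r i) -> sform A,
          (forall (p : nat) j, Omega V p (c (k - p%:Z) j)) /\
          s = gcomb V e k c) /\
        (forall c : forall i, 'I_(r i) -> sform A,
          (forall (p : nat) j, Omega V p (c (k - p%:Z) j)) ->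
          gcomb V e k c = 0 ->
          forall (p : nat) j x, V x -> forall t, c (k - p%:Z) j x t = 0)] }.

(** Degree-preserving linear maps over the identity of A[1]. *)
Definition gmor R n (M : manifold R n) (A : vbundle M) (B B' : gsheaf A) :=
  forall U k, sec B U k -> sec B' U k.

Record is_gmor R n (M : manifold R n) (A : vbundle M) (B B' : gsheaf A)
    (f : gmor B B') : Prop := IsGMor {
  gmor_linear : forall U k, open U -> linear (f U k);
  gmor_act : forall U k p al s, open U -> Omega U p al ->
    f U _ (act B U k (k + p%:Z) al s) = act B' U k (k + p%:Z) al (f U k s);
  gmor_res : forall U V k s, open U -> open V -> V `<=` U ->
    f V k (res B U V k s) = res B' U V k (f U k s) }.

Definition inverse_gmor R n (M : manifold R n) (A : vbundle M)
    (B B' : gsheaf A) (f : gmor B B') (g : gmor B' B) :=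
  [/\ is_gmor f, is_gmor g
    & forall U k, open U -> cancel (f U k) (g U k) /\ cancel (g U k) (f U k)].

(** The family [E : int -> vbundle M] is the graded vector bundle with [E i] in
    degree [i]. *)
Definition rawform R n (M : manifold R n) (A : vbundle M)
    (E : int -> vbundle M) := forall (x : M) (i : int), seq (A x) -> E i x.

HB.instance Definition _ (R : realType) n (M : manifold R n)
  (A : vbundle M) (E : int -> vbundle M) := gen_eqMixin (@rawform R n M A E).
HB.instance Definition _ (R : realType) n (M : manifold R n)
  (A : vbundle M) (E : int -> vbundle M) := gen_choiceMixin (@rawform R n M A E).

Section RawForm.
Context {R : realType} {n : nat} {M : manifold R n} {A : vbundle M}
  {E : int -> vbundle M}.
Local Notation F := (@rawform R n M A E).

Fact raw_ext (f g : F) : (forall x i s, f x i s = g x i s) -> f = g.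
Proof.
move=> h; apply: functional_extensionality_dep => x.
apply: functional_extensionality_dep => i.
by apply: functional_extensionality_dep => s.
Qed.

Definition raw_add (f g : F) : F := fun x i s => f x i s + g x i s.
Definition raw_opp (f : F) : F := fun x i s => - f x i s.
Definition raw_zero : F := fun x i s => 0.
Definition raw_scale (c : R) (f : F) : F := fun x i s => c *: f x i s.

Fact raw_addA : associative raw_add.
Proof. by move=> f g h; apply: raw_ext => x i s; exact: addrA. Qed.
Fact raw_addC : commutative raw_add.
Proof. by move=> f g; apply: raw_ext => x i s; exact: addrC. Qed.
Fact raw_add0 : left_id raw_zero raw_add.
Proof. by move=> f; apply: raw_ext => x i s; exact: add0r. Qed.
Fact raw_addN : left_inverse raw_zero raw_opp raw_add.
Proof. by move=> f; apply: raw_ext => x i s; exact: addNr. Qed.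
HB.instance Definition _ :=
  GRing.isZmodule.Build F raw_addA raw_addC raw_add0 raw_addN.

Fact raw_scaleA a b (f : F) : raw_scale a (raw_scale b f) = raw_scale (a * b) f.
Proof. by apply: raw_ext => x i s; exact: scalerA. Qed.
Fact raw_scale1 : left_id 1 raw_scale.
Proof. by move=> f; apply: raw_ext => x i s; exact: scale1r. Qed.
Fact raw_scaleDr : right_distributive raw_scale +%R.
Proof. by move=> c f g; apply: raw_ext => x i s; exact: scalerDr. Qed.
Fact raw_scaleDl (f : F) : {morph raw_scale^~ f : a b / a + b}.
Proof. by move=> a b; apply: raw_ext => x i s; exact: scalerDl. Qed.
HB.instance Definition _ := GRing.Zmodule_isLmodule.Build R F
  raw_scaleA raw_scale1 raw_scaleDr raw_scaleDl.
End RawForm.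

(** Forms over [U], of total degree [k], with values in the graded bundle [E]:
    the component with values in [E i] is a form of degree [k - i].  They are
    represented by their extension by zero outside [U]. *)
Definition is_psec R n (M : manifold R n) (A : vbundle M) (E : int -> vbundle M)
    (U : set M) (k : int) (w : rawform A E) :=
  [/\ forall i, @is_form R n M A (E i) (@vsmooth R n M (E i)) U
        (fun x => w x i),
      forall x i s, (size s)%:Z + i <> k -> w x i s = 0
    & forall x, ~ U x -> forall i s, w x i s = 0].

Definition psec_pred R n (M : manifold R n) (A : vbundle M)
    (E : int -> vbundle M) (U : set M) (k : int) : {pred rawform A E} :=
  fun w => `[< is_psec U k w >].

Section SmoothLinear.
Context {R : realType} {n : nat}.

Fact Ck_sub k (U V : set 'rV[R]_n) f : V `<=` U -> Ck k U f -> Ck k V f.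
Proof.
move=> VU; elim: k f => [|k IH] f /= [cf df]; split=> //; first by move=> v /VU/cf.
  by move=> v /VU/cf.
move=> i; have [d1 d2] := df i; split; last exact: IH.
by move=> v /VU/d1.
Qed.

Fact near_ext (U : set 'rV[R]_n) (f g : 'rV[R]_n -> R) v : open U ->
  (forall v, U v -> f v = g v) -> U v -> \near v, f v = g v.
Proof.
move=> oU fg Uv; near=> w; apply: fg; near: w.
exact: open_nbhs_nbhs.
Unshelve. all: by end_near. Qed.

Fact cont_ext (U : set 'rV[R]_n) (f g : 'rV[R]_n -> R) : open U ->
  (forall v, U v -> f v = g v) -> (forall v, U v -> {for v, continuous f}) ->
  forall v, U v -> {for v, continuous g}.
Proof.
move=> oU fg cf v Uv; rewrite /prop_for /continuous_at -(fg _ Uv).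
apply: cvg_trans (cf v Uv); apply: near_eq_cvg; first exact: (nbhs_filter v).
exact: near_ext oU fg Uv.
Qed.

Fact Ck_ext k (U : set 'rV[R]_n) f g : open U ->
  (forall v, U v -> f v = g v) -> Ck k U f -> Ck k U g.
Proof.
move=> oU; elim: k f g => [|k IH] f g fg [cf df]; split.
- exact: cont_ext oU fg cf.
- by [].
- exact: cont_ext oU fg cf.
move=> i; have [df1 df2] := df i; split=> [v Uv|].
  exact: near_eq_derivable (near_ext oU fg Uv) (df1 v Uv).
by apply: IH df2 => v Uv; exact: near_eq_derive (near_ext oU fg Uv).
Qed.

Fact Ck_0 k (U : set 'rV[R]_n) : Ck k U (fun=> 0).
Proof.
have cont0 v : U v -> {for v, continuous (fun=> 0 : R)}.
  by move=> _; apply: (@cst_continuous _ _ (0 : R)).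
elim: k => [|k IH]; split=> // i; split.
  by move=> v _; exact: (@derivable_cst R _ R (0 : R) v (delta_mx 0 i)).
suff -> : (fun v : 'rV[R]_n => 'D_(delta_mx 0 i) (fun=> 0 : R) v) = fun=> 0 by [].
by apply/funext => v; exact: (@derive_cst R _ R (0 : R) v (delta_mx 0 i)).
Qed.

Fact cont_linear c (f g : 'rV[R]_n -> R) v : {for v, continuous f} ->
  {for v, continuous g} -> {for v, continuous (fun v => c * f v + g v)}.
Proof.
move=> cf cg; apply: (@continuousD _ _ _ (fun v => c * f v) g) => //.
exact: (@continuousZl_tmp _ _ _ f c v).
Qed.

Fact Ck_linear k (U : set 'rV[R]_n) c f g : open U ->
  Ck k U f -> Ck k U g -> Ck k U (fun v => c * f v + g v).
Proof.
move=> oU; elim: k f g => [|k IH] f g [cf df] [cg dg]; split => //.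
- by move=> v Uv; apply: cont_linear; [exact: cf|exact: cg].
- by move=> v Uv; apply: cont_linear; [exact: cf|exact: cg].
move=> i; have [df1 df2] := df i; have [dg1 dg2] := dg i.
have E : (fun v => c * f v + g v) = c \*: f + g by [].
rewrite E; split=> [v Uv|].
  by apply: derivableD; [apply: derivableZ; exact: df1|exact: dg1].
apply: (Ck_ext oU _ (IH _ _ df2 dg2)) => v Uv /=.
by rewrite deriveD ?deriveZ//; [exact: df1|apply: derivableZ; exact: df1|exact: dg1].
Qed.

Context {M : manifold R n}.

Fact chart_open (c : chart R n M) (U : set M) : open U ->
  open (ccod c `&` cinv c @^-1` U).
Proof.
move=> oU; rewrite openE => v [cv Uv]; apply: filterI.
  by apply: open_nbhs_nbhs; split; [exact: ccod_open|].
by apply: (cinv_cont cv); apply: open_nbhs_nbhs.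
Qed.

Fact smooth_at_0 (x : M) : smooth_at (fun=> 0) x.
Proof. by exists setT; split=> //; [exact: openT|move=> c _ k; exact: Ck_0]. Qed.

Fact smooth_at_linear (x : M) a f g : smooth_at f x -> smooth_at g x ->
  smooth_at (fun y => a * f y + g y) x.
Proof.
move=> [U [oU Ux sU]] [V [oV Vx sV]].
have oUV : open (U `&` V) by exact: openI.
exists (U `&` V); split=> // c Ac k.
apply: Ck_linear; first exact: chart_open.
  by apply: Ck_sub (sU c Ac k) => v [cv []].
by apply: Ck_sub (sV c Ac k) => v [cv []].
Qed.

Fact vsmooth_0 (E : vbundle M) x : vsmooth (fun y => 0 : E y) x.
Proof.
have [U [e [oU Ux _ H]]] := vframe E x; apply/(H x Ux).
exists (fun _ _ => 0); split; first by move=> i; exact: smooth_at_0.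
by near=> z; rewrite big1// => i _; rewrite scale0r.
Unshelve. all: by end_near. Qed.

Fact vsmooth_linear (E : vbundle M) x a s t : vsmooth s x -> vsmooth t x ->
  vsmooth (fun y => a *: s y + t y : E y) x.
Proof.
have [U [e [oU Ux _ H]]] := vframe E x.
move=> /(H x Ux)[c [sc ec]] /(H x Ux)[d [sd ed]]; apply/(H x Ux).
exists (fun i y => a * c i y + d i y); split.
  by move=> i; exact: smooth_at_linear.
near=> z; rewrite (near ec z)// (near ed z)// scaler_sumr -big_split/=.
by apply: eq_bigr => i _; rewrite scalerDl scalerA.
Unshelve. all: by end_near. Qed.

Context {A : vbundle M} {E : int -> vbundle M}.

Fact psec_closed (U : set M) k : submod_closed (@psec_pred R n M A E U k).
Proof.
split=> [|a f g /asboolP[f1 f2 f3] /asboolP[g1 g2 g3]]; apply/asboolP; split.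
- move=> i x Ux; split; last by move=> b p _; exact: vsmooth_0.
  by split=> *; rewrite /= ?scaler0 ?addr0.
- by [].
- by [].
- move=> i x Ux; have [[fl fa] fs] := f1 i x Ux; have [[gl ga] gs] := g1 i x Ux.
  split; last first.
    by move=> b p sb; apply: vsmooth_linear; [exact: fs|exact: gs].
  split=> [s t c u v|s t r u].
    rewrite /= [LHS](_ : _ = a *: f x i (s ++ (c *: u + v) :: t)
                           + g x i (s ++ (c *: u + v) :: t))//.
    rewrite fl gl [RHS](_ : _ = c *: (a *: f x i (s ++ u :: t)
      + g x i (s ++ u :: t)) + (a *: f x i (s ++ v :: t) + g x i (s ++ v :: t)))//.
    by rewrite !scalerDr !scalerA (mulrC a c) addrACA.
  rewrite [LHS](_ : _ = a *: f x i (s ++ u :: t ++ u :: r)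
                      + g x i (s ++ u :: t ++ u :: r))//.
  by rewrite fa ga scaler0 addr0.
- move=> x i s h; rewrite [LHS](_ : _ = a *: f x i s + g x i s)//.
  by rewrite f2// g2// scaler0 addr0.
- move=> x h i s; rewrite [LHS](_ : _ = a *: f x i s + g x i s)//.
  by rewrite f3// g3// scaler0 addr0.
Qed.
End SmoothLinear.

HB.instance Definition _ (R : realType) n (M : manifold R n)
  (A : vbundle M) (E : int -> vbundle M) (U : set M) (k : int) :=
  GRing.isSubmodClosed.Build R (@rawform R n M A E) (@psec_pred R n M A E U k)
    (psec_closed U k).

Record psec R n (M : manifold R n) (A : vbundle M) (E : int -> vbundle M)
  (U : set M) (k : int) := PSec {
  pval :> rawform A E;
  pvalP : pval \in psec_pred U k }.
Arguments pval {R n M A E U k} _ x i s.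
HB.instance Definition _ (R : realType) n (M : manifold R n)
  (A : vbundle M) (E : int -> vbundle M) (U : set M) (k : int) :=
  [isSub for @pval R n M A E U k].
HB.instance Definition _ (R : realType) n (M : manifold R n)
  (A : vbundle M) (E : int -> vbundle M) (U : set M) (k : int) :=
  [Choice of @psec R n M A E U k by <:].
HB.instance Definition _ (R : realType) n (M : manifold R n)
  (A : vbundle M) (E : int -> vbundle M) (U : set M) (k : int) :=
  [SubChoice_isSubLmodule of @psec R n M A E U k by <:].

(** The sheaf of sections of the pullback of [E]: the tensor product of the
    forms with the sections of [E], realized as E-valued forms.  Its sections of
    degree [k] over [setT] are the degree [k] part of Omega(A; E).  The default value [0] of [insubd] is not used when [V `<=` U] are open and [al]
    is a form of degree [l - k]. *)
Definition pullback R n (M : manifold R n) (A : vbundle M)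
    (E : int -> vbundle M) : gsheaf A :=
  @GSheaf R n M A (fun U k => psec A E U k)
    (fun U V k w => insubd (0 : psec A E V k)
       (fun x i s => if x \in V then pval w x i s else 0))
    (fun U k l al w => insubd (0 : psec A E U l)
       (fun x i s => if x \in U then
          @wedge R n M A (E i) al (fun y => pval w y i) x s else 0)).

(** An identification of the pullback of [B] along the zero embedding with [E]:
    [ev] induces an isomorphism onto the sheaf of sections of [E] from the
    quotient of the sheaf [B] by the subsheaf generated by the multiples of
    forms of positive degree. *)
Record standard R n (M : manifold R n) (A : vbundle M) (B : gsheaf A)
    (E : int -> vbundle M) := Standard {
  ev : forall U k, sec B U k -> forall x, E k x;
  ev_smooth : forall U k s, open U -> forall x, U x -> vsmooth (ev (U := U) (k := k) s) x;
  ev_res : forall U V k s, open U -> open V -> V `<=` U ->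
    forall x, V x -> ev (res B U V k s) x = ev s x;
  ev_linear : forall U k c (s t : sec B U k), open U ->
    forall x, U x -> ev (c *: s + t) x = c *: ev s x + ev t x;
  ev_act0 : forall U k al (s : sec B U k), open U -> Omega U 0 al ->
    forall x, U x -> ev (act B U k k al s) x = al x [::] *: ev s x;
  ev_act : forall U k p al (s : sec B U k), open U -> Omega U p.+1 al ->
    forall x, U x -> ev (act B U k (k + p.+1%:Z) al s) x = 0;
  ev_surj : forall k (f : forall x, E k x) x, vsmooth f x ->
    exists (U : set M) (s : sec B U k),
      [/\ open U, U x & forall y, U y -> ev s y = f y];
  ev_ker : forall U k (s : sec B U k), open U ->
    (forall x, U x -> ev s x = 0) ->
    forall x, U x -> exists V : set M, [/\ open V, V x, V `<=` U &
      exists (m : nat) (q : 'I_m -> nat) (al : 'I_m -> sform A)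
        (t : forall j, sec B V (k - (q j).+1%:Z)),
        (forall j, Omega V (q j).+1 (al j)) /\
        res B U V k s = \sum_j act B V (k - (q j).+1%:Z) k (al j) (t j)] }.
Arguments ev {R n M A B E} _ U k s x.

Definition gop R n (M : manifold R n) (A : vbundle M) (B : gsheaf A) :=
  forall k, sec B setT k -> sec B setT (k + 1).

Definition is_module_op R n (M : manifold R n) (A : lie_algebroid M)
    (B : gsheaf A) (Q : gop B) :=
  [/\ forall k, linear (Q k),
      forall k s, Q (k + 1) (Q k s) = 0
    & forall k l p al s, Omega setT p al -> l = k + p%:Z ->
        Q l (act B setT k l al s) =
        act B setT k (l + 1) (dA al) s +
        (-1) ^+ p *: act B setT (k + 1) (l + 1) al (Q k s)].

Record amodule R n (M : manifold R n) (A : lie_algebroid M) := AModule {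
  am_sheaf :> gsheaf A;
  am_rk : int -> nat;
  am_bundle : is_gbundle am_sheaf am_rk;
  am_op : gop am_sheaf;
  am_opP : is_module_op am_op }.
Arguments am_op {R n M A} _ k s.

Record amodule_on R n (M : manifold R n) (A : lie_algebroid M)
    (E : int -> vbundle M) := AModuleOn {
  ao_module :> amodule A;
  ao_std : standard ao_module E }.

Record rep_on R n (M : manifold R n) (A : lie_algebroid M)
    (E : int -> vbundle M) := RepOn {
  rep_op : gop (pullback A E);
  rep_opP : is_module_op rep_op }.
Arguments rep_op {R n M A E} _ k w.

Record rep R n (M : manifold R n) (A : lie_algebroid M) := Rep {
  rep_bundle : int -> vbundle M;
  rep_rep :> rep_on A rep_bundle }.

Definition amodule_iso R n (M : manifold R n) (A : lie_algebroid M)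
    (X Y : amodule A) :=
  exists (f : gmor X Y) (g : gmor Y X), inverse_gmor f g /\
    forall k s, f setT _ (am_op X k s) = am_op Y k (f setT k s).

Definition statomorphic R n (M : manifold R n) (A : lie_algebroid M)
    (E : int -> vbundle M) (X Y : amodule_on A E) :=
  exists (f : gmor X Y) (g : gmor Y X),
    [/\ inverse_gmor f g,
        forall k s, f setT _ (am_op X k s) = am_op Y k (f setT k s)
      & forall U k s, open U -> forall x, U x ->
          ev (ao_std Y) U k (f U k s) x = ev (ao_std X) U k s x].

(** Morphisms of modules over the global forms, between global sections, as
    opposed to the sheaf morphisms [gmor]. *)
Definition is_module_mor R n (M : manifold R n) (A : vbundle M)
    (B B' : gsheaf A) (f : forall k, sec B setT k -> sec B' setT k) :=
  (forall k, linear (f k)) /\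
  forall k p al s, Omega setT p al ->
    f _ (act B setT k (k + p%:Z) al s) = act B' setT k (k + p%:Z) al (f k s).

Definition inverse_module_mor R n (M : manifold R n) (A : vbundle M)
    (B B' : gsheaf A) (f : forall k, sec B setT k -> sec B' setT k)
    (g : forall k, sec B' setT k -> sec B setT k) :=
  [/\ is_module_mor f, is_module_mor g
    & forall k, cancel (f k) (g k) /\ cancel (g k) (f k)].

Definition rep_iso R n (M : manifold R n) (A : lie_algebroid M) (D D' : rep A) :=
  exists f g, inverse_module_mor f g /\
    forall k w, f _ (rep_op D k w) = rep_op D' k (f k w).

(** [D' = u^-1 D u] where the gauge transformation [u] preserves the component
    of form degree 0. *)
Definition gauge_equivalent R n (M : manifold R n) (A : lie_algebroid M)
    (E : int -> vbundle M) (D D' : rep_on A E) :=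
  exists (u v : forall k, psec A E setT k -> psec A E setT k),
    [/\ @inverse_module_mor R n M A (pullback A E) (pullback A E) u v,
        forall k w x i, pval (u k w) x i [::] = pval w x i [::]
      & forall k w, rep_op D' k w = v _ (rep_op D k (u k w))].

Record decomposition R n (M : manifold R n) (A : lie_algebroid M)
    (E : int -> vbundle M) (X : amodule_on A E) := Decomposition {
  dec : gmor X (pullback A E);
  dec_inv : gmor (pullback A E) X;
  decK : inverse_gmor dec dec_inv;
  dec_ev : forall U k s, open U -> forall x, U x ->
    pval (@dec U k s) x k [::] = ev (ao_std X) U k s x }.
Arguments dec {R n M A E X} _ U k _.
Arguments dec_inv {R n M A E X} _ U k _.

Definition transport R n (M : manifold R n) (A : lie_algebroid M)
    (E : int -> vbundle M) (X : amodule_on A E) (T : decomposition X) :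
    gop (pullback A E) :=
  fun k w => dec T setT (k + 1) (am_op X k (dec_inv T setT k w)).

Arguments transport {R n M A E X} T k w.

Definition induces R n (M : manifold R n) (A : lie_algebroid M)
    (E : int -> vbundle M) (X : amodule_on A E) (D : rep_on A E) :=
  exists T : decomposition X, forall k w, rep_op D k w = transport T k w.

(** The correspondence relating an A-module to the representations up to
    homotopy induced on any of its standard graded vector bundles. *)
Definition corresponds R n (M : manifold R n) (A : lie_algebroid M)
    (X : amodule A) (D : rep A) :=
  exists std : standard X (rep_bundle D), induces (AModuleOn std) D.

Definition bounded_rk (r : int -> nat) :=
  exists N : int, forall i, N < `|i| -> r i = 0%N.

Definition semibounded_rk (r : int -> nat) :=
  (exists N : int, forall i, i < N -> r i = 0%N) \/
  (exists N : int, forall i, N < i -> r i = 0%N).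

Definition bundle_rk R n (M : manifold R n) (E : int -> vbundle M) : int -> nat :=
  fun i => vrk (E i).

(** [C] induces a bijection from the classes, for [eX], of the objects
    satisfying [PX] to the classes, for [eY], of the objects satisfying
    [PY]. *)
Definition one_to_one (X Y : Type) (PX : X -> Prop) (eX : X -> X -> Prop)
    (PY : Y -> Prop) (eY : Y -> Y -> Prop) (C : X -> Y -> Prop) :=
  [/\ Equivalence eX /\ Equivalence eY,
      forall x, PX x -> exists y, PY y /\ C x y,
      forall y, PY y -> exists x, PX x /\ C x y
    & forall x x' y y', PX x -> PX x' -> PY y -> PY y' ->
        C x y -> C x' y' -> (eX x x' <-> eY y y')].

(* Main.v *)
Require Import Defs.
From Stdlib Require Import RelationClasses.
From mathcomp Require Import all_boot all_order all_algebra.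
From mathcomp Require Import all_classical all_reals all_analysis.
From mathcomp Require Import zify ring lra.
Set Implicit Arguments.
Unset Strict Implicit.
Unset Printing Implicit Defensive.
Import Order.TTheory GRing.Theory Num.Theory numFieldNormedType.Exports.
Local Open Scope classical_set_scope.
Local Open Scope ring_scope.

(** The main point is that decompositions exist and that every A-module has a
    standard graded bundle.  In a local basis of the module, a section has
    unique coefficients which are forms; the degree 0 parts of these
    coefficients are the coordinates of a graded bundle, of which the basis
    gives local frames.  Sending a section to the combination of these frames
    with the same coefficients is a local decomposition, and a partition of
    unity averages local decompositions to a global one: the average is linear
    over the forms and is the identity in form degree 0, so it is triangular for
    the filtration by form degree, hence invertible.  Conjugation by
    decompositions then gives the correspondence.  In the other direction,
    an isomorphism of modules of global sections comes from an isomorphism of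
    sheaves, since bump functions make it local. *)

(** * Shuffle products *)

(** Two obstacles shape the proof. A graded bundle may have infinitely many degrees, while local
    freeness gives a basis on a neighbourhood that depends on a finite range of degrees. Forms of
    degree above the rank a of A vanish, so a section of degree k only involves generators of
    degrees k - a, ..., k, and a value in [E i] only comes from sections of degrees i, ..., i + a.
    Each construction therefore fixes one degree and takes a basis for a range exceeding it by a or
    2a. The second obstacle is that the identification of the zero-embedding pullback with a graded
    bundle is given on sections, so it must be shown pointwise that it turns a basis of the sheaf
    into a frame; functionals on the fibres of that pullback serve this purpose. Invertibility of a
    decomposition uses no series: any sections of the pullback whose parts of form degree 0 are
    frames form a basis, by a triangular system. A decomposition thus carries a basis to a basis and
    keeps coefficients, so it is locally bijective, and local preimages glue. *)

Lemma big_tuple_cons (V : nmodType) (n : nat) (F : seq bool -> V) :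
  \sum_(m : n.+1.-tuple bool) F m =
  \sum_(m : n.-tuple bool) F (true :: m) + \sum_(m : n.-tuple bool) F (false :: m).
Proof.
rewrite (reindex (fun p : bool * n.-tuple bool => cons_tuple p.1 p.2)) /=; last first.
  exists (fun t : n.+1.-tuple bool => (thead t, behead_tuple t)) => [[b m] _|t _] /=.
    by congr pair; apply: val_inj.
  by rewrite [RHS]tuple_eta; apply: val_inj.
rewrite -(pair_bigA _ (fun b (m : n.-tuple bool) => F (b :: m))) /=.
by rewrite big_bool.
Qed.

(** A selected head creates no inversion; an unselected one is jumped over by every later selected
    entry. *)
Lemma inversions_cons b m :
  inversions (b :: m) = (inversions m + (~~ b) * count id m)%N.
Proof.
rewrite /inversions big_mkcond big_ord_recl /= if_same add0n.
have -> : count id m = (\sum_(j < size m | nth false m j) 1)%N.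
  by rewrite -(big_mkord (nth false m) (fun=> 1%N)) -(big_nth _ id (fun=> 1%N)) sum1_count.
rewrite big_distrr /= -big_split [RHS]big_mkcond; apply: eq_bigr => j _ /=.
by case: ifP => //= _; rewrite muln1 addnC.
Qed.

Section Shuffle.
Context {R : realType}.

(** The value of [wedge] at one point, with the fibre abstracted to a type, so that products can be
    studied by induction on the list of arguments. *)
Definition shuf (V : Type) (W : lmodType R) (a : seq V -> R) (w : seq V -> W)
    (s : seq V) : W :=
  \sum_(m : (size s).-tuple bool)
    (-1) ^+ inversions m *: (a (mask m s) *: w (mask (map negb m) s)).

(** The grading automorphism, which multiplies [p]-forms by (-1)^p: the sign picked up by a
    contraction that moves past [a]. *)
Definition twist (V : Type) (a : seq V -> R) : seq V -> R :=
  fun s => (-1) ^+ size s * a s.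

Section Basic.
Context {V : Type} {W : lmodType R}.
Implicit Types (a b : seq V -> R) (v w : seq V -> W) (s : seq V).

Lemma size_mask_negb s (m : (size s).-tuple bool) :
  (size (mask m s) + size (mask (map negb m) s))%N = size s.
Proof.
rewrite !size_mask ?size_map ?size_tuple// count_map.
by rewrite -[RHS](size_tuple m) -[RHS](count_predC id).
Qed.

Lemma shuf_nil a w : shuf a w [::] = a [::] *: w [::].
Proof.
rewrite /shuf (big_pred1 [tuple]) => [|m]; last by apply/esym/eqP; exact: tuple0.
by rewrite /inversions big_ord0 expr0 scale1r.
Qed.

(** The Leibniz rule for contraction with [u]: the first argument goes to [a], or it goes to [w]
    after jumping over all the arguments of [a], whence the [twist]. *)
Lemma shuf_cons a w u s : shuf a w (u :: s) =
  shuf (fun t => a (u :: t)) w s + shuf (twist a) (fun t => w (u :: t)) s.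
Proof.
rewrite /shuf /= (big_tuple_cons (size s) (fun m => (-1) ^+ inversions m *:
  (a (mask m (u :: s)) *: w (mask (map negb m) (u :: s))))).
congr (_ + _); apply: eq_bigr => m _ /=; rewrite inversions_cons ?addn0//.
rewrite /twist size_mask ?size_tuple// mul1n exprD.
by rewrite scalerA -!mulrA scalerA.
Qed.

Lemma shuf_linearl c a b w s : shuf (fun t => c * a t + b t) w s =
  c *: shuf a w s + shuf b w s.
Proof.
rewrite /shuf scaler_sumr -big_split; apply: eq_bigr => m _ /=.
by rewrite scalerDl scalerDr !scalerA mulrCA mulrA.
Qed.

Lemma shuf_linearr c a v w s : shuf a (fun t => c *: v t + w t) s =
  c *: shuf a v s + shuf a w s.
Proof.
rewrite /shuf scaler_sumr -big_split; apply: eq_bigr => m _ /=.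
by rewrite !scalerDr !scalerA -!mulrA [in a _ * c]mulrC mulrCA.
Qed.

Lemma shuf_eq a b v w s : (forall t, (size t <= size s)%N -> a t = b t) ->
  (forall t, (size t <= size s)%N -> v t = w t) -> shuf a v s = shuf b w s.
Proof.
move=> ab vw; apply: eq_bigr => m _.
by rewrite ab ?vw// -[leqRHS](size_mask_negb m) ?leq_addl ?leq_addr.
Qed.

Lemma shuf0l w s : shuf (fun=> 0) w s = 0.
Proof. by rewrite /shuf big1// => m _; rewrite scale0r scaler0. Qed.

Lemma shuf0r a s : shuf a (fun=> 0 : W) s = 0.
Proof. by rewrite /shuf big1// => m _; rewrite !scaler0. Qed.

Lemma shufDl a b w s : shuf (fun t => a t + b t) w s = shuf a w s + shuf b w s.
Proof.
rewrite -[X in X + _]scale1r -shuf_linearl; apply: shuf_eq => // t _.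
by rewrite mul1r.
Qed.

Lemma shufDr a v w s : shuf a (fun t => v t + w t) s = shuf a v s + shuf a w s.
Proof.
rewrite -[X in X + _]scale1r -shuf_linearr; apply: shuf_eq => // t _.
by rewrite scale1r.
Qed.

Lemma shufZr c a w s : shuf a (fun t => c *: w t) s = c *: shuf a w s.
Proof.
rewrite -[RHS]addr0 -(shuf0r a s) -shuf_linearr; apply: shuf_eq => // t _.
by rewrite addr0.
Qed.

Lemma shuf_sumr (I : finType) a (w : I -> seq V -> W) s :
  shuf a (fun t => \sum_i w i t) s = \sum_i shuf a (w i) s.
Proof.
rewrite /shuf exchange_big; apply: eq_bigr => m _ /=.
by rewrite !scaler_sumr.
Qed.

Lemma shuf_degree p q a w s : (forall t, size t <> p -> a t = 0) ->
  (forall t, size t <> q -> w t = 0) -> size s <> (p + q)%N -> shuf a w s = 0.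
Proof.
move=> ha hw hs; rewrite /shuf big1// => m _.
have [e|/eqP ne] := eqVneq (size (mask m s)) p; last first.
  by rewrite (ha _ ne) scale0r scaler0.
by rewrite (hw (mask (map negb m) s)) ?scaler0// => e'; apply: hs; rewrite -e -e' size_mask_negb.
Qed.

Lemma shuf_deg0l a w s : (forall t, size t <> 0%N -> a t = 0) ->
  shuf a w s = a [::] *: w s.
Proof.
elim: s a w => [|u s IH] a w ha; first by rewrite shuf_nil.
rewrite shuf_cons (_ : (fun t => a (u :: t)) = fun=> 0) ?shuf0l; last first.
  by apply/funext => t; apply: ha.
rewrite add0r IH; first by rewrite /twist /= expr0 mul1r.
by move=> t ht; rewrite /twist ha ?mulr0.
Qed.

Lemma shuf_deg0r a w s : (forall t, size t <> 0%N -> w t = 0) ->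
  shuf a w s = a s *: w [::].
Proof.
elim: s a w => [|u s IH] a w hw; first by rewrite shuf_nil.
rewrite shuf_cons IH// (_ : (fun t => w (u :: t)) = fun=> 0) ?shuf0r ?addr0//.
by apply/funext => t; apply: hw.
Qed.

Lemma shuf_scale_cst a (c : seq V -> R) (v : W) s :
  shuf a (fun t => c t *: v) s = @shuf V R^o a c s *: v.
Proof.
by rewrite /shuf scaler_suml; apply: eq_bigr => m _; rewrite [in LHS]scalerA [LHS]scalerA.
Qed.
End Basic.

Lemma twist_shuf (V : Type) (a b : seq V -> R) :
  twist (@shuf V R^o a b) = @shuf V R^o (twist a) (twist b).
Proof.
apply/funext => s; rewrite /twist /shuf mulr_sumr; apply: eq_bigr => m _.
rewrite -[in X in X * _](size_mask_negb m) exprD /GRing.scale /=.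
by ring.
Qed.

(** Both sides obey the contraction rule [shuf_cons], because [twist] is multiplicative, so
    induction replaces any regrouping of shuffles. *)
Lemma shufA (V : Type) (W : lmodType R) (a b : seq V -> R) (w : seq V -> W) s :
  shuf (@shuf V R^o a b) w s = shuf a (shuf b w) s.
Proof.
elim: s a b w => [|u s IH] a b w; first by rewrite !shuf_nil scalerA.
rewrite !shuf_cons.
rewrite (_ : (fun t => @shuf V R^o a b (u :: t)) = fun t =>
  @shuf V R^o (fun t => a (u :: t)) b t +
  @shuf V R^o (twist a) (fun t => b (u :: t)) t); last first.
  by apply/funext => t; rewrite shuf_cons.
rewrite shufDl !IH twist_shuf IH -addrA -shufDr; congr (_ + _).
by apply: shuf_eq => // t _; rewrite shuf_cons.
Qed.

(** * Multilinear and alternating functions of lists *)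

Section Alternating.
Context {V : lmodType R}.

Definition multilinear_seq (W : lmodType R) (w : seq V -> W) :=
  forall s t c u v, w (s ++ (c *: u + v) :: t) = c *: w (s ++ u :: t) + w (s ++ v :: t).

(** Polarising the vanishing on adjacent repetitions gives antisymmetry under adjacent swaps, which
    brings two distant equal entries together. *)
Lemma alternating_adjacent (W : lmodType R) (w : seq V -> W) :
  multilinear_seq w -> (forall s r u, w (s ++ u :: u :: r) = 0) -> Defs.alternating w.
Proof.
move=> lw aw; split=> // s t; elim: t s => [|v t IH] s r u; first exact: aw.
have swap s' r' x y : w (s' ++ x :: y :: r') = - w (s' ++ y :: x :: r').
  apply/eqP; rewrite -addr_eq0; apply/eqP.
  have := aw s' r' (1 *: x + y).
  have := lw (rcons s' x) r' 1 x y; have := lw (rcons s' y) r' 1 x y.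
  by rewrite !cat_rcons lw => -> ->; rewrite !scale1r !aw add0r addr0.
by rewrite /= swap -cat_rcons IH oppr0.
Qed.

Lemma multilinear_twist (a : seq V -> R^o) : multilinear_seq a ->
  @multilinear_seq R^o (twist a).
Proof.
move=> la s t c u v; rewrite /twist la !size_cat /= mulrDr.
by rewrite [in LHS]mulrCA.
Qed.

Lemma multilinear_shuf (W : lmodType R) (a : seq V -> R) (w : seq V -> W) :
  @multilinear_seq R^o a -> multilinear_seq w -> multilinear_seq (shuf a w).
Proof.
move=> la lw s; elim: s a w la lw => [|x s IH] a w la lw t c u v /=.
  rewrite !shuf_cons scalerDr addrACA -shuf_linearl -shuf_linearr.
  by congr (_ + _); apply: shuf_eq => // r _; rewrite ?(la [::]) ?(lw [::]).
rewrite !shuf_cons !IH//; first by rewrite scalerDr addrACA.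
- exact: multilinear_twist.
- by move=> s' *; apply: (lw (x :: s')).
- by move=> s' *; apply: (la (x :: s')).
Qed.

(** At a repeated adjacent pair, the terms giving both copies to one factor vanish, and the two
    terms that separate the copies cancel by the sign of [twist]. *)
Lemma alternating_shuf (W : lmodType R) (a : seq V -> R) (w : seq V -> W) :
  @Defs.alternating R V R^o a -> Defs.alternating w -> Defs.alternating (shuf a w).
Proof.
move=> [la aa] [lw aw]; apply: alternating_adjacent; first exact: multilinear_shuf.
have {}aa s r u : a (s ++ u :: u :: r) = 0 by apply: (aa s [::]).
have {}aw s r u : w (s ++ u :: u :: r) = 0 by apply: (aw s [::]).
move=> {la lw} s; elim: s a w aa aw => [|x s IH] a w aa aw r u /=.
  rewrite !shuf_cons (_ : (fun t => a (u :: u :: t)) = fun=> 0); last first.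
    by apply/funext => t; apply: (aa [::]).
  rewrite (_ : (fun t => w (u :: u :: t)) = fun=> 0); last first.
    by apply/funext => t; apply: (aw [::]).
  rewrite shuf0l shuf0r add0r addr0 -shufDl.
  rewrite -[RHS](shuf0l (fun t => w (u :: t)) r); apply: shuf_eq => // t _.
  by rewrite /twist /= exprS mulN1r mulNr subrr.
rewrite shuf_cons !IH ?addr0// => s' *; first by rewrite /twist aa mulr0.
- exact: (aw (x :: s')).
- exact: (aa (x :: s')).
Qed.

Lemma multilinear_sum (W : lmodType R) (w : seq V -> W) s t m
    (c : 'I_m -> R) (e : 'I_m -> V) : multilinear_seq w ->
  w (s ++ (\sum_i c i *: e i) :: t) = \sum_i c i *: w (s ++ e i :: t).
Proof.
move=> lw; have w0 : w (s ++ 0 :: t) = 0.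
  by have := lw s t (-1) 0 0; rewrite scaler0 addr0 scaleN1r addNr.
elim: m c e => [|m IH] c e; first by rewrite !big_ord0.
by rewrite !big_ord_recl lw IH.
Qed.

Lemma alternating_sum (W : lmodType R) m (c : 'I_m -> R)
    (w : 'I_m -> seq V -> W) : (forall j, Defs.alternating (w j)) ->
  Defs.alternating (fun t => \sum_j c j *: w j t).
Proof.
move=> aw; split=> [s t a u v|s t p u].
  rewrite scaler_sumr -big_split; apply: eq_bigr => j _ /=.
  by rewrite (aw j).1 scalerDr !scalerA mulrC.
by apply: big1 => j _; rewrite (aw j).2 scaler0.
Qed.

(** Expanding the arguments in a spanning family of [m] vectors, each term
    contains a repetition. *)
Lemma alternating_gt_rank (W : lmodType R) (w : seq V -> W) m (e : 'I_m -> V) :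
  Defs.alternating w -> (forall v, exists c : 'I_m -> R, v = \sum_i c i *: e i) ->
  forall s, (m < size s)%N -> w s = 0.
Proof.
move=> [lw aw] he s.
suff H (b : seq 'I_m) : (m < size b + size s)%N -> w (map e b ++ s) = 0.
  exact: (H [::]).
elim: s b => [|v s IH] b hb.
  have : ~~ uniq b.
    apply/negP => /card_uniqP bu; move: hb; rewrite /= addn0 -bu ltnNge.
    by rewrite -[X in (_ <= X)%N](card_ord m) max_card.
  have nu : ~~ uniq b -> exists s1 u s2 s3, b = s1 ++ u :: s2 ++ u :: s3.
    elim: b {hb} => // x b IHb /=; rewrite negb_and negbK => /orP[/splitPr[p1 p2]|/IHb].
      by exists [::], x, p1, p2.
    by move=> [s1 [u [s2 [s3 ->]]]]; exists (x :: s1), u, s2, s3.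
  by move=> /nu[s1 [u [s2 [s3 ->]]]]; rewrite cats0 map_cat /= map_cat aw.
have [c ->] := he v; rewrite (multilinear_sum _ _ _ _ lw) big1// => i _.
rewrite -cat_rcons -map_rcons IH ?scaler0//.
by rewrite size_rcons addSnnS.
Qed.
End Alternating.
End Shuffle.

(** * Smooth functions and partitions of unity *)

Section FlatFunction.
Context {R : realType}.

Fixpoint Ck_line (k : nat) (f : R -> R) : Prop :=
  match k with
  | 0%N => continuous f
  | k'.+1 => exists2 f' : R -> R, (forall t, is_derive t (1 : R) f (f' t)) & Ck_line k' f'
  end.

Lemma is_derive_continuous (f f' : R -> R) :
  (forall t, is_derive t (1 : R) f (f' t)) -> continuous f.
Proof.
move=> df t; apply/differentiable_continuous/derivable1_diffP.
by have [] := df t.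
Qed.

Lemma Ck_line_linear k a (f g : R -> R) : Ck_line k f -> Ck_line k g ->
  Ck_line k (fun t => a * f t + g t).
Proof.
elim: k f g => [|k IH] f g /=.
  by move=> cf cg t; apply: cvgD => //; [apply: cvgMr; exact: cf|exact: cg].
move=> [f' df cf] [g' dg cg]; exists (fun t => a * f' t + g' t); last exact: IH.
move=> t; have := df t; have := dg t => dgt dft.
exact: (@is_deriveD _ _ _ (a \*: f) g).
Qed.

(** The family t^-k exp(-1/t) is closed under differentiation up to linear combinations, so
    smoothness of exp(-1/t) follows by an induction over all [k] at once. *)
Definition flat (k : nat) (t : R) : R := if 0 < t then t^-1 ^+ k * expR (- t^-1) else 0.

Lemma flat_ge0 k t : 0 <= flat k t.
Proof.
by rewrite /flat; case: ifPn => // t0; rewrite mulr_ge0 ?expR_ge0// exprn_ge0// invr_ge0 ltW.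
Qed.

Lemma flat_gt0 k t : 0 < t -> 0 < flat k t.
Proof. by move=> t0; rewrite /flat t0 mulr_gt0 ?expR_gt0// exprn_gt0// invr_gt0. Qed.

(** With s = 1/t, a single term of the exponential series gives exp(s) >= s^(k+1)/(k+1)!. The linear
    decay is what differentiability at 0 requires. *)
Lemma flat_le k t : 0 <= t -> flat k t <= k.+1`!%:R * t.
Proof.
rewrite le_eqVlt => /predU1P[<-|t0]; first by rewrite /flat ltxx mulr0.
rewrite /flat t0; have i0 : 0 < t^-1 by rewrite invr_gt0.
have := expR_ge1Dxn k (ltW i0); set e := expR _ => he.
have f0 : 0 < k.+1`!%:R :> R by rewrite ltr0n fact_gt0.
have {he} : t^-1 ^+ k.+1 / k.+1`!%:R <= e by apply: le_trans he; rewrite lerDr.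
rewrite ler_pdivrMr// => he.
have e0 : 0 < e by exact: expR_gt0.
rewrite expRN -/e ler_pdivrMr// -(ler_pM2l i0) -exprS (le_trans he)//.
by rewrite !mulrA (mulrAC t^-1) mulVf ?gt_eqF// mul1r mulrC.
Qed.

Lemma flat_is_derive k t :
  is_derive t (1 : R) (flat k) (flat k.+2 t - k%:R * flat k.+1 t).
Proof.
have [t0|t0|->] := ltgtP t 0.
- rewrite /flat !ltNge !(ltW t0) /= mulr0 subr0.
  apply: (@near_eq_is_derive _ _ _ (cst 0)).
  near=> s; rewrite /flat ltNge (_ : s <= 0)//; apply/ltW.
  by near: s; exact: lt_nbhsl.
- apply: (@near_eq_is_derive _ _ _ (fun s : R => s^-1 ^+ k * expR (- s^-1))).
    by near=> s; rewrite /flat (_ : 0 < s)//; near: s; exact: lt_nbhsr.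
  have tN0 : t != 0 by rewrite gt_eqF.
  have dV : is_derive t (1 : R) (fun s : R => s^-1) (- t ^- 2 *: (1 : R)).
    exact: (@is_deriveV _ id).
  have dX := is_deriveX k dV.
  have dN : is_derive t (1 : R) (fun s : R => - s^-1) (- (- t ^- 2 *: (1 : R))).
    exact: is_deriveN.
  have dE := @is_derive1_comp _ expR (fun s : R => - s^-1) t _ _ (is_derive_expR _) dN.
  have dM := is_deriveM dX dE.
  have -> : (fun s : R => s^-1 ^+ k * expR (- s^-1)) =
      (fun s : R => s^-1) ^+ k * (expR \o (fun s : R => - s^-1)).
    by apply/funext => s; rewrite /= -[RHS]/(_ s * _) exprfctE.
  apply: is_derive_eq dM _.
  rewrite /flat t0 /GRing.scale /= !exprfctE /=.
  case: k {dX} => [|k].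
    by rewrite !expr0 -exprVn !mul1r !mul0r !mulr0 ?addr0 ?subr0 mulr1 opprK mulrC.
  by rewrite /= -exprVn mulr1 opprK !exprS; ring.
- rewrite /flat ltxx mulr0 subr0.
  have cv : (fun h : R => h^-1 *: (flat k (h *: (1:R) + 0) - flat k 0)) @ 0^' --> (0 : R).
    (* The difference quotient at 0 is [flat k.+1 h] for positive [h] and 0 for negative [h], so
       [flat_le] for [k.+1] bounds it. *)
    have bd (h : R) : h != 0 ->
        `|h^-1 *: (flat k (h *: (1:R) + 0) - flat k 0)| <= k.+2`!%:R * `|h|.
      move=> hN0; rewrite addr0 [h *: 1]mulr1 {2}/flat ltxx subr0 /GRing.scale /=.
      have [h0|h0] := ltP 0 h.
        rewrite (_ : h^-1 * flat k h = flat k.+1 h); last first.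
          by rewrite /flat h0 mulrA -exprS.
        by rewrite !ger0_norm ?flat_ge0// ?(ltW h0)// flat_le// ltW.
      by rewrite /flat ltNge h0 /= mulr0 normr0 mulr_ge0.
    apply/cvgr0Pnorm_le => e e0; near=> h.
    have hN0 : h != 0 by near: h; exact: nbhs_dnbhs_neq.
    apply: le_trans (bd _ hN0) _.
    have f0 : 0 < k.+2`!%:R :> R by rewrite ltr0n fact_gt0.
    rewrite -ler_pdivlMl//; near: h.
    by apply: dnbhs0_le; rewrite mulr_gt0// invr_gt0.
  apply: DeriveDef; first by apply/cvg_ex; exists 0; exact: cv.
  exact: cvg_lim cv.
Unshelve. all: by end_near. Qed.

Lemma Ck_line_flat m k : Ck_line m (flat k).
Proof.
elim: m k => [|m IH] k; first exact: is_derive_continuous (flat_is_derive k).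
exists (fun t => - k%:R * flat k.+1 t + flat k.+2 t); last exact: Ck_line_linear.
by move=> t; rewrite addrC mulNr; exact: flat_is_derive.
Qed.
End FlatFunction.

(** * Calculus of C^k functions of several variables *)

Section CkCalculus.
Context {R : realType} {n : nat}.
Implicit Types (U : set 'rV[R]_n) (f g : 'rV[R]_n -> R).

Lemma Ck_S k U f : Ck k.+1 U f -> Ck k U f.
Proof.
elim: k f => [|k IH] f [cf df]; first by split.
split=> // i; have [d1 d2] := df i; split=> //; exact: IH.
Qed.

Lemma Ck_const k U (c : R) : Ck k U (fun=> c).
Proof.
case: k => [|k]; (split; first by move=> v _; exact: (@cst_continuous _ _ c)) => //.
move=> i; split.
  by move=> v _; exact: (@derivable_cst R _ R c v (delta_mx 0 i)).
suff -> : (fun v : 'rV[R]_n => 'D_(delta_mx 0 i) (fun=> c) v) = fun=> 0 by exact: Ck_0.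
by apply/funext => v; exact: (@derive_cst R _ R c v (delta_mx 0 i)).
Qed.

Lemma CkD k U f g : open U -> Ck k U f -> Ck k U g -> Ck k U (fun v => f v + g v).
Proof.
move=> oU cf cg; apply: (Ck_ext oU _ (Ck_linear 1 oU cf cg)) => v _.
by rewrite mul1r.
Qed.

Lemma CkM k U f g : open U -> Ck k U f -> Ck k U g -> Ck k U (fun v => f v * g v).
Proof.
move=> oU; elim: k f g => [|k IH] f g cfg cgg.
  have [cf _] := cfg; have [cg _] := cgg.
  split=> // v Uv.
  by apply: (@cvgM _ _ (nbhs v) _ f g (f v) (g v)); [exact: cf|exact: cg].
have [cf df] := cfg; have [cg dg] := cgg; split.
  move=> v Uv.
  by apply: (@cvgM _ _ (nbhs v) _ f g (f v) (g v)); [exact: cf|exact: cg].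
move=> i; have [df1 df2] := df i; have [dg1 dg2] := dg i; split.
  by move=> v Uv; apply: (@derivableM _ _ f g); [exact: df1|exact: dg1].
apply: (Ck_ext oU _ (CkD oU (IH _ _ (Ck_S cfg) dg2) (IH _ _ (Ck_S cgg) df2))) => v Uv.
by rewrite (deriveM (df1 _ Uv) (dg1 _ Uv)).
Qed.

Lemma CkV k U f : open U -> (forall v, U v -> f v != 0) -> Ck k U f ->
  Ck k U (fun v => (f v)^-1).
Proof.
move=> oU f0; elim: k => [|k IH] cf.
  have [c0 _] := cf; split=> // v Uv.
  by apply: (@cvgV _ _ (nbhs v) _ f (f v)); [exact: f0|exact: c0].
have [c0 df] := cf; have iv := IH (Ck_S cf).
split; first by move=> v Uv; apply: (@cvgV _ _ (nbhs v) _ f (f v)); [exact: f0|exact: c0].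
move=> i; have [df1 df2] := df i; split.
  by move=> v Uv; apply: derivableV; [exact: f0|exact: df1].
apply: (Ck_ext oU _ (CkM oU (Ck_const k U (-1)) (CkM oU (CkM oU iv iv) df2))) => v Uv.
by rewrite deriveV ?f0//; [rewrite mulN1r scaleNr /GRing.scale /= expr2 invfM|exact: df1].
Qed.

(** Reduces directional derivatives to one variable, so that the one-variable chain rule applies in
    [Ck_comp]. *)
Lemma is_derive_line f (v e : 'rV[R]_n) a :
  is_derive v e f a <-> is_derive (0 : R) (1 : R) (fun h : R => f (h *: e + v)) a.
Proof.
have E : 'D_e f v = 'D_(1 : R) (fun h : R => f (h *: e + v)) 0.
  rewrite /derive; set F := (X in X @ _); set G := (X in _ = lim (X @ _)).
  suff -> : F = G by [].
  by apply/funext => h; rewrite /F /G /= addr0 scale0r add0r [h *: 1]mulr1.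
split=> -[d <-]; split; rewrite ?E//; first exact: (derivable1P f v e).1.
exact: (derivable1P f v e).2.
Qed.

Lemma Ck_comp k U f (g : R -> R) : open U -> Ck k U f -> Ck_line k g ->
  Ck k U (fun v => g (f v)).
Proof.
move=> oU; elim: k f g => [|k IH] f g cf cg.
  split=> // v Uv; apply: (@continuous_comp _ _ _ f g); first exact: cf.1.
  exact: cg.
have [g' dg cg'] := cg; have [cf1 df] := cf; split.
  move=> v Uv; apply: (@continuous_comp _ _ _ f g); first exact: cf1.
  exact: (is_derive_continuous dg).
move=> i; have [df1 df2] := df i.
have D v : U v -> is_derive v (delta_mx 0 i) (fun v => g (f v))
    (g' (f v) * 'D_(delta_mx 0 i) f v).
  move=> Uv; apply/is_derive_line; have /is_derive_line dfv := DeriveDef (df1 v Uv) erefl.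
  apply: (@is_derive1_comp _ g _ 0 _ _ _ dfv).
  by rewrite scale0r add0r.
split; first by move=> v /D[].
apply: (Ck_ext oU _ (CkM oU (IH _ _ (Ck_S cf) cg') df2)) => v Uv.
by have [_ ->] := D v Uv.
Qed.

Lemma Ck_prod k U (I : Type) (r : seq I) (f : I -> 'rV[R]_n -> R) : open U ->
  (forall i, Ck k U (f i)) -> Ck k U (fun v => \prod_(i <- r) f i v).
Proof.
move=> oU cf; elim: r => [|i r IH].
  by apply: (Ck_ext oU _ (Ck_const k U 1)) => v _; rewrite big_nil.
by apply: (Ck_ext oU _ (CkM oU (cf i) IH)) => v _; rewrite big_cons.
Qed.
End CkCalculus.

(** The usual smooth step, equal to 0 for t <= 0 and to 1 for t >= 1. *)
Definition step (R : realType) (t : R) : R := flat 0 t / (flat 0 t + flat 0 (1 - t)).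

Section Step.
Context {R : realType}.

Lemma step_denom_gt0 (t : R) : 0 < flat 0 t + flat 0 (1 - t).
Proof.
have [t0|t0] := ltP 0 t.
  by rewrite ltr_wpDr ?flat_gt0 ?flat_ge0.
by rewrite ltr_wpDl ?flat_ge0 ?flat_gt0// subr_gt0 (le_lt_trans t0).
Qed.

Lemma step_ge1 (t : R) : 1 <= t -> step t = 1.
Proof.
move=> t1; rewrite /step [flat 0 (1 - t)]/flat subr_gt0 ltNge t1 /= addr0.
by rewrite divff// gt_eqF// flat_gt0// (lt_le_trans _ t1).
Qed.

Lemma step_le0 (t : R) : t <= 0 -> step t = 0.
Proof. by move=> t0; rewrite /step /flat ltNge t0 mul0r. Qed.

Lemma Ck_step n k (U : set 'rV[R]_n) f : open U -> Ck k U f ->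
  Ck k U (fun v => step (f v)).
Proof.
move=> oU cf; have c0 := Ck_comp oU cf (Ck_line_flat k 0).
apply: CkM => //; apply: CkV => //.
  by move=> v _; rewrite gt_eqF// step_denom_gt0.
apply: CkD => //; apply: Ck_comp (Ck_line_flat k 0) => //.
apply: (Ck_ext oU _ (Ck_linear (-1) oU cf (Ck_const k U 1))) => v _.
by rewrite mulN1r addrC.
Qed.
End Step.

(** * Smooth functions on a manifold, bumps and partitions of unity *)

Section SmoothFunctions.
Context {R : realType} {n : nat} {M : manifold R n}.
Implicit Types (f g : M -> R) (x y : M) (U V : set M).

Lemma smooth_at_near f x : smooth_at f x -> \forall y \near x, smooth_at f y.
Proof.
move=> [U [oU Ux sU]]; have : nbhs x U by exact: open_nbhs_nbhs.
by apply: filterS => y Uy; exists U.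
Qed.

Lemma near_open_nbhs x (P : set M) : (\forall y \near x, P y) ->
  exists U, [/\ open U, U x & U `<=` P].
Proof. by move=> H; exists P°; split; [exact: open_interior|exact: H|exact: interior_subset]. Qed.

Lemma smooth_at_eq_near f g x : (\forall y \near x, f y = g y) ->
  smooth_at f x -> smooth_at g x.
Proof.
move=> /near_open_nbhs[V [oV Vx fg]] [U [oU Ux sU]].
exists (U `&` V); split=> //; first exact: openI.
move=> c Ac k; have oc := @chart_open _ _ _ c _ (openI oU oV).
apply: (@Ck_ext _ _ _ _ (fun v => f (cinv c v)) (fun v => g (cinv c v)) oc).
  by move=> v [_ [_ /fg]].
by apply: Ck_sub (sU c Ac k) => v [cv []].
Qed.

Lemma smooth_at_cst (c : R) x : smooth_at (fun=> c) x.
Proof. by exists setT; split=> // [|d _ k]; [exact: openT|exact: Ck_const]. Qed.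

Lemma smooth_atM f g x : smooth_at f x -> smooth_at g x ->
  smooth_at (fun y => f y * g y) x.
Proof.
move=> [U [oU Ux sU]] [V [oV Vx sV]].
have oUV : open (U `&` V) by exact: openI.
exists (U `&` V); split=> // c Ac k.
apply: CkM; first exact: chart_open.
  by apply: Ck_sub (sU c Ac k) => v [cv []].
by apply: Ck_sub (sV c Ac k) => v [cv []].
Qed.

Lemma smooth_atD f g x : smooth_at f x -> smooth_at g x ->
  smooth_at (fun y => f y + g y) x.
Proof.
move=> sf sg; have := smooth_at_linear 1 sf sg.
by congr smooth_at; apply/funext => y; rewrite mul1r.
Qed.

Lemma smooth_at_prod (I : Type) (r : seq I) (f : I -> M -> R) x :
  (forall i, smooth_at (f i) x) -> smooth_at (fun y => \prod_(i <- r) f i y) x.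
Proof.
move=> sf; elim: r => [|i r IH].
  by rewrite (_ : (fun=> _) = fun=> 1); [exact: smooth_at_cst|apply/funext => y; rewrite big_nil].
rewrite (_ : (fun=> _) = fun y => f i y * \prod_(j <- r) f j y).
  exact: smooth_atM.
by apply/funext => y; rewrite big_cons.
Qed.

(** The supports are compact in a chart domain, hence closed in [M] because [M]
    is Hausdorff. *)
Lemma smooth_bump x U : open U -> U x -> exists f : M -> R,
  [/\ forall y, smooth_at f y,
      exists W, [/\ open W, W x & forall y, W y -> f y = 1]
    & exists K, [/\ closed K, K `<=` U & forall y, ~ K y -> f y = 0]].
Proof.
move=> oU Ux; have [c Ac cx] := atlas_cover x.
set u := cmap c x; set O := ccod c `&` cinv c @^-1` U.
have Ou : O u by split; [exact: cmap_cod|rewrite /= /u cmapK].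
have oO : open O by exact: chart_open.
have [d d0 dO] : exists2 d : R, 0 < d &
    forall v : 'rV[R]_n, (forall i, `|u 0 i - v 0 i| < d) -> O v.
  have : nbhs u O by exact: open_nbhs_nbhs.
  move=> /nbhs_ballP[d d0 dO]; exists d => // v hv; apply: dO.
  by split=> // i j; rewrite ord1; exact: hv.
(* The bump will be 1 on the cube of radius [e] and 0 off the cube of radius [2 * e], which lies in
   the cube of radius [d] contained in [O]. *)
pose e := d / 3.
have e0 : 0 < e by rewrite divr_gt0.
pose phi (v : 'rV[R]_n) :=
  \prod_i (step (2 - (v 0 i - u 0 i) / e) * step (2 + (v 0 i - u 0 i) / e)).
pose box := [set v : 'rV[R]_n | forall i, v 0 i \in `[u 0 i - 2 * e, u 0 i + 2 * e]].
have boxO : box `<=` O.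
  move=> v bv; apply: dO => i; have := bv i; rewrite in_itv /= => /andP[h1 h2].
  by rewrite ltr_norml; apply/andP; split; rewrite /e in h1 h2; lra.
have phi0 v : ~ box v -> phi v = 0.
  move=> /existsNP[i bi]; rewrite /phi (bigD1 i)//=; apply/eqP; rewrite mulf_eq0.
  apply/orP; left; apply/eqP.
  have [h|h] := leP (v 0 i) (u 0 i + 2 * e); last first.
    rewrite step_le0 ?mul0r// subr_le0 ler_pdivlMr//; lra.
  have [h'|h'] := leP (u 0 i - 2 * e) (v 0 i).
    by exfalso; apply: bi; rewrite in_itv /= h h'.
  rewrite [X in _ * X]step_le0 ?mulr0//.
  have : (v 0 i - u 0 i) / e <= - 2 by rewrite ler_pdivrMr//; lra.
  lra.
have phi1 (v : 'rV[R]_n) : (forall i, `|u 0 i - v 0 i| < e) -> phi v = 1.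
  move=> hv; apply: big1 => i _; have := hv i; rewrite ltr_norml => /andP[h1 h2].
  have a1 : (v 0 i - u 0 i) / e <= 1 by rewrite ler_pdivrMr//; lra.
  have a2 : -1 <= (v 0 i - u 0 i) / e by rewrite ler_pdivlMr//; lra.
  by rewrite !step_ge1 ?mulr1//; lra.
have cbox : compact box.
  apply: (@rV_compact R^o _ (fun i => `[u 0 i - 2 * e, u 0 i + 2 * e]%classic)).
  by move=> i; exact: segment_compact.
pose K := cinv c @` box.
have clK : closed K.
  apply: compact_closed; first exact: pt_hausdorff.
  apply: continuous_compact => //.
  apply: continuous_in_subspaceT => v /set_mem bv; apply: cinv_cont.
  by have [] := boxO _ bv.
have KU : K `<=` U by move=> _ [v /boxO[_ ?] <-].
have Kc : K `<=` cdom c by move=> _ [v /boxO[/cinv_dom ? _] <-].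
pose f y := if pselect (cdom c y) then phi (cmap c y) else 0.
have f0 y : ~ K y -> f y = 0.
  move=> nK; rewrite /f; case: pselect => // cy; apply: phi0 => by_.
  by apply: nK; exists (cmap c y); rewrite ?cmapK.
exists f; split; last by exists K.
- move=> y; have [cy|ncy] := pselect (cdom c y); last first.
    exists (~` K); split; [exact: closed_openC|by move=> /Kc|].
    move=> b Ab k; apply: (Ck_ext (@chart_open _ _ _ b _ (closed_openC clK)) _ (Ck_0 k _)).
    by move=> v [_ nK]; rewrite f0.
  exists (cdom c); split; [exact: cdom_open|by []|] => b Ab k.
  have oc := @chart_open _ _ _ b _ (@cdom_open _ _ _ c).
  apply: (Ck_ext oc (f := fun v => phi (cmap c (cinv b v)))).
    by move=> v [bv cv]; rewrite /f; case: pselect.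
  have cc i : Ck k (ccod b `&` cinv b @^-1` cdom c) (fun v => (cmap c (cinv b v) 0 i - u 0 i) / e).
    apply: CkM => //; last exact: Ck_const.
    by apply: CkD => //; [exact: atlas_smooth|exact: Ck_const].
  apply: Ck_prod => // i; apply: CkM => //; apply: Ck_step => //.
    apply: (Ck_ext oc _ (Ck_linear (-1) oc (cc i) (Ck_const k _ 2))) => v _.
    by rewrite mulN1r addrC.
  by apply: CkD => //; exact: Ck_const.
- suff /near_open_nbhs[W [oW Wx WP]] : \forall y \near x, f y = 1 by exists W.
  have c1 : \forall y \near x, cdom c y by apply: open_nbhs_nbhs; split=> //; exact: cdom_open.
  have c2 : \forall y \near x, forall i, `|u 0 i - cmap c y 0 i| < e.
    apply: (@cmap_cont _ _ _ c x cx [set v | forall i, `|u 0 i - v 0 i| < e]).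
    apply/nbhs_ballP; exists e => // v [_ hv] i; exact: (hv 0 i).
  near=> y; rewrite /f; case: pselect => [cy|ncy].
    by apply: phi1; near: y.
  by exfalso; apply: ncy; near: y.
Unshelve. all: by end_near. Qed.

(** With bumps [f_i] equal to [1] on open sets covering [M], the functions
    [f_i * \prod_(j < i) (1 - f_j)] vanish for [i > m] where [f_m = 1], and
    their sums telescope. *)
Lemma smooth_partition (U : M -> set M) : (forall x, open (U x) /\ U x x) ->
  exists (psi : nat -> M -> R) (z : nat -> option M),
  [/\ forall i y, smooth_at (psi i) y,
      forall i, if z i is Some w then
        exists K, [/\ closed K, K `<=` U w & forall y, ~ K y -> psi i y = 0]
        else forall y, psi i y = 0
    & forall x, exists V m, [/\ open V, V x & forall y, V y ->
        (forall i, (m <= i)%N -> psi i y = 0) /\ \sum_(i < m) psi i y = 1]].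
Proof.
move=> hU.
have /choice[f hf] : forall x, exists fW : (M -> R) * set M,
    [/\ forall y, smooth_at fW.1 y, open fW.2, fW.2 x, forall y, fW.2 y -> fW.1 y = 1
    & exists K, [/\ closed K, K `<=` U x & forall y, ~ K y -> fW.1 y = 0]].
  move=> x; have [oU Ux] := hU x.
  by have [f [sf [W [oW Wx W1]] hK]] := smooth_bump oU Ux; exists (f, W).
have [B /countable_injP[g ginj] [Bo Bb]] := @pt_countable _ _ M.
(* Index [i] numbers a set of the countable basis, and [z i] picks a point whose plateau (where its
   bump is 1) contains that set. Countably many plateaus then still cover the manifold. *)
pose good i w := exists2 b, B b & g b = i /\ b `<=` (f w).2.
pose z i := if pselect (exists w, good i w) is left h then Some (projT1 (cid h)) else None.
pose F i y := if z i is Some w then (f w).1 y else 0.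
pose psi i y := F i y * \prod_(j < i) (1 - F j y).
have sF i y : smooth_at (F i) y.
  by rewrite /F; case: (z i) => [w|]; [have [] := hf w|exact: smooth_at_0].
have sumpsi m y : \sum_(i < m) psi i y = 1 - \prod_(j < m) (1 - F j y).
  elim: m => [|m IH]; first by rewrite !big_ord0 subrr.
  by rewrite !big_ord_recr /= IH /psi; ring.
exists psi, z; split.
- move=> i y; apply: smooth_atM => //.
  apply: (@smooth_at_prod _ _ (fun (j : 'I_i) y => 1 - F j y)) => j.
  rewrite (_ : (fun y => 1 - F j y) = fun y => -1 * F j y + 1); last first.
    by apply/funext => w; rewrite mulN1r addrC.
  by apply: smooth_at_linear => //; exact: smooth_at_cst.
- move=> i; rewrite /psi /F; case: (z i) => [w|y]; last by rewrite mul0r.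
  have [_ _ _ _ [K [cK KU K0]]] := hf w; exists K; split=> // y nK.
  by rewrite K0// mul0r.
move=> x; have [sf oW Wx W1 _] := hf x.
have : nbhs x (f x).2 by exact: open_nbhs_nbhs.
move=> /Bb[b [Bb' bx] bW].
have gz : exists w, good (g b) w by exists x; exists b.
(* The point chosen for the index of [b] need not be [x]; injectivity of the numbering ensures that
   its plateau contains the same [b]. *)
have [w zw hw] : exists2 w, z (g b) = Some w & b `<=` (f w).2.
  rewrite /z; case: pselect => // h; case: (cid h) => w /= [b' Bb'' [gb' b'w]].
  exists w => //; suff -> : b = b' by [].
  by apply: ginj; rewrite ?inE.
exists b, (g b).+1; split; [exact: Bo|by []|] => y hby.
have F1 : F (g b) y = 1.
  by rewrite /F zw; have [_ _ _ h _] := hf w; exact/h/hw.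
have P0 m : (g b < m)%N -> \prod_(j < m) (1 - F j y) = 0.
  by move=> hm; rewrite (bigD1 (Ordinal hm))//= F1 subrr mul0r.
by split=> [i hi|]; [rewrite /psi P0 ?mulr0|rewrite sumpsi P0 ?subr0].
Qed.
End SmoothFunctions.

(** * Bundles and forms *)

Section Bundles.
Context {R : realType} {n : nat} {M : manifold R n}.
Implicit Types (E : vbundle M) (x y : M) (U V : set M).

Lemma vsmooth_eq_near E (s t : forall y, E y) x : (\forall y \near x, s y = t y) ->
  vsmooth s x -> vsmooth t x.
Proof.
have [U [e [oU Ux _ H]]] := vframe E x.
move=> st /(H x Ux)[c [sc ec]]; apply/(H x Ux); exists c; split=> //.
by near=> y; rewrite -(near st y)// (near ec y).
Unshelve. all: by end_near. Qed.

Lemma vsmooth_near E (s : forall y, E y) x : vsmooth s x ->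
  \forall y \near x, vsmooth s y.
Proof.
have [U [e [oU Ux _ H]]] := vframe E x.
move=> /(H x Ux)[c [sc /near_open_nbhs[V [oV Vx ec]]]].
have sc' : \forall y \near x, forall i, smooth_at (c i) y.
  by apply: filter_forall => i; exact: smooth_at_near.
have : nbhs x (U `&` V) by apply: open_nbhs_nbhs; split=> //; exact: openI.
move=> UV; near=> y; have [Uy Vy] : (U `&` V) y by near: y.
apply/(H y Uy); exists c; split; first by near: y.
have : nbhs y V by exact: open_nbhs_nbhs.
by apply: filterS => z /ec.
Unshelve. all: by end_near. Qed.

Lemma vsmoothZ E (f : M -> R) (s : forall y, E y) x : smooth_at f x ->
  vsmooth s x -> vsmooth (fun y => f y *: s y) x.
Proof.
have [U [e [oU Ux _ H]]] := vframe E x.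
move=> sf /(H x Ux)[c [sc ec]]; apply/(H x Ux).
exists (fun i y => f y * c i y); split; first by move=> i; exact: smooth_atM.
near=> y; rewrite (near ec y)// scaler_sumr; apply: eq_bigr => i _.
by rewrite scalerA.
Unshelve. all: by end_near. Qed.

Lemma vsmoothD E (s t : forall y, E y) x : vsmooth s x -> vsmooth t x ->
  vsmooth (fun y => s y + t y) x.
Proof.
move=> ss st; have := vsmooth_linear 1 ss st.
by apply: vsmooth_eq_near; near=> y; rewrite scale1r.
Unshelve. all: by end_near. Qed.

Lemma vsmooth_sum E (I : Type) (r : seq I) (s : I -> forall y, E y) x :
  (forall i, vsmooth (s i) x) -> vsmooth (fun y => \sum_(i <- r) s i y) x.
Proof.
move=> ss; elim: r => [|i r IH].
  by apply: vsmooth_eq_near (vsmooth_0 E x); near=> y; rewrite big_nil.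
apply: vsmooth_eq_near (vsmoothD (ss i) IH); near=> y; by rewrite big_cons.
Unshelve. all: by end_near. Qed.

Lemma gsmooth_extension E (s : forall y, E y) x : vsmooth s x ->
  exists2 t : forall y, E y, gsmooth t & \forall y \near x, t y = s y.
Proof.
move=> /vsmooth_near/near_open_nbhs[U [oU Ux sU]].
have [f [sf [W [oW Wx W1]] [K [cK KU K0]]]] := smooth_bump oU Ux.
exists (fun y => f y *: s y).
  move=> y; have [Uy|nU] := pselect (U y); first by apply: vsmoothZ => //; exact: sU.
  apply: vsmooth_eq_near (vsmooth_0 E y).
  have : nbhs y (~` K) by apply: open_nbhs_nbhs; split; [exact: closed_openC|move=> /KU].
  by apply: filterS => z /K0 ->; rewrite scale0r.
have : nbhs x W by exact: open_nbhs_nbhs.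
by apply: filterS => z /W1 ->; rewrite scale1r.
Qed.

Lemma gsmooth_through E x (v : E x) : exists2 t : forall y, E y, gsmooth t & t x = v.
Proof.
have [U [e [oU Ux sp H]]] := vframe E x; have [c [-> _]] := sp x Ux v.
have [|t gt ts] := @gsmooth_extension E (fun y => \sum_i c 0 i *: e i y) x.
  apply/(H x Ux); exists (fun i _ => c 0 i); split=> [i|].
    exact: smooth_at_cst.
  exact: nearW.
by exists t => //; exact: nbhs_singleton ts.
Qed.

Definition frame_on E U m (b : 'I_m -> forall y, E y) :=
  (forall y, U y -> forall v : E y,
     exists! c : 'rV[R]_m, v = \sum_i c 0 i *: b i y) /\
  (forall y, U y -> forall s : (forall z, E z), vsmooth s y <->
     exists c : 'I_m -> M -> R, (forall i, smooth_at (c i) y) /\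
       \forall z \near y, s z = \sum_i c i z *: b i z).

Definition frame_coord E m (b : 'I_m -> forall y, E y) y (v : E y) : 'rV[R]_m :=
  xget 0 [set c : 'rV[R]_m | v = \sum_i c 0 i *: b i y].

Section Frame.
Context {E : vbundle M} {U : set M} {m : nat} {b : 'I_m -> forall y, E y}.
Hypothesis fb : frame_on U b.

Lemma frame_coordP y (v : E y) : U y -> v = \sum_i frame_coord b v 0 i *: b i y.
Proof.
move=> Uy; have [c [vc _]] := fb.1 y Uy v.
exact: (@xgetPex _ _ [set c : 'rV[R]_m | v = \sum_i c 0 i *: b i y] (ex_intro _ c vc)).
Qed.

Lemma frame_coord_uniq y (v : E y) (c : 'I_m -> R) : U y ->
  v = \sum_i c i *: b i y -> forall i, frame_coord b v 0 i = c i.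
Proof.
move=> Uy vc i; have [c' [_ u]] := fb.1 y Uy v.
rewrite -(u _ (frame_coordP v Uy)) (u (\row_i c i)) ?mxE//.
by rewrite vc; apply: eq_bigr => j _; rewrite mxE.
Qed.

Lemma frame_coord_linear y (a : R) (u v : E y) i : U y ->
  frame_coord b (a *: u + v) 0 i = a * frame_coord b u 0 i + frame_coord b v 0 i.
Proof.
move=> Uy.
apply: (@frame_coord_uniq _ _ (fun i => a * frame_coord b u 0 i + frame_coord b v 0 i)) => //.
rewrite {1}(frame_coordP u Uy) {1}(frame_coordP v Uy) scaler_sumr -big_split.
by apply: eq_bigr => j _; rewrite scalerDl scalerA.
Qed.

Lemma frame_coord0 y i : U y -> frame_coord b (0 : E y) 0 i = 0.
Proof.
move=> Uy; apply: (@frame_coord_uniq _ _ (fun=> 0)) => //.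
by rewrite big1// => j _; rewrite scale0r.
Qed.

Lemma frame_coord_smooth (s : forall z, E z) y i : open U -> U y -> vsmooth s y ->
  smooth_at (fun z => frame_coord b (s z) 0 i) y.
Proof.
move=> oU Uy /(fb.2 y Uy)[c [sc ec]]; apply: smooth_at_eq_near (sc i).
have nU : nbhs y U by exact: open_nbhs_nbhs.
by near=> z; apply/esym/(frame_coord_uniq (c := fun i => c i z)); near: z.
Unshelve. all: by end_near. Qed.

Lemma frame_smooth i y : U y -> vsmooth (b i) y.
Proof.
move=> Uy; apply/(fb.2 y Uy); exists (fun j _ => (i == j)%:R); split.
  by move=> j; exact: smooth_at_cst.
apply: nearW => z; rewrite (bigD1 i)//= eqxx scale1r big1 ?addr0// => j.
by rewrite eq_sym => /negbTE ->; rewrite scale0r.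
Qed.

Lemma frame_onS V : V `<=` U -> frame_on V b.
Proof. by move=> VU; split=> y /VU Uy; [exact: fb.1|exact: fb.2]. Qed.
End Frame.
End Bundles.

Lemma args_S R n (M : manifold R n) (A : vbundle M) (a : nat -> forall x, A x) p x :
  args a p.+1 x = a 0%N x :: args (fun i => a i.+1) p x.
Proof. by rewrite /args /mkseq /= -[1%N]addn0 iotaDl -map_comp. Qed.

(** * Forms on a bundle, their products and their extension by zero *)

Section Forms.
Context {R : realType} {n : nat} {M : manifold R n} {A : vbundle M}.
Implicit Types (U V : set M) (x y : M) (al be : sform A).

Lemma wedgeE (W : M -> lmodType R) al (w : forall x, seq (A x) -> W x) x s :
  wedge al w s = shuf (al x) (w x) s.
Proof. by []. Qed.

Section Wedge.
Context {W : M -> lmodType R} {sm : (forall x, W x) -> M -> Prop}.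
Hypothesis smD : forall s t x, sm s x -> sm t x -> sm (fun y => s y + t y) x.
Hypothesis smZ : forall f s x, smooth_at f x -> sm s x -> sm (fun y => f y *: s y) x.

(** Induction on the number of arguments through [shuf_cons]; smoothness is assumed for all families
    of sections, so it passes to contractions with the first section. *)
Lemma shuf_smooth al (w : forall x, seq (A x) -> W x) x :
  (forall (a : nat -> forall y, A y) p, (forall i, vsmooth (a i) x) ->
     smooth_at (fun y => al y (args a p y)) x) ->
  (forall (a : nat -> forall y, A y) p, (forall i, vsmooth (a i) x) ->
     sm (fun y => w y (args a p y)) x) ->
  forall (a : nat -> forall y, A y) p, (forall i, vsmooth (a i) x) ->
     sm (fun y => shuf (al y) (w y) (args a p y)) x.
Proof.
move=> hal hw a p sa; elim: p a al w hal hw sa => [|p IH] a al w hal hw sa.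
  rewrite (_ : (fun y => _) = fun y => al y (args a 0 y) *: w y (args a 0 y)).
    by apply: smZ; [exact: hal|exact: hw].
  by apply: functional_extensionality_dep => y; rewrite shuf_nil.
rewrite (_ : (fun y => _) = fun y =>
  shuf (fun t => al y (a 0%N y :: t)) (w y) (args (fun i => a i.+1) p y) +
  shuf (twist (al y)) (fun t => w y (a 0%N y :: t)) (args (fun i => a i.+1) p y)).
  have contr (b : nat -> forall y, A y) : (forall i, vsmooth (b i) x) ->
      forall i, vsmooth ((fun i => if i is j.+1 then b j else a 0%N) i) x.
    by move=> sb [|i]; [exact: sa|exact: sb].
  apply: smD; apply: IH => //.
  - move=> b q sb; have := hal _ q.+1 (contr _ sb).
    by congr smooth_at; apply/funext => y; rewrite args_S.
  - move=> b q sb; rewrite (_ : (fun y => _) = fun y => (-1) ^+ q * al y (args b q y)).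
      by apply: smooth_atM; [exact: smooth_at_cst|exact: hal].
    by apply/funext => y; rewrite /twist size_mkseq.
  - move=> b q sb; have := hw _ q.+1 (contr _ sb).
    by congr sm; apply: functional_extensionality_dep => y; rewrite args_S.
by apply: functional_extensionality_dep => y; rewrite args_S shuf_cons.
Qed.

Lemma is_form_wedge U al (w : forall x, seq (A x) -> W x) :
  @is_form R n M A (fun=> R^o) (@smooth_at R n M) U al -> is_form sm U w ->
  is_form sm U (wedge al w).
Proof.
move=> fal fw x Ux; have [aal sal] := fal x Ux; have [aw sw] := fw x Ux.
by split; [exact: alternating_shuf|move=> a p sa; exact: shuf_smooth].
Qed.

Lemma is_form_eq U (v w : forall x, seq (A x) -> W x) :
  (forall s t x, (\forall y \near x, s y = t y) -> sm s x -> sm t x) ->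
  open U -> (forall x, U x -> forall s, v x s = w x s) ->
  is_form sm U v -> is_form sm U w.
Proof.
move=> sme oU vw fv x Ux; have [av sv] := fv x Ux; split.
  by rewrite -(_ : v x = w x)//; apply/funext => s; exact: vw.
move=> a p sa; apply: sme (sv a p sa).
have : nbhs x U by exact: open_nbhs_nbhs.
by apply: filterS => y Uy; exact: vw.
Qed.
End Wedge.

Lemma alternating_rank (W : lmodType R) x (w : seq (A x) -> W) s :
  Defs.alternating w -> (vrk A < size s)%N -> w s = 0.
Proof.
move=> aw; have [U [e [oU Ux sp H]]] := vframe A x.
apply: (alternating_gt_rank (e := fun i => e i x)) => // v.
by have [c [-> _]] := sp x Ux v; exists (fun i => c 0 i).
Qed.

Lemma Omega_rank U p al x s : Omega U p al -> (vrk A < p)%N -> U x -> al x s = 0.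
Proof.
move=> [fal dal] hp Ux; have [/eqP e|/eqP ne] := eqVneq (size s) p.
  by apply: (@alternating_rank R^o); rewrite ?(eqP e)//; exact: (fal x Ux).1.
exact: dal.
Qed.

Lemma Omega_sub U V p al : V `<=` U -> Omega U p al -> Omega V p al.
Proof. by move=> VU [f d]; split=> [x /VU/f|x /VU/d]. Qed.

Lemma Omega0 U p : Omega U p ((fun _ _ => 0) : sform A).
Proof.
split=> // x Ux; split; last by move=> *; exact: smooth_at_0.
by split=> // s t c u v; rewrite scaler0 addr0.
Qed.

Lemma Omega_linear U p c al be : Omega U p al -> Omega U p be ->
  Omega U p (fun x s => c * al x s + be x s).
Proof.
move=> [f d] [f' d']; split; last first.
  by move=> x Ux s hs; rewrite d// d'// mulr0 addr0.
move=> x Ux; have [[l a] s] := f x Ux; have [[l' a'] s'] := f' x Ux.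
split; last first.
  by move=> b p' sb; apply: smooth_at_linear; [exact: s|exact: s'].
split=> [u t k v w|u t r v]; last by rewrite a a' mulr0 addr0.
by rewrite l l' /GRing.scale /=; ring.
Qed.

Lemma OmegaD U p al be : Omega U p al -> Omega U p be ->
  Omega U p (fun x s => al x s + be x s).
Proof.
move=> oa ob; have := Omega_linear 1 oa ob; congr Omega.
by apply: functional_extensionality_dep => x; apply/funext => s; rewrite mul1r.
Qed.

Lemma Omega_wedge U p q al be : Omega U p al -> Omega U q be ->
  Omega U (p + q) (wedges al be).
Proof.
move=> [f d] [f' d']; split.
  apply: (@is_form_wedge (fun=> R^o)) f f'.
    by move=> *; exact: smooth_atD.
  by move=> *; exact: smooth_atM.
by move=> x Ux s; apply: shuf_degree => t; [exact: d|exact: d'].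
Qed.

Definition funform (f : M -> R) : sform A := fun x s => if s is [::] then f x else 0.

Lemma Omega_funform U f : (forall x, U x -> smooth_at f x) -> Omega U 0 (funform f).
Proof.
move=> sf; split=> [x Ux|x _ []//]; split.
  by split=> [[|u s] t c v w|[|u s] t r v] /=; rewrite ?scaler0 ?addr0.
move=> a [|p] sa; first exact: sf.
by rewrite (_ : (fun y => _) = fun=> 0); [exact: smooth_at_0|apply/funext => y; rewrite args_S].
Qed.

Lemma Omega_const U c : Omega U 0 (constform c : sform A).
Proof. by apply: (@Omega_funform U (fun=> c)) => x _; exact: smooth_at_cst. Qed.

(** The form [al] is arbitrary outside [U], but every point there has the complement of [K] as a
    neighbourhood, on which the product vanishes. *)
Lemma Omega_extend U K p f al : open U -> closed K -> K `<=` U ->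
  (forall y, ~ K y -> f y = 0) -> (forall x, smooth_at f x) -> Omega U p al ->
  Omega setT p (fun x s => f x * al x s).
Proof.
move=> oU cK KU f0 sf [fa da].
have E x : ~ U x -> \forall y \near x, f y = 0.
  move=> nU; have : nbhs x (~` K) by apply: open_nbhs_nbhs; split; [exact: closed_openC|move=> /KU].
  by apply: filterS => y /f0.
split=> [x _|x _ s hs]; last first.
  have [Ux|/E/nbhs_singleton->] := pselect (U x); last by rewrite mul0r.
  by rewrite da// mulr0.
have [Ux|/E nx] := pselect (U x).
  have [[l a] s] := fa x Ux; split; last first.
    by move=> b q sb; apply: smooth_atM => //; exact: s.
  split=> [u t k v w|u t r v]; last by rewrite a mulr0.
  by rewrite l /GRing.scale /=; ring.
have fx0 := nbhs_singleton nx; split.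
  by split=> *; rewrite /= fx0 !mul0r// scaler0 addr0.
move=> b q sb; apply: smooth_at_eq_near (smooth_at_0 x).
by apply: filterS nx => y ->; rewrite mul0r.
Qed.
End Forms.

(** * Sections of the pullback *)

Section Pullback.
Context {R : realType} {n : nat} {M : manifold R n} {A : vbundle M} {E : int -> vbundle M}.
Implicit Types (U V : set M) (x y : M) (i k l : int).

Lemma psecP U k (w : psec A E U k) : is_psec U k (pval w).
Proof. by have /asboolP := pvalP w. Qed.

Lemma pval_linear U k a (v w : psec A E U k) x i s :
  pval (a *: v + w) x i s = a *: pval v x i s + pval w x i s.
Proof. by []. Qed.

Lemma pvalD U k (v w : psec A E U k) x i s :
  pval (v + w) x i s = pval v x i s + pval w x i s.
Proof. by []. Qed.

Lemma pvalZ U k a (w : psec A E U k) x i s : pval (a *: w) x i s = a *: pval w x i s.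
Proof. by []. Qed.

Lemma pvalB U k (v w : psec A E U k) x i s :
  pval (v - w) x i s = pval v x i s - pval w x i s.
Proof. by []. Qed.

Lemma pval0 U k x i s : pval (0 : psec A E U k) x i s = 0.
Proof. by []. Qed.

Lemma pval_sum U k (I : Type) (r : seq I) (w : I -> psec A E U k) x i s :
  pval (\sum_(j <- r) w j) x i s = \sum_(j <- r) pval (w j) x i s.
Proof. by elim: r => [|j r IH]; rewrite ?big_nil ?big_cons// pvalD IH. Qed.

Lemma pval_degree U k (w : psec A E U k) x i s : (size s)%:Z + i <> k -> pval w x i s = 0.
Proof. by have [_ h _] := psecP w; exact: h. Qed.

Lemma pval_out U k (w : psec A E U k) x i s : ~ U x -> pval w x i s = 0.
Proof. by have [_ _ h] := psecP w => nU; exact: h. Qed.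

Lemma psec_ext U k (v w : psec A E U k) :
  (forall x, U x -> forall i s, pval v x i s = pval w x i s) -> v = w.
Proof.
move=> vw; apply: val_inj; apply: raw_ext => x i s /=.
have [Ux|nU] := pselect (U x); first exact: vw.
by rewrite !pval_out.
Qed.

Definition mk_psec U k (w : rawform A E) : psec A E U k := insubd 0 w.

Lemma mk_psecE U k (w : rawform A E) : is_psec U k w -> pval (mk_psec U k w) = w.
Proof. by move=> h; rewrite /mk_psec; apply: insubdK; apply/asboolP. Qed.

Lemma is_psec_res U V k w : open V -> V `<=` U -> is_psec U k w ->
  is_psec V k ((fun x i s => if x \in V then w x i s else 0) : rawform A E).
Proof.
move=> oV VU [f d o]; split; last 2 first.
- by move=> x i s h; rewrite d ?if_same.
- by move=> x nV i s; rewrite memNset.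
move=> i; apply: (@is_form_eq _ _ _ _ _ (@vsmooth _ _ _ (E i)) V (fun x => w x i)) => //.
- by move=> s t x; exact: vsmooth_eq_near.
- by move=> x Vx s; rewrite mem_set.
- by move=> x /VU; exact: f.
Qed.

Lemma pval_res U V k (w : psec A E U k) x i s : open V -> V `<=` U ->
  pval (res (pullback A E) U V k w) x i s = if x \in V then pval w x i s else 0.
Proof.
by move=> oV VU; rewrite [pval _](mk_psecE (is_psec_res oV VU (psecP w))).
Qed.

Lemma pval_resV U V k (w : psec A E U k) x i s : open V -> V `<=` U -> V x ->
  pval (res (pullback A E) U V k w) x i s = pval w x i s.
Proof. by move=> oV VU Vx; rewrite pval_res// mem_set. Qed.

Lemma is_psec_act U k p l al (w : psec A E U k) : open U -> Omega U p al ->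
  l = k + p%:Z -> is_psec U l ((fun x i s => if x \in U then
    @wedge R n M A (E i) al (fun y => pval w y i) x s else 0) : rawform A E).
Proof.
move=> oU [fa da] ->; have [f d o] := psecP w; split; last 2 first.
- move=> x i s h; case: ifPn => // /set_mem Ux; rewrite wedgeE.
  (* If [k - i] is negative, the component of [w] in [E i] is zero; otherwise it has form degree
     [j = k - i]. *)
  have [j|hj] := pselect (exists j : nat, j%:Z + i = k); last first.
    rewrite (_ : pval w x i = fun=> 0) ?shuf0r//; apply/funext => t.
    by apply: d => e; apply: hj; exists (size t).
  case: j => j e; apply: (@shuf_degree _ _ _ p j); first exact: da.
    by move=> t ht; apply: d => e'; apply: ht; move: e e'; lia.
  by move: h e; lia.
- by move=> x nU i s; rewrite memNset.
move=> i; apply: (@is_form_eq _ _ _ _ _ (@vsmooth _ _ _ (E i)) U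
    (@wedge R n M A (E i) al (fun y => pval w y i))) => //.
- by move=> s t x; exact: vsmooth_eq_near.
- by move=> x Ux s; rewrite mem_set.
apply: is_form_wedge => // *; [exact: vsmoothD|exact: vsmoothZ].
Qed.

Lemma pval_act U k p l al (w : psec A E U k) x i s : open U -> Omega U p al ->
  l = k + p%:Z -> U x ->
  pval (act (pullback A E) U k l al w) x i s = shuf (al x) (pval w x i) s.
Proof.
move=> oU oal kl Ux.
by rewrite [pval _](mk_psecE (is_psec_act w oU oal kl)) mem_set.
Qed.

Lemma is_form_alternating U k (w : psec A E U k) x i : U x ->
  Defs.alternating (pval w x i).
Proof. by have [f _ _] := psecP w => Ux; exact: (f i x Ux).1. Qed.

(** * Sections of the pullback whose parts of form degree 0 are frames form a basis *)

Section Coefficients.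
Context {U V : set M} {r : int -> nat} (b : forall i, 'I_(r i) -> psec A E U i).
Context {k : int}.
Hypotheses (oU : open U) (oV : open V) (VU : V `<=` U).

Let B : gsheaf A := pullback A E.

Lemma pval_gcomb (c : forall i, 'I_(r i) -> sform A) x i s :
  (forall (p : nat) j, Omega V p (c (k - p%:Z) j)) -> V x ->
  pval (gcomb (B := B) V b k c) x i s =
  \sum_(p < (vrk A).+1) \sum_(j < r (k - p%:Z))
     shuf (c (k - p%:Z) j x) (pval (b j) x i) s.
Proof.
move=> oc Vx; rewrite /gcomb pval_sum; apply: eq_bigr => p _.
rewrite pval_sum; apply: eq_bigr => j _.
rewrite (pval_act _ _ _ oV (oc p j))//; last by rewrite subrK.
by congr shuf; apply/funext => t; rewrite pval_resV.
Qed.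

Hypothesis fb : forall p : nat, (p <= vrk A)%N ->
  frame_on U (fun (j : 'I_(r (k - p%:Z))) y => pval (b j) y (k - p%:Z) [::]).

(** A generator of degree k - p has components only in the [E i] with i <= k - p. Hence the
    component in E (k - q) involves coefficients of form degree at most q only: the system is
    triangular with the frames on its diagonal. *)
Lemma psec_coefs_unique (c : forall i, 'I_(r i) -> sform A) :
  (forall (p : nat) j, Omega V p (c (k - p%:Z) j)) ->
  gcomb (B := B) V b k c = 0 ->
  forall (p : nat) j x, V x -> forall t, c (k - p%:Z) j x t = 0.
Proof.
move=> oc c0; elim/ltn_ind => q IH j x Vx t.
have [qm|qm] := leqP q (vrk A); last exact: Omega_rank (oc q j) qm Vx.
have := congr1 (fun w : psec A E V k => pval w x (k - q%:Z) t) c0.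
rewrite pval_gcomb// pval0 (bigD1 (Ordinal (qm : (q < (vrk A).+1)%N)))//= => h.
rewrite [X in _ + X = 0]big1 ?addr0 in h; last first.
  move=> p pq; apply: big1 => l _; have [pq'|pq'] := ltnP p q.
    rewrite (_ : c _ l x = fun=> 0) ?shuf0l//.
    by apply/funext => s; exact: IH.
  rewrite (_ : pval _ _ _ = fun=> 0) ?shuf0r//; apply/funext => s.
  apply: pval_degree; move: pq; rewrite -val_eqE /= => /eqP; lia.
have Ux := VU Vx.
rewrite -(frame_coord_uniq (fb qm) (c := fun j => c (k - q%:Z) j x t) (v := 0) Ux).
  exact: (frame_coord0 (fb qm)) Ux.
rewrite -[LHS]h; apply: eq_bigr => l _; rewrite shuf_deg0r// => s hs.
by apply: pval_degree; lia.
Qed.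

Lemma Omega_frame_coord (i : int) m (e : 'I_m -> forall y, E i y) p
    (w : forall x, seq (A x) -> E i x) j :
  frame_on U e -> is_form (@vsmooth _ _ _ (E i)) V w ->
  (forall x, V x -> forall s, size s <> p -> w x s = 0) ->
  Omega V p (fun x t => frame_coord e (w x t) 0 j).
Proof.
move=> fe fw dw; split=> [x Vx|x Vx s hs]; have Ux := VU Vx; last first.
  by rewrite dw// (frame_coord0 fe).
have [[l a] s] := fw x Vx; split; last first.
  by move=> a' q sa; apply: (frame_coord_smooth fe) => //; exact: s.
by split=> [*|*]; [rewrite l (frame_coord_linear fe)|rewrite a (frame_coord0 fe)].
Qed.

(** The components of form degree [q] of the two sides determine the
    coefficients of form degree [q] in terms of those of lower form degree. *)
Lemma psec_coefs_exist (w : psec A E V k) : exists c : forall i, 'I_(r i) -> sform A,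
  (forall (p : nat) j, Omega V p (c (k - p%:Z) j)) /\ w = gcomb (B := B) V b k c.
Proof.
(* The components in E (k - q') for q' < q are matched first; once q exceeds the rank of [A], every
   remaining component is zero. *)
suff H q : (q <= (vrk A).+1)%N -> exists c : forall i, 'I_(r i) -> sform A,
    (forall (p : nat) j, Omega V p (c (k - p%:Z) j)) /\
    forall q' : nat, (q' < q)%N -> forall x s, V x ->
      pval (w - gcomb (B := B) V b k c) x (k - q'%:Z) s = 0.
  have [c [oc hc]] := H _ (leqnn _); exists c; split=> //.
  apply/eqP; rewrite -subr_eq0; apply/eqP; apply: psec_ext => x Vx i s.
  rewrite pval0; have [e|ne] := pselect ((size s)%:Z + i = k); last exact: pval_degree.
  have -> : i = k - (size s)%:Z by lia.
  have [hs|hs] := leqP (size s) (vrk A); first exact: hc.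
  by apply: alternating_rank (hs); exact: is_form_alternating.
elim: q => [_|q IH hq].
  exists (fun _ _ _ _ => 0); split=> // p j; exact: Omega0.
have [c [oc hc]] := IH (ltnW hq).
set w' := w - gcomb (B := B) V b k c in hc.
(* The correction only concerns the generators of degree k - q, with the frame coordinates of the
   remainder as coefficients. By triangularity it does not disturb the components already
   matched. *)
pose d i (j : 'I_(r i)) : sform A := fun x t => if i == k - q%:Z then
  frame_coord (fun (l : 'I_(r i)) y => pval (b l) y i [::]) (pval w' x i t) 0 j else 0.
have od (p : nat) j : Omega V p (d (k - p%:Z) j).
  rewrite /d; case: (eqVneq (k - p%:Z) (k - q%:Z)) => [e|ne]; last exact: Omega0.
  have ep : p = q by move: e; lia.
  apply: Omega_frame_coord; first by apply: fb; rewrite ep.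
    by have [f _ _] := psecP w'; exact: f.
  by move=> x Vx s hs; apply: pval_degree; lia.
pose c' i j : sform A := fun x t => c i j x t + d i j x t.
exists c'; have oc' (p : nat) j : Omega V p (c' (k - p%:Z) j) by exact: OmegaD.
split=> // q' hq' x s Vx.
have -> : pval (w - gcomb (B := B) V b k c') x (k - q'%:Z) s =
    pval w' x (k - q'%:Z) s - \sum_(j < r (k - q%:Z))
      shuf (d (k - q%:Z) j x) (pval (b j) x (k - q'%:Z)) s.
  rewrite !pvalB !pval_gcomb// -addrA -opprD; congr (_ - _).
  transitivity (\sum_(p < (vrk A).+1) \sum_(j < r (k - p%:Z))
     (shuf (c (k - p%:Z) j x) (pval (b j) x (k - q'%:Z)) s +
      shuf (d (k - p%:Z) j x) (pval (b j) x (k - q'%:Z)) s)).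
    by apply: eq_bigr => p _; apply: eq_bigr => j _; rewrite -shufDl.
  under eq_bigr do rewrite big_split; rewrite big_split; congr (_ + _).
  rewrite (bigD1 (Ordinal hq))//= -[RHS]addr0; congr (_ + _); apply: big1 => p pq.
  apply: big1 => j _; rewrite (_ : d _ j x = fun=> 0) ?shuf0l//.
  apply/funext => t; rewrite /d; case: eqP => // e; exfalso.
  by move: pq e; rewrite -val_eqE /= => /eqP; lia.
have [qq|qq] := ltnP q' q.
  rewrite hc// big1 ?subr0// => j _.
  rewrite (_ : pval _ _ _ = fun=> 0) ?shuf0r//; apply/funext => t.
  by apply: pval_degree; lia.
have -> : q' = q by lia.
apply/eqP; rewrite subr_eq0; apply/eqP.
rewrite [LHS](frame_coordP (fb (hq : (q <= vrk A)%N)) _ (VU Vx)).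
apply: eq_bigr => j _; rewrite shuf_deg0r ?/d ?eqxx// => t ht.
by apply: pval_degree; lia.
Qed.
End Coefficients.
End Pullback.

(** * Sheaves of modules over the forms *)

Section LinearFunctions.
Context {R : pzRingType} {V W : lmodType R} {f : V -> W}.
Hypothesis lf : linear f.

Lemma lin0 : f 0 = 0.
Proof. by have := lf (-1) 0 0; rewrite scaler0 addr0 scaleN1r addNr. Qed.

Lemma linD u v : f (u + v) = f u + f v.
Proof. by have := lf 1 u v; rewrite !scale1r. Qed.

Lemma linZ c u : f (c *: u) = c *: f u.
Proof. by have := lf c u 0; rewrite lin0 !addr0. Qed.

Lemma linB u v : f (u - v) = f u - f v.
Proof. by rewrite linD -scaleN1r linZ scaleN1r. Qed.

Lemma lin_sum (I : Type) (r : seq I) (F : I -> V) :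
  f (\sum_(i <- r) F i) = \sum_(i <- r) f (F i).
Proof. by elim: r => [|i r IH]; rewrite ?big_nil ?lin0// !big_cons linD IH. Qed.
End LinearFunctions.

(** Uniqueness of coefficients says nothing about generators of degree above [k]; giving these the
    coefficient 0 makes the coefficients over [V] well determined for every [i]. *)
Definition local_coef R n (M : manifold R n) (A : vbundle M) (B : gsheaf A)
    (r : int -> nat) (U : set M) (e : forall i, 'I_(r i) -> sec B U i)
    (V : set M) (k : int) (s : sec B V k) : forall i, 'I_(r i) -> sform A :=
  fun i j x t => if i <= k then
    (xget (fun _ _ _ _ => 0) [set c : forall i, 'I_(r i) -> sform A |
      (forall (p : nat) j, Omega V p (c (k - p%:Z) j)) /\ s = gcomb V e k c])
    i j x t else 0.
Arguments local_coef {R n M A B r U} e {V k} s [i] j x t.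

(** Multiplication by a [q]-form raises the form degree of coefficients from p to p + q; this
    reindexes the sum, the terms gained or lost at both ends being zero. *)
Lemma sum_nat_shift (V : nmodType) (G : nat -> V) m q :
  (forall p, (p < q)%N -> G p = 0) -> (forall p, (m <= p)%N -> G p = 0) ->
  \sum_(0 <= p < m) G (p + q)%N = \sum_(0 <= p < m) G p.
Proof.
move=> G0 G1; transitivity (\sum_(0 <= p < m + q) G p).
  rewrite [RHS](big_cat_nat (n := q)) ?leq_addl//= [X in X + _]big_nat [X in X + _]big1 ?add0r.
    by rewrite -{2}[q]add0n big_addn addnK.
  by move=> p /andP[_]; exact: G0.
rewrite (big_cat_nat (n := m)) ?leq_addr//= [X in _ + X]big_nat [X in _ + X]big1 ?addr0//.
by move=> p /andP[hp _]; exact: G1.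
Qed.

Section Sheaf.
Context {R : realType} {n : nat} {M : manifold R n} {A : vbundle M}.
Context {B : gsheaf A} {r : int -> nat}.
Hypothesis gB : is_gbundle B r.
Implicit Types (U V W : set M) (x y : M) (i k l : int).

Lemma act_linear_eq U k p l al : open U -> Omega U p al -> l = k + p%:Z ->
  linear (act B U k l al).
Proof. by move=> oU oal ->; exact: (act_linear gB). Qed.

Lemma act_addl U k p l al be s : open U -> Omega U p al -> Omega U p be -> l = k + p%:Z ->
  act B U k l (fun x t => al x t + be x t) s = act B U k l al s + act B U k l be s.
Proof. by move=> oU oa ob ->; exact: (act_add gB). Qed.

Lemma act0l U k p l (al : sform A) s : open U -> l = k + p%:Z ->
  (forall x, U x -> forall t, al x t = 0) -> act B U k l al s = 0.
Proof.
move=> oU kl al0.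
have o0 : Omega U p ((fun _ _ => 0) : sform A) by exact: Omega0.
rewrite [LHS](_ : _ = act B U k l (fun _ _ => 0) s); last first.
  by apply: (act_ext gB) => // x Ux; exact/funext/al0.
have := act_addl s oU o0 o0 kl.
rewrite (_ : (fun x t => 0 + 0) = (fun _ _ => 0) :> sform A).
  by move=> /eqP; rewrite -subr_eq subrr => /eqP/esym.
by apply: functional_extensionality_dep => x; apply/funext => t; rewrite addr0.
Qed.

Lemma act_rank U k p l al s : open U -> Omega U p al -> l = k + p%:Z ->
  (vrk A < p)%N -> act B U k l al s = 0.
Proof.
by move=> oU oal kl hp; apply: (act0l s oU kl) => x Ux t; exact: Omega_rank oal hp Ux.
Qed.

Lemma act_res_eq U V k p l al s : open U -> open V -> V `<=` U -> Omega U p al ->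
  l = k + p%:Z -> res B U V l (act B U k l al s) = act B V k l al (res B U V k s).
Proof. by move=> oU oV VU oal ->; exact: (act_res gB). Qed.

(** The type of sections depends on the open set, so the description of [U] as a union is an
    equation to substitute, not one to rewrite with inside types. *)
Lemma sec_glue_eq U (C : set (set M)) k (s : forall V, sec B V k) :
  U = \bigcup_(V in C) V -> (forall V, C V -> open V) ->
  (forall V W, C V -> C W -> res B V (V `&` W) k (s V) = res B W (V `&` W) k (s W)) ->
  exists! t : sec B U k, forall V, C V -> res B U V k t = s V.
Proof. by move=> ->; exact: (sec_glue gB). Qed.

Lemma sec_eq_local U k (s t : sec B U k) : open U ->
  (forall x, U x -> exists V, [/\ open V, V x, V `<=` U & res B U V k s = res B U V k t]) ->
  s = t.
Proof.
move=> oU hst; pose C := [set V | [/\ open V, V `<=` U & res B U V k s = res B U V k t]].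
have UC : U = \bigcup_(V in C) V.
  apply/seteqP; split=> [x /hst[V [oV Vx VU e]]|x [V [oV VU e] Vx]]; last exact: VU.
  by exists V.
have [|V W [oV VU _] [oW WU _]|w [_ u]] := sec_glue_eq (s := fun V => res B U V k s) UC.
- by move=> V [].
- have oVW := openI oV oW.
  by rewrite !(res_comp gB)// => z [].
by rewrite -(u s)// (u t)// => V [].
Qed.

Definition local_basis U (e : forall i, 'I_(r i) -> sec B U i) (N : nat) :=
  open U /\ forall V k, open V -> V `<=` U -> (`|k| <= N%:Z)%R ->
    (forall s : sec B V k, exists c : forall i, 'I_(r i) -> sform A,
      (forall (p : nat) j, Omega V p (c (k - p%:Z) j)) /\ s = gcomb V e k c) /\
    (forall c : forall i, 'I_(r i) -> sform A,
      (forall (p : nat) j, Omega V p (c (k - p%:Z) j)) -> gcomb V e k c = 0 ->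
      forall (p : nat) j x, V x -> forall t, c (k - p%:Z) j x t = 0).

Section Gcomb.
Context {U : set M} (e : forall i, 'I_(r i) -> sec B U i).
Hypothesis oU : open U.

Lemma gcomb_ext V k (c d : forall i, 'I_(r i) -> sform A) : open V ->
  (forall (p : nat) j x, V x -> c (k - p%:Z) j x = d (k - p%:Z) j x) ->
  gcomb V e k c = gcomb V e k d.
Proof.
move=> oV cd; apply: eq_bigr => p _; apply: eq_bigr => j _.
by apply: (act_ext gB) => // x; exact: cd.
Qed.

Lemma gcomb_linear V k a (c d : forall i, 'I_(r i) -> sform A) : open V ->
  (forall (p : nat) j, Omega V p (c (k - p%:Z) j)) ->
  (forall (p : nat) j, Omega V p (d (k - p%:Z) j)) ->
  gcomb V e k (fun i j x t => a * c i j x t + d i j x t) =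
  a *: gcomb V e k c + gcomb V e k d.
Proof.
move=> oV oc od; rewrite /gcomb scaler_sumr -big_split; apply: eq_bigr => p _ /=.
rewrite scaler_sumr -big_split; apply: eq_bigr => j _ /=.
have kp : k = k - p%:Z + p%:Z by rewrite subrK.
set s := res _ _ _ _ _.
have Oa : Omega V 0 (constform a : sform A) by exact: Omega_const.
have oac : Omega V p (fun x t => a * c (k - p%:Z) j x t).
  have := Omega_linear a (oc p j) (Omega0 V p); congr Omega.
  by apply: functional_extensionality_dep => x; apply/funext => t; rewrite addr0.
rewrite (act_addl _ oV oac (od p j) kp); congr (_ + _).
rewrite -(act_const gB) ?oV// -(act_wedge (p := 0) (q := p) gB)//; last by rewrite addr0.
apply: (act_ext gB) => // x Vx; apply/funext => t.
rewrite /wedges wedgeE shuf_deg0l// => u hu; case: u hu => //.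
Qed.

Lemma gcomb_res V W k (c : forall i, 'I_(r i) -> sform A) : open V -> open W ->
  V `<=` U -> W `<=` V -> (forall (p : nat) j, Omega V p (c (k - p%:Z) j)) ->
  res B V W k (gcomb V e k c) = gcomb W e k c.
Proof.
move=> oV oW VU WV oc; rewrite /gcomb (lin_sum (res_linear gB (k := k) oV oW WV)).
apply: eq_bigr => p _; rewrite (lin_sum (res_linear gB (k := k) oV oW WV)).
apply: eq_bigr => j _.
rewrite (act_res_eq (p := p))//; last by rewrite subrK.
by rewrite (res_comp gB).
Qed.

(** Generators of degree in ]k, l] occur in combinations of degree [l] but not in those of degree
    [k], and get the coefficient 0. At the other end, the product forms exceed the rank of [A]. *)
Lemma gcomb_act V k q l al (c : forall i, 'I_(r i) -> sform A) : open V ->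
  V `<=` U -> l = k + q%:Z -> Omega V q al ->
  (forall (p : nat) j, Omega V p (c (k - p%:Z) j)) ->
  act B V k l al (gcomb V e k c) =
  gcomb V e l (fun i j => if i <= k then wedges al (c i j) else (fun _ _ => 0)).
Proof.
move=> oV VU kl oal oc; set d := fun i j => _.
pose F (i : int) : sec B V l := \sum_(j < r i) act B V i l (d i j) (res B U V i (e j)).
have lal := act_linear_eq oV oal kl.
transitivity (\sum_(0 <= p < (vrk A).+1) F (l - (p + q)%N%:Z)).
  rewrite (lin_sum lal) big_mkord; apply: eq_bigr => p _; rewrite (lin_sum lal).
  have -> : l - (p + q)%N%:Z = k - p%:Z by lia.
  apply: eq_bigr => j _; rewrite /d (_ : k - p%:Z <= k); last by lia.
  by rewrite (act_wedge (p := q) (q := p) (l := k) gB)//; lia.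
rewrite [RHS](_ : _ = \sum_(0 <= p < (vrk A).+1) F (l - p%:Z)); last by rewrite big_mkord.
have Fs i : k < i -> i <= l -> F i = 0.
  move=> ki il; rewrite /F big1// => j _; apply: (act0l (p := `|l - i|%N)) => //; first by lia.
  by move=> x Vx t; rewrite /d ifF//; lia.
have Fb p : (vrk A < p)%N -> F (l - p%:Z) = 0.
  move=> hp; rewrite /F big1// => j _; apply: (act0l (p := p)) => //; first by rewrite subrK.
  move=> x Vx t; rewrite /d; case: ifP => // h.
  have [p' hp'] : exists p', p = (p' + q)%N by exists (p - q)%N; lia.
  move: j; have -> : l - p%:Z = k - p'%:Z by lia.
  move=> j; have ow := Omega_wedge oal (oc p' j).
  by apply: (Omega_rank t ow _ Vx); lia.
apply: (@sum_nat_shift _ (fun p => F (l - p%:Z))) => p hp; last exact: Fb.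
by apply: Fs; lia.
Qed.
End Gcomb.

Section Coef.
Context {U : set M} {e : forall i, 'I_(r i) -> sec B U i} {N : nat}.
Hypothesis eB : local_basis e N.

Lemma local_coef_gt V k (s : sec B V k) i (j : 'I_(r i)) x t :
  k < i -> local_coef e s j x t = 0 :> R.
Proof. by move=> ki; rewrite /local_coef leNgt (ki : k < i). Qed.

Context {V : set M} {k : int}.
Hypotheses (oV : open V) (VU : V `<=` U) (kN : (`|k| <= N%:Z)%R).

Lemma local_coefP (s : sec B V k) :
  (forall (p : nat) (j : 'I_(r (k - p%:Z))), Omega V p (local_coef e s j)) /\
  s = gcomb V e k (local_coef e s).
Proof.
have [[oU eP]] := (eB, eB); move=> _.
have [c hc] := (eP _ _ oV VU kN).1 s.
pose P := [set c : forall i, 'I_(r i) -> sform A |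
  (forall (p : nat) j, Omega V p (c (k - p%:Z) j)) /\ s = gcomb V e k c].
have [oc sc] : P (xget (fun _ _ _ _ => 0) P) by apply: xgetPex; exists c.
have E (p : nat) j : local_coef e s j = xget (fun _ _ _ _ => 0) P (k - p%:Z) j.
  apply: functional_extensionality_dep => x; apply/funext => t.
  by rewrite /local_coef (_ : k - p%:Z <= k)//; lia.
split=> [p j|]; first by rewrite E.
by rewrite {1}sc; apply: gcomb_ext => // p j x Vx; rewrite E.
Qed.

Lemma local_coef_uniq (s : sec B V k) (c : forall i, 'I_(r i) -> sform A) :
  (forall (p : nat) j, Omega V p (c (k - p%:Z) j)) -> s = gcomb V e k c ->
  forall i (j : 'I_(r i)) x t, i <= k -> V x -> local_coef e s j x t = c i j x t.
Proof.
move=> oc sc i j x t ik Vx; have [p ip] : exists p : nat, i = k - p%:Z.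
  by exists `|k - i|%N; lia.
subst i; have [oc' sc'] := local_coefP s; have [_ eP] := eB.
apply/eqP; rewrite -subr_eq0 addrC -mulN1r; apply/eqP.
apply: ((eP _ _ oV VU kN).2 (fun i j x t => -1 * c i j x t + local_coef e s j x t)) => //.
  by move=> q l; apply: Omega_linear.
by rewrite gcomb_linear// -sc -sc' scaleN1r addNr.
Qed.

Lemma local_coef_linear a (s t : sec B V k) i (j : 'I_(r i)) x u : V x ->
  local_coef e (a *: s + t) j x u = a * local_coef e s j x u + local_coef e t j x u.
Proof.
move=> Vx; have [ik|ki] := leP i k; last by rewrite !local_coef_gt// mulr0 addr0.
have [os es] := local_coefP s; have [ot et] := local_coefP t.
apply: (local_coef_uniq
  (c := fun i j x u => a * local_coef e s j x u + local_coef e t j x u)) => //.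
  by move=> p l; apply: Omega_linear.
by rewrite gcomb_linear// -es -et.
Qed.

Lemma local_coef_res (s : sec B V k) W i (j : 'I_(r i)) x u : open W -> W `<=` V -> W x ->
  local_coef e (res B V W k s) j x u = local_coef e s j x u.
Proof.
move=> oW WV Wx; have [ik|ki] := leP i k; last by rewrite !local_coef_gt.
have WU : W `<=` U by move=> z /WV/VU.
have [os es] := local_coefP s; have [oU eP] := eB.
have := (eP _ _ oW WU kN).1 (res B V W k s) => -[c [oc ec]].
have os' (p : nat) (l : 'I_(r (k - p%:Z))) : Omega W p (local_coef e s l).
  exact: Omega_sub WV (os p l).
have E : res B V W k s = gcomb W e k (local_coef e s).
  by rewrite {1}es gcomb_res.
have [p ip] : exists p : nat, i = k - p%:Z by exists `|k - i|%N; lia.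
subst i; pose Q := [set c : forall i, 'I_(r i) -> sform A |
  (forall (p : nat) j, Omega W p (c (k - p%:Z) j)) /\ res B V W k s = gcomb W e k c].
have [oq sq] : Q (xget (fun _ _ _ _ => 0) Q) by apply: xgetPex; exists c.
have -> : local_coef e (res B V W k s) j x u = xget (fun _ _ _ _ => 0) Q (k - p%:Z) j x u.
  by rewrite /local_coef ik.
apply/eqP; rewrite -subr_eq0 addrC -mulN1r; apply/eqP.
apply: ((eP _ _ oW WU kN).2 (fun i j x t => -1 * local_coef e s j x t +
  xget (fun _ _ _ _ => 0) Q i j x t)) => //.
  by move=> q l; apply: Omega_linear.
by rewrite gcomb_linear// -sq E scaleN1r addNr.
Qed.
End Coef.
End Sheaf.

(** * Morphisms of sheaves: local bijectivity and inverses *)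

Section Gmor.
Context {R : realType} {n : nat} {M : manifold R n} {A : vbundle M}.
Context {B B' : gsheaf A} {r r' : int -> nat}.
Hypotheses (gB : is_gbundle B r) (gB' : is_gbundle B' r').
Implicit Types (U V W : set M).

Lemma gmor_act_eq (f : gmor B B') U k p l al s : is_gmor f -> open U -> Omega U p al ->
  l = k + p%:Z -> f U l (act B U k l al s) = act B' U k l al (f U k s).
Proof. by move=> hf oU oal ->; exact: (gmor_act hf). Qed.

(** Local preimages of a section agree on overlaps by injectivity there, hence glue; this is why
    bijectivity is asked on all smaller open sets. *)
Lemma gmor_bijective_local (f : gmor B B') k U : is_gmor f -> open U ->
  (forall x, U x -> exists W, [/\ open W, W x & forall V, open V -> V `<=` W ->
     injective (f V k) /\ forall w, exists s, f V k s = w]) ->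
  injective (f U k) /\ forall w, exists s, f U k s = w.
Proof.
move=> hf oU loc; split=> [s t est|w].
  apply: (sec_eq_local gB oU) => x Ux; have [W [oW Wx WP]] := loc x Ux.
  have oWU : open (W `&` U) by exact: openI.
  have WW : W `&` U `<=` W by move=> z [].
  have UU : W `&` U `<=` U by move=> z [].
  exists (W `&` U); split=> //.
  by apply: (WP _ oWU WW).1; rewrite !(gmor_res hf) ?est.
pose C := [set V | [/\ open V, V `<=` U & forall V', open V' -> V' `<=` V ->
  injective (f V' k) /\ forall w, exists s, f V' k s = w]].
have UC : U = \bigcup_(V in C) V.
  apply/seteqP; split=> [x Ux|x [V [oV VU _] Vx]]; last exact: VU.
  have [W [oW Wx WP]] := loc x Ux; exists (W `&` U) => //.
  have oWU : open (W `&` U) by exact: openI.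
  by split=> // V' oV' V'W; apply: WP => // z /V'W[].
pose s V : sec B V k := xget 0 [set s | f V k s = res B' U V k w].
have sP V : C V -> f V k (s V) = res B' U V k w.
  move=> [oV VU VP]; have [s0 hs0] := (VP V oV (@subset_refl _ _)).2 (res B' U V k w).
  exact: (@xgetPex _ _ [set s | f V k s = res B' U V k w] (ex_intro _ s0 hs0)).
have [|V W CV CW|t [ht _]] := sec_glue_eq gB (s := s) UC; first by move=> V [].
  have [[oV VU VP] [oW WU WP]] := (CV, CW); have oVW := openI oV oW.
  have VV : V `&` W `<=` V by move=> z [].
  have WW : V `&` W `<=` W by move=> z [].
  by apply: (VP _ oVW VV).1; rewrite !(gmor_res hf)// !sP// !(res_comp gB').
exists t; apply: (sec_eq_local gB' oU) => x; rewrite {1}UC => -[V CV Vx].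
have [oV VU _] := CV; exists V; split=> //.
by rewrite -(gmor_res hf)// ht// sP.
Qed.

Lemma gmor_inverse (f : gmor B B') : is_gmor f ->
  (forall U k, open U -> injective (f U k) /\ forall w, exists s, f U k s = w) ->
  exists g : gmor B' B, inverse_gmor f g.
Proof.
move=> hf bij; pose g : gmor B' B := fun U k w => xget 0 [set s | f U k s = w].
have gK U k w : open U -> f U k (g U k w) = w.
  move=> oU; have [s0 hs0] := (bij U k oU).2 w.
  exact: (@xgetPex _ _ [set s | f U k s = w] (ex_intro _ s0 hs0)).
have inj U k (oU : open U) := (bij U k oU).1.
exists g; split=> //; last first.
  by move=> U k oU; split=> s; [apply: (inj U k oU)|]; rewrite gK.
split.
- by move=> U k oU a s t; apply: (inj _ _ oU); rewrite (gmor_linear hf oU) !gK.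
- by move=> U k p al s oU oal; apply: (inj _ _ oU); rewrite gK// (gmor_act hf)// gK.
- move=> U V k s oU oV VU; apply: (inj _ _ oV).
  by rewrite gK// (gmor_res hf)// gK.
Qed.
End Gmor.

(** A linear functional on the fibre in degree [k], at [y], of the pullback of a
    sheaf along the zero section. *)
Record fibre_functional R n (M : manifold R n) (A : vbundle M) (B : gsheaf A)
    (y : M) (k : int) (W : lmodType R) (f : forall V, sec B V k -> W) : Prop := {
  ff_lin : forall V, open V -> V y -> linear (f V);
  ff_act0 : forall V al s, open V -> V y -> Omega V 0 al ->
    f V (act B V k k al s) = al y [::] *: f V s;
  ff_act : forall V k' p al s, open V -> V y -> Omega V p.+1 al ->
    k = k' + p.+1%:Z -> f V (act B V k' k al s) = 0;
  ff_res : forall V V' s, open V -> open V' -> V' `<=` V -> V' y ->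
    f V' (res B V V' k s) = f V s }.

(** * Coordinates at a point in a local basis *)

Section Charts.
Context {R : realType} {n : nat} {M : manifold R n} {A : vbundle M}.
Context {B : gsheaf A} {r : int -> nat}.
Hypothesis gB : is_gbundle B r.
Implicit Types (U V W : set M) (x y : M) (i k l : int).

Lemma local_basis_exists x N : exists U (e : forall i, 'I_(r i) -> sec B U i),
  U x /\ local_basis e N.
Proof.
have [U [e [oU Ux H]]] := locally_free gB x N.
by exists U, e; do 2!split=> //.
Qed.

Section Chart.
Context {U : set M} {e : forall i, 'I_(r i) -> sec B U i} {N : nat}.
Hypothesis eB : local_basis e N.

Lemma local_coef_act V k q l al (s : sec B V k) i (j : 'I_(r i)) x u :
  open V -> V `<=` U -> (`|k| <= N%:Z)%R -> (`|l| <= N%:Z)%R -> l = k + q%:Z ->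
  Omega V q al -> V x ->
  local_coef e (act B V k l al s) j x u = @shuf R _ R^o (al x) (local_coef e s j x) u.
Proof.
move=> oV VU kN lN kl oal Vx.
have zero i' (j' : 'I_(r i')) : k < i' -> @shuf R _ R^o (al x) (local_coef e s j' x) u = 0.
  move=> ki; rewrite (_ : local_coef e s j' x = fun=> 0) ?shuf0r//.
  by apply/funext => t; exact: local_coef_gt.
have [il|li] := leP i l; last by rewrite local_coef_gt// zero//; lia.
have [os es] := local_coefP gB eB oV VU kN s.
pose c i (j : 'I_(r i)) : sform A :=
  if i <= k then wedges al (local_coef e s j) else (fun _ _ => 0).
have oc (p : nat) (j' : 'I_(r (l - p%:Z))) : Omega V p (c _ j').
  rewrite /c; case: ifP => h; last exact: Omega0.
  have [p' hp'] : exists p', p = (q + p')%N by exists (p - q)%N; lia.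
  move: j'; rewrite (_ : l - p%:Z = k - p'%:Z); last by lia.
  by move=> j'; rewrite hp'; apply: Omega_wedge.
rewrite (local_coef_uniq gB eB oV VU lN (c := c) oc)//; last first.
  by rewrite {1}es (gcomb_act gB _ oV VU kl oal os).
by rewrite /c; case: leP => // /zero ->.
Qed.

Lemma gcomb_degree V k (c : forall i, 'I_(r i) -> sform A) : open V ->
  (forall (p : nat) j, Omega V p (c (k - p%:Z) j)) ->
  (forall i j x t, i < k -> V x -> c i j x t = 0) ->
  gcomb V e k c = \sum_(j < r k) act B V k k (c k j) (res B U V k (e j)).
Proof.
move=> oV oc c0.
pose G i := \sum_(j < r i) act B V i k (c i j) (res B U V i (e j)).
transitivity (\sum_(p < (vrk A).+1) G (k - p%:Z)) => //.
have G0 i : (exists p : nat, i = k - p.+1%:Z) -> G i = 0.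
  move=> [p ->]; apply: big1 => j _; apply: (act0l gB (p := p.+1)) => //.
    by rewrite subrK.
  by move=> x Vx t; apply: c0 => //; lia.
by rewrite big_ord_recl subr0 big1 ?addr0// => p _; apply: G0; exists p; rewrite lift0.
Qed.

Lemma local_coef_basis k (j j0 : 'I_(r k)) y : (`|k| <= N%:Z)%R -> U y ->
  local_coef e (e j0) j y [::] = (j == j0)%:R.
Proof.
move=> kN Uy; have [oU _] := eB.
(* The indices are compared through [val] because [j] and [j0] have the same type only when
   [i = k]. *)
pose c i (j : 'I_(r i)) : sform A :=
  constform (if (i == k) && (val j == val j0) then 1 else 0).
have cE i (l : 'I_(r i)) x t : i < k -> c i l x t = 0.
  by move=> ik; rewrite /c lt_eqF//=; case: t.
have oc (p : nat) (l : 'I_(r (k - p%:Z))) : Omega U p (c _ l).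
  case: p l => [|p] l; first exact: Omega_const.
  rewrite (_ : c _ l = fun _ _ => 0); first exact: Omega0.
  by apply: functional_extensionality_dep => x; apply/funext => t; apply: cE; lia.
rewrite (local_coef_uniq gB eB oU (@subset_refl _ _) kN (c := c) oc)//.
  by rewrite /c eqxx /= val_eqE; case: eqP.
rewrite gcomb_degree//; last by move=> *; exact: cE.
rewrite (bigD1 j0)//= big1 ?addr0 => [|l lj0].
  by rewrite /c !eqxx /= (act_const gB)// scale1r (res_id gB).
by rewrite /c eqxx /= val_eqE (negbTE lj0) (act_const gB)// scale0r.
Qed.

(** Terms whose coefficient has positive form degree are killed, and functions come out as their
    value at [y], so only the generators of degree [k] contribute. *)
Lemma fibre_functional_basis (W : lmodType R) k y (f : forall V, sec B V k -> W) V s :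
  fibre_functional y f -> (`|k| <= N%:Z)%R -> open V -> V `<=` U -> V y ->
  f V s = \sum_(j < r k) local_coef e s j y [::] *: f U (e j).
Proof.
move=> hf kN oV VU Vy; have [oU _] := eB.
have [os es] := local_coefP gB eB oV VU kN s.
pose G i := \sum_(j < r i) f V (act B V i k (local_coef e s j) (res B U V i (e j))).
have lf := ff_lin hf oV Vy.
transitivity (\sum_(p < (vrk A).+1) G (k - p%:Z)).
  by rewrite [in LHS]es (lin_sum lf); apply: eq_bigr => p _; rewrite (lin_sum lf).
have G0 i : (exists p : nat, i = k - p.+1%:Z) -> G i = 0.
  move=> [p ->]; apply: big1 => j _; apply: (ff_act hf _ oV Vy (os p.+1 j)).
  by rewrite subrK.
rewrite big_ord_recl subr0 [X in _ + X]big1 ?addr0; last first.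
  by move=> p _; apply: G0; exists p; rewrite lift0.
apply: eq_bigr => j _.
have oj : Omega V 0 (local_coef e s j).
  by move: j; have := os 0%N; rewrite subr0.
by rewrite (ff_act0 hf)// (ff_res hf).
Qed.

(** Coordinates in the fibre at [y] of the pullback along the zero embedding; restricting to [V]
    intersected with [U] first allows sections over any [V] around [y]. *)
Definition basis_functional k y V (s : sec B V k) : 'rV[R]_(r k) :=
  \row_j local_coef e (res B V (V `&` U) k s) j y [::].

(** The margin [vrk A] is there for [ff_act]: a multiple of a form of degree p + 1 comes from degree
    k - (p + 1), and the basis must be valid there too. Forms of degree beyond the rank vanish. *)
Lemma basis_functionalP k y : (`|k| + (vrk A)%:Z <= N%:Z)%R -> U y ->
  fibre_functional y (basis_functional (k := k) y).
Proof.
move=> hN Uy; have [oU _] := eB; have kN : `|k| <= N%:Z by lia.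
have I1 V : V `&` U `<=` V by move=> z [].
have I2 V : V `&` U `<=` U by move=> z [].
split.
- move=> V oV Vy a s t; apply/rowP => j; rewrite !mxE.
  have oVU := openI oV oU.
  by rewrite (res_linear gB oV oVU (I1 V)) (local_coef_linear gB eB oVU).
- move=> V al s oV Vy oal; apply/rowP => j; rewrite !mxE.
  have oVU := openI oV oU.
  rewrite (act_res_eq gB s oV oVU (I1 V) oal) ?addr0//.
  have oal' := Omega_sub (I1 V) oal.
  by rewrite (local_coef_act _ _ _ oVU _ _ _ _ oal') ?addr0// shuf_nil.
- move=> V k' p al s oV Vy oal kk; apply/rowP => j; rewrite !mxE.
  have oVU := openI oV oU; have oal' := Omega_sub (I1 V) oal.
  rewrite (act_res_eq gB s oV oVU (I1 V) oal)//.
  have [hp|hp] := leqP p.+1 (vrk A); last first.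
    rewrite (act_rank gB _ oVU oal' kk hp).
    have := local_coef_linear gB eB oVU (I2 V) kN (-1) 0 0 j [::] (conj Vy Uy).
    by rewrite scaler0 addr0 mulN1r addNr.
  rewrite (local_coef_act _ _ _ oVU _ _ _ kk oal')//; last by lia.
  by rewrite shuf_nil local_coef_gt ?scaler0//; lia.
- move=> V V' s oV oV' V'V V'y; apply/rowP => j; rewrite !mxE.
  have oVU := openI oV oU; have oVU' := openI oV' oU.
  have S : V' `&` U `<=` V `&` U by move=> z [/V'V].
  by rewrite (res_comp gB)// -(res_comp gB _ oV oVU oVU')// (local_coef_res gB eB oVU).
Qed.

Lemma basis_functional_basis k y (j : 'I_(r k)) : (`|k| <= N%:Z)%R -> U y ->
  basis_functional y (e j) = delta_mx 0 j.
Proof.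
move=> kN Uy; have [oU _] := eB; apply/rowP => l; rewrite !mxE eqxx /=.
have S : U `&` U `<=` U by move=> z [].
by rewrite (local_coef_res gB eB oU)//; [exact: local_coef_basis|exact: openI].
Qed.

Lemma basis_functional_comb k y (c : 'I_(r k) -> R) :
  (`|k| + (vrk A)%:Z <= N%:Z)%R -> U y ->
  basis_functional y (\sum_j c j *: e j) = \row_j c j.
Proof.
move=> hN Uy; have kN : `|k| <= N%:Z by lia.
have [oU _] := eB; have lf := ff_lin (basis_functionalP hN Uy) oU Uy.
rewrite (lin_sum lf) [RHS]row_sum_delta; apply: eq_bigr => j _.
by rewrite (linZ lf) basis_functional_basis// mxE.
Qed.
End Chart.
End Charts.

(** * The pullback sheaf *)

Section PositivePart.
Context {R : realType} {n : nat} {M : manifold R n} {A : vbundle M}.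
Context {B : gsheaf A} {r : int -> nat}.
Hypothesis gB : is_gbundle B r.

(** Brings a combination without coefficients of form degree 0 into the shape required by [ev_ker],
    by enumerating the pairs of a positive degree and a generator. *)
Lemma gcomb_positive (U V : set M) (e : forall i, 'I_(r i) -> sec B U i) k
    (c : forall i, 'I_(r i) -> sform A) : open V ->
  (forall (p : nat) j, Omega V p (c (k - p%:Z) j)) ->
  (forall (j : 'I_(r k)) x, V x -> forall t, c k j x t = 0) ->
  exists (m : nat) (q : 'I_m -> nat) (al : 'I_m -> sform A)
    (t : forall j, sec B V (k - (q j).+1%:Z)),
    (forall j, Omega V (q j).+1 (al j)) /\
    gcomb V e k c = \sum_j act B V (k - (q j).+1%:Z) k (al j) (t j).
Proof.
move=> oV oc c0; pose I : finType := ({p : 'I_(vrk A) & 'I_(r (k - p.+1%:Z))} : Type).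
pose f (j : 'I_#|I|) : {p : 'I_(vrk A) & 'I_(r (k - p.+1%:Z))} := enum_val j.
exists #|I|, (fun j => tag (f j) : nat), (fun j => c _ (tagged (f j))).
exists (fun j => res B U V _ (e _ (tagged (f j)))); split=> [j|]; first exact: oc.
pose G i := \sum_(j < r i) act B V i k (c i j) (res B U V i (e i j)).
transitivity (\sum_(p < (vrk A).+1) G (k - p%:Z)) => //.
rewrite big_ord_recl subr0 [X in X + _]big1 ?add0r; last first.
  by move=> j _; apply: (act0l gB (p := 0)); rewrite ?addr0// => x Vx t; exact: c0.
transitivity (\sum_(p < vrk A) G (k - p.+1%:Z)).
  by apply: eq_bigr => p _; rewrite lift0.
rewrite (sig_big_dep (fun=> true) (fun (p : 'I_(vrk A)) (_ : 'I_(r (k - p.+1%:Z))) => true)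
  (fun p j => act B V _ k (c _ j) (res B U V _ (e _ j)))) /=.
by rewrite (reindex f)//=; exact/onW_bij/enum_val_bij.
Qed.
End PositivePart.

Section PullbackBundle.
Context {R : realType} {n : nat} {M : manifold R n} {A : vbundle M} {E : int -> vbundle M}.
Implicit Types (U V : set M) (x y : M) (i k l : int).

(** A raw form needs a value in every [E l]; the equality of degrees is decided so that [v] can be
    placed in its own component and 0 in all others. *)
Definition degree_cast i l x (v : E i x) : E l x :=
  if pselect (i = l) is left h then eq_rect i (fun l => E l x) v l h else 0.

Lemma degree_castE i x (v : E i x) : degree_cast i v = v.
Proof. by rewrite /degree_cast; case: pselect => // h; rewrite (eq_irrelevance h erefl). Qed.

Lemma degree_cast_neq i l x (v : E i x) : i <> l -> degree_cast l v = 0.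
Proof. by rewrite /degree_cast; case: pselect. Qed.

Definition section_form U i (f : forall y, E i y) : rawform A E :=
  fun x l s => if s is [::] then (if x \in U then degree_cast l (f x) else 0) else 0.

Lemma is_psec_section U i (f : forall y, E i y) : open U ->
  (forall x, U x -> vsmooth f x) -> is_psec U i (section_form U f).
Proof.
move=> oU sf; split; last 2 first.
- by move=> x l [|u s]//= h; rewrite /section_form degree_cast_neq ?if_same//; lia.
- by move=> x nU l [|u s]//=; rewrite /section_form memNset.
move=> l x Ux; split.
  by split=> [[|u s] t c v w|[|u s] t r' v] /=; rewrite /section_form /= ?scaler0 ?addr0.
move=> a [|p] sa; last first.
  apply: vsmooth_eq_near (vsmooth_0 (E l) x).
  by apply: nearW => y; rewrite args_S.
have nU : nbhs x U by exact: open_nbhs_nbhs.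
have [e|ne] := pselect (i = l).
  subst l; apply: vsmooth_eq_near (sf x Ux); near=> y.
  by rewrite /args /= /section_form mem_set ?degree_castE//; near: y.
apply: vsmooth_eq_near (vsmooth_0 (E l) x); near=> y.
by rewrite /args /= /section_form degree_cast_neq// if_same.
Unshelve. all: by end_near. Qed.

Definition section_psec U i (f : forall y, E i y) : psec A E U i :=
  mk_psec U i (section_form U f).

Lemma section_psecE U i (f : forall y, E i y) x : open U ->
  (forall x, U x -> vsmooth f x) -> U x -> pval (section_psec U f) x i [::] = f x.
Proof.
move=> oU sf Ux; rewrite mk_psecE; last exact: is_psec_section.
by rewrite /section_form mem_set// degree_castE.
Qed.

Lemma frame_on_eq i U m (b b' : 'I_m -> forall y, E i y) : open U ->
  (forall j y, U y -> b j y = b' j y) -> frame_on U b -> frame_on U b'.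
Proof.
move=> oU bb [f1 f2]; split=> y Uy.
  move=> v; have [c [vc u]] := f1 y Uy v; exists c; split.
    by rewrite vc; apply: eq_bigr => j _; rewrite bb.
  move=> c' vc'; apply: u; rewrite vc'; apply: eq_bigr => j _; by rewrite bb.
have nU : nbhs y U by exact: open_nbhs_nbhs.
move=> s; split=> [/(f2 y Uy)|] [c [sc ec]]; [|apply/(f2 y Uy)]; exists c; split=> //;
  near=> z; (have Uz : U z by near: z); rewrite (near ec z)//;
  by apply: eq_bigr => j _; rewrite bb.
Unshelve. all: by end_near. Qed.

(** Each [E i] has its own trivialising neighbourhood. Only the finitely many of degrees -L, ..., L
    are intersected, degree a - L being indexed by [a]. *)
Lemma local_frames x (L : nat) : exists (U : set M)
    (b : forall i, 'I_(bundle_rk E i) -> psec A E U i),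
  [/\ open U, U x & forall i, (`|i| <= L%:Z)%R ->
    frame_on U (fun j y => pval (b i j) y i [::])].
Proof.
have H : forall i, exists Ue : {U : set M & 'I_(bundle_rk E i) -> forall y, E i y},
    [/\ open (tag Ue), tag Ue x & frame_on (tag Ue) (tagged Ue)].
  move=> i; have [U [e [oU Ux f1 f2]]] := vframe (E i) x.
  by exists (existT _ U e).
pose Ue i := projT1 (cid (H i)); have hUe i := projT2 (cid (H i)).
have : \forall y \near x, forall a : 'I_(L + L).+1, tag (Ue (a%:Z - L%:Z)) y.
  apply: filter_forall => a; have [oU Ux _] := hUe (a%:Z - L%:Z).
  exact: open_nbhs_nbhs.
move=> /near_open_nbhs[U [oU Ux hU]].
have UU i : (`|i| <= L%:Z)%R -> U `<=` tag (Ue i).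
  move=> iL y /hU hy; have ha : (absz (i + L%:Z)%R < (L + L).+1)%N by lia.
  have := hy (Ordinal ha); rewrite /=.
  by have -> : (absz (i + L%:Z))%:Z - L%:Z = i by lia.
exists U, (fun i j => section_psec U (tagged (Ue i) j)); split=> // i iL.
have [_ _ fe] := hUe i; have fU := frame_onS fe (UU i iL).
apply: (frame_on_eq oU _ fU) => j y Uy; rewrite section_psecE// => z Uz.
exact: frame_smooth fU _ _ Uz.
Qed.

Lemma pullback_gbundle : is_gbundle (pullback A E) (bundle_rk E).
Proof.
split.
- move=> U V k oU oV VU a s t; apply: psec_ext => x Vx i u.
  by rewrite pval_resV// pval_linear pval_linear !pval_resV.
- by move=> U k s oU; apply: psec_ext => x Ux i u; rewrite pval_resV.
- move=> U V W k s oU oV oW VU WV; apply: psec_ext => x Wx i u.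
  by rewrite !pval_resV//; [move=> z /WV/VU|exact: WV].
- move=> C k s oC compat; set D := \bigcup_(V in C) V.
  have oD : open D by exact: bigcup_open.
  have VD V : C V -> V `<=` D by move=> CV y Vy; exists V.
  have agree V W x i u : C V -> C W -> V x -> W x ->
      pval (s V : psec A E V k) x i u = pval (s W : psec A E W k) x i u.
    move=> CV CW Vx Wx; have [oV oW] := (oC _ CV, oC _ CW).
    have := congr1 (fun w : psec A E (V `&` W) k => pval w x i u) (compat V W CV CW).
    have oVW := openI oV oW.
    by rewrite !pval_resV// => [z []|z []].
  (* The glued form takes at [x] the value of any member of the cover containing [x]; by [agree] the
     choice is immaterial. *)
  pose w : rawform A E := fun x i u =>
    if pselect (exists2 V, C V & V x) is left h then
      pval (s (projT1 (cid2 h)) : psec A E _ k) x i u else 0.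
  have wE V x i u : C V -> V x -> w x i u = pval (s V : psec A E V k) x i u.
    move=> CV Vx; rewrite /w; case: pselect => [h|[]]; last by exists V.
    by case: (cid2 h) => /= W CW Wx; exact: agree.
  have pw : is_psec D k w.
    split; last 2 first.
    - move=> x i u hu; rewrite /w; case: pselect => // h.
      exact: pval_degree.
    - move=> x nD i u; rewrite /w; case: pselect => // h.
    move=> i x [V CV Vx]; have oV := oC V CV.
    have [f _ _] := psecP (s V : psec A E V k).
    suff fw : is_form (@vsmooth _ _ _ (E i)) V (fun x => w x i) by exact: (fw x Vx).
    apply: (is_form_eq (v := fun x => pval (s V : psec A E V k) x i)) => //.
      by move=> s' t y; exact: vsmooth_eq_near.
    by move=> y Vy u; rewrite (wE V).
  exists (mk_psec D k w); split.
    move=> V CV; have oV := oC V CV; apply: psec_ext => x Vx i u.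
    by rewrite pval_resV ?mk_psecE//; [exact: wE|exact: VD].
  move=> t ht; apply: psec_ext => x [V CV Vx] i u; have oV := oC V CV.
  rewrite mk_psecE// (wE V)// -(ht V CV) pval_resV//; exact: VD.
- move=> U k l al be s oU ab; apply: (congr1 (insubd (0 : psec A E U l))).
  apply: raw_ext => x i u; case: ifPn => // /set_mem Ux.
  by rewrite !wedgeE (_ : al x = be x)//; exact: ab.
- move=> U k p al oU oal a s t; apply: psec_ext => x Ux i u.
  rewrite pval_linear !(pval_act _ _ _ oU oal)//.
  by rewrite -shuf_linearr.
- move=> U k p al be s oU oa ob; apply: psec_ext => x Ux i u.
  rewrite pvalD !(pval_act _ _ _ oU _ _ Ux (p := p))//; last exact: OmegaD.
  by rewrite -shufDl.
- move=> U k c s oU; apply: psec_ext => x Ux i u.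
  rewrite pvalZ (pval_act _ _ _ oU (Omega_const U c)) ?addr0//.
  by rewrite shuf_deg0l//= => -[].
- move=> U k p q l m al be s oU oa ob -> ->; apply: psec_ext => x Ux i u.
  rewrite (pval_act _ _ _ oU (Omega_wedge oa ob))//; last by rewrite PoszD; ring.
  rewrite (pval_act _ _ _ oU oa)//.
  transitivity (shuf (al x) (shuf (be x) (pval s x i)) u); first by rewrite -shufA.
  by congr shuf; apply/funext => t; rewrite (pval_act _ _ _ oU ob).
- move=> U V k p al s oU oV VU oal; apply: psec_ext => x Vx i u.
  rewrite pval_resV// (pval_act _ _ _ oU oal)//; last exact: VU.
  rewrite (pval_act _ _ _ oV (Omega_sub VU oal))//.
  by congr shuf; apply/funext => t; rewrite pval_resV.
(* A section of degree [k] uses generators down to degree k - [vrk A], so frames are taken for a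
   range larger by the rank. *)
- move=> x N; have [U [b [oU Ux fb]]] := local_frames x (N + vrk A).
  exists U, b; split=> // V k oV VU kN.
  have fbk (p : nat) : (p <= vrk A)%N ->
      frame_on U (fun (j : 'I_(bundle_rk E (k - p%:Z))) y => pval (b _ j) y (k - p%:Z) [::]).
    by move=> pA; apply: fb; lia.
  split=> [s|c oc c0].
    by have [c hc] := psec_coefs_exist oU oV VU fbk s; exists c.
  exact: (psec_coefs_unique oV VU fbk oc c0).
Qed.

Definition pullback_ev U k (w : sec (pullback A E) U k) x : E k x :=
  pval (w : psec A E U k) x k [::].

(** Kept transparent, since [pullback_induces] relies on [ev] computing to the component of form
    degree 0. *)
Definition pullback_standard : standard (pullback A E) E.
Proof.
apply: (@Standard _ _ _ _ _ _ pullback_ev).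
- move=> U k s oU x Ux; have [f _ _] := psecP s; have [_ sm] := f k x Ux.
  by have := sm (fun _ _ => 0) 0%N; apply=> i; exact: vsmooth_0.
- by move=> U V k s oU oV VU x Vx; rewrite /pullback_ev pval_resV.
- by [].
- move=> U k al s oU oal x Ux.
  by rewrite /pullback_ev (pval_act _ _ _ oU oal) ?addr0// shuf_nil.
- move=> U k p al s oU oal x Ux.
  rewrite /pullback_ev (pval_act _ _ _ oU oal)// shuf_nil.
  by have [_ ->] := oal; rewrite ?scale0r.
- move=> k f x /vsmooth_near/near_open_nbhs[U [oU Ux sU]].
  exists U, (section_psec U f); split=> // y Uy; exact: section_psecE.
(* The kernel condition: if the part of form degree 0 vanishes, so do the coefficients of form
   degree 0 in a local frame, and what remains is a sum of multiples of positive forms. *)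
move=> U k s oU s0 x Ux; have [U' [b [oU' Ux' fb]]] := local_frames x (`|k|%N + vrk A).
pose V := U `&` U'; have oV : open V by exact: openI.
have VU : V `<=` U by move=> z [].
have VU' : V `<=` U' by move=> z [].
have fbk (p : nat) : (p <= vrk A)%N ->
    frame_on U' (fun (j : 'I_(bundle_rk E (k - p%:Z))) y => pval (b _ j) y (k - p%:Z) [::]).
  by move=> pA; apply: fb; lia.
have [c [oc sc]] := psec_coefs_exist oU' oV VU' fbk (res (pullback A E) U V k s).
exists V; split=> //; rewrite sc; apply: (gcomb_positive pullback_gbundle) => //.
move=> j y Vy t.
have o0 a : Omega V 0 (c k a) by move: a; have := oc 0%N; rewrite subr0.
have [/size0nil ->|ht] := eqVneq (size t) 0%N; last first.
  by have [_ ->] := o0 j => //; exact/eqP.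
have fk : frame_on U' (fun (j : 'I_(bundle_rk E k)) y => pval (b _ j) y k [::]).
  by apply: fb; lia.
have Uy' := VU' _ Vy.
rewrite -(frame_coord_uniq fk (c := fun j => c k j y [::]) (v := 0) Uy').
  by rewrite (frame_coord0 fk).
transitivity (pval s y k [::]); first by have := s0 y (VU _ Vy); rewrite /pullback_ev.
rewrite -(pval_resV s _ _ oV VU Vy) sc pval_gcomb//.
pose G i := \sum_(j < bundle_rk E i) shuf (c i j y) (pval (b i j) y k) [::].
rewrite [LHS](_ : _ = \sum_(p < (vrk A).+1) G (k - p%:Z))//.
rewrite big_ord_recl subr0 -[RHS]addr0; congr (_ + _).
  by apply: eq_bigr => l _; rewrite shuf_nil.
have G0 i : (exists p : nat, i = k - p.+1%:Z) -> G i = 0.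
  move=> [p ->]; apply: big1 => l _; rewrite shuf_nil.
  by have [_ ->] := oc p.+1 l; rewrite ?scale0r.
by apply: big1 => p _; apply: G0; exists p; rewrite lift0.
Defined.
End PullbackBundle.

(** * Standard graded bundles *)

Section StandardFrame.
Context {R : realType} {n : nat} {M : manifold R n} {A : vbundle M}.
Context {B : gsheaf A} {r : int -> nat} {E : int -> vbundle M}.
Hypothesis gB : is_gbundle B r.
Variable std : standard B E.
Implicit Types (U V W : set M) (x y : M) (k : int).

Lemma ev_functional k y : fibre_functional y (fun V (s : sec B V k) => ev std V k s y).
Proof.
split.
- by move=> V oV Vy a s t; exact: (ev_linear std).
- by move=> V al s oV Vy oal; exact: (ev_act0 std).
- by move=> V k' p al s oV Vy oal ->; exact: (ev_act std).
- by move=> V V' s oV oV' V'V V'y; exact: (ev_res std).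
Qed.

Section Frame.
Context {U : set M} {e : forall i, 'I_(r i) -> sec B U i} {N : nat} {k : int}.
Hypotheses (eB : local_basis e N) (hN : (`|k| + (vrk A)%:Z <= N%:Z)%R).

(** A combination of the [ev e_j] vanishing at [y] is a combination of smooth
    sections with coefficients vanishing at [y]; lifting the latter, it differs
    from the corresponding combination of the [e_j] by positive forms. *)
Lemma ev_basis_free y (c : 'I_(r k) -> R) : U y ->
  \sum_j c j *: ev std U k (e j) y = 0 -> forall j, c j = 0.
Proof.
move=> Uy c0; have [oU _] := eB; have kN : `|k| <= N%:Z by lia.
pose s := \sum_j c j *: e (i := k) j.
have s0 : ev std U k s y = 0.
  rewrite (lin_sum (ff_lin (ev_functional k y) oU Uy)) -[RHS]c0.
  by apply: eq_bigr => j _; rewrite (linZ (ff_lin (ev_functional k y) oU Uy)).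
have [U' [ep [oU' Uy' ep1 ep2]]] := vframe (E k) y.
have fep : frame_on U' ep by split.
pose f l z := frame_coord ep (ev std U k s z) 0 l.
have sf l : smooth_at (f l) y.
  by apply: (frame_coord_smooth fep _ oU' Uy'); exact: (ev_smooth std).
have H l : exists Wt : {W : set M & sec B W k},
    [/\ open (tag Wt), tag Wt y & forall z, tag Wt z -> ev std _ k (tagged Wt) z = ep l z].
  have [W [t [oW Wy ht]]] := ev_surj std (frame_smooth fep l Uy').
  by exists (existT _ W t).
pose Wt l := projT1 (cid (H l)); have hWt l := projT2 (cid (H l)).
have : \forall z \near y, forall l, tag (Wt l) z.
  apply: filter_forall => l; have [oW Wy _] := hWt l; exact: open_nbhs_nbhs.
have : \forall z \near y, forall l, smooth_at (f l) z.
  by apply: filter_forall => l; exact: smooth_at_near.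
have nUU : nbhs y (U `&` U') by apply: open_nbhs_nbhs; split=> //; exact: openI.
move=> nsf nW.
have /near_open_nbhs[W [oW Wy hW]] : \forall z \near y,
    [/\ (U `&` U') z, forall l, smooth_at (f l) z & forall l, tag (Wt l) z].
  by near=> z; split; near: z.
have WU : W `<=` U by move=> z /hW[[]].
have WW l : W `<=` tag (Wt l) by move=> z /hW[_ _].
have oWt l : open (tag (Wt l)) by have [] := hWt l.
have ofl l : Omega W 0 (funform (A := A) (f l)).
  by apply: Omega_funform => z /hW[_ + _]; exact.
pose t l := res B _ W k (tagged (Wt l)).
pose sg := res B U W k s - \sum_l act B W k k (funform (f l)) (t l).
have lev z : W z -> linear (fun s : sec B W k => ev std W k s z).
  by move=> Wz; exact: (ff_lin (ev_functional k z) oW Wz).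
have sg0 z : W z -> ev std W k sg z = 0.
  move=> Wz; have [[Uz Uz'] _ _] := hW z Wz.
  rewrite (linB (lev z Wz)) (lin_sum (lev z Wz)) (ev_res std)//.
  rewrite {1}(frame_coordP fep (ev std U k s z) Uz').
  apply/eqP; rewrite subr_eq0; apply/eqP; apply: eq_bigr => l _.
  rewrite (ev_act0 std (t l) oW (ofl l) Wz).
  rewrite (ev_res std (tagged (Wt l)) (oWt l) oW (WW l) Wz).
  by have [_ _ h] := hWt l; rewrite (h _ (WW l _ Wz)).
have [V [oV Vy VW [m [q [al [u [oal usg]]]]]]] := @ev_ker _ _ _ _ _ _ std _ _ sg oW sg0 y Wy.
have hl := basis_functionalP gB eB hN Uy.
(* The basis functional sends [s] to the row of the [c j]. It kills [sg], a sum of multiples of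
   positive forms near [y], and the multiples of the [f l], which vanish at [y]. *)
suff cr : \row_j c j = 0.
  by move=> j; move/rowP: cr => /(_ j); rewrite !mxE.
rewrite -(basis_functional_comb gB eB c hN Uy) -/s -(ff_res hl s oU oW WU Wy).
have -> : res B U W k s = sg + \sum_l act B W k k (funform (f l)) (t l) by rewrite subrK.
rewrite (linD (ff_lin hl oW Wy)) (lin_sum (ff_lin hl oW Wy)) [X in _ + X]big1 ?addr0.
  rewrite -(ff_res hl sg oW oV VW Vy) usg (lin_sum (ff_lin hl oV Vy)) big1// => j _.
  by apply: (ff_act hl _ oV Vy (oal j)); rewrite subrK.
by move=> l _; rewrite (ff_act0 hl)// /= /f s0 (frame_coord0 fep)// scale0r.
Unshelve. all: by end_near. Qed.

(** Lifting sections of [E k] through [ev_surj] gives spanning and smooth coordinates, the latter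
    because coefficients are forms; [ev_basis_free] gives uniqueness. *)
Lemma standard_frame : frame_on U (fun (j : 'I_(r k)) y => ev std U k (e j) y).
Proof.
have [oU _] := eB; have kN : `|k| <= N%:Z by lia.
have span V (s : sec B V k) y : open V -> V `<=` U -> V y -> ev std V k s y =
    \sum_j local_coef e s j y [::] *: ev std U k (e j) y.
  by move=> oV VU Vy; exact: (fibre_functional_basis gB eB _ (ev_functional k y)).
have lift (f : forall z, E k z) y : U y -> vsmooth f y -> exists V (s : sec B V k),
    [/\ open V, V `<=` U, V y & forall z, V z -> ev std V k s z = f z].
  move=> Uy sf; have [W [s [oW Wy hs]]] := ev_surj std sf.
  have oWU := openI oW oU.
  have I1 : W `&` U `<=` W by move=> z [].
  exists (W `&` U), (res B W (W `&` U) k s); split=> // z [Wz Uz].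
  by rewrite (ev_res std)// hs.
split=> y Uy.
  move=> v; have [t gt tv] := gsmooth_through v.
  have [V [s [oV VU Vy hs]]] := lift t y Uy (gt y).
  exists (\row_j local_coef e s j y [::]); split.
    by rewrite -tv -hs// span//; apply: eq_bigr => j _; rewrite mxE.
  move=> c vc; apply/rowP => j; apply/eqP; rewrite -subr_eq0 mxE; apply/eqP.
  apply: (ev_basis_free (c := fun j => local_coef e s j y [::] - c 0 j) Uy).
  under eq_bigr do rewrite scalerBl.
  by rewrite big_split /= sumrN -span// hs// tv vc subrr.
move=> f; split=> [/(lift f y Uy)[V [s [oV VU Vy hs]]]|[c [sc /near_open_nbhs[V [oV Vy hc]]]]].
  exists (fun j z => local_coef e s j z [::]); split=> [j|].
    have [os _] := local_coefP gB eB oV VU kN s.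
    have o0 : Omega V 0 (local_coef e s j) by move: j; have := os 0%N; rewrite subr0.
    have [fo _] := o0; have [_ so] := fo y Vy.
    by have := so (fun _ _ => 0) 0%N; apply => _; exact: vsmooth_0.
  have nV : nbhs y V by exact: open_nbhs_nbhs.
  by apply: filterS nV => z Vz; rewrite -hs// span.
have nV : nbhs y V by exact: open_nbhs_nbhs.
apply: (vsmooth_eq_near (s := fun z => \sum_j c j z *: ev std U k (e j) z)).
  by apply: filterS nV => z /hc ->.
by apply: vsmooth_sum => j; apply: vsmoothZ => //; exact: (ev_smooth std).
Qed.
End Frame.
End StandardFrame.

Section BundleOfSheaf.
Context {R : realType} {n : nat} {M : manifold R n} {A : vbundle M}.
Context {B : gsheaf A} {r : int -> nat}.
Hypothesis gB : is_gbundle B r.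
Implicit Types (U V W : set M) (x y : M) (k : int).

(** The fibre at [x] is the space of coordinates in a local basis chosen
    around [x]. *)
Lemma standard_exists : exists E : int -> vbundle M,
  (forall i, bundle_rk E i = r i) /\ inhabited (standard B E).
Proof.
(* The range of degrees |k| + [vrk A] is the one required by [basis_functionalP]. *)
have H k x : exists Ue : {U : set M & forall i, 'I_(r i) -> sec B U i},
    tag Ue x /\ local_basis (tagged Ue) (absz k + vrk A).
  have [U [e [Ux eB]]] := local_basis_exists gB x (absz k + vrk A).
  by exists (existT _ U e).
pose C k x := projT1 (cid (H k x)).
pose Uc k x := tag (C k x); pose ec k x : forall i, 'I_(r i) -> sec B (Uc k x) i := tagged (C k x).
have Ux k x : Uc k x x by have [] := projT2 (cid (H k x)).
have eB k x : local_basis (ec k x) (absz k + vrk A) by have [] := projT2 (cid (H k x)).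
have oU k x : open (Uc k x) by have [] := eB k x.
have hN k : (`|k| + (vrk A)%:Z <= (absz k + vrk A)%N%:Z)%R by lia.
have kN k : (`|k| <= (absz k + vrk A)%N%:Z)%R by lia.
pose F k V (s : sec B V k) y : 'rV[R]_(r k) := basis_functional (e := ec k y) y s.
have FF k y : fibre_functional y (fun V (s : sec B V k) => F k V s y).
  exact: (basis_functionalP gB (eB k y) (hN k) (Ux k y)).
(* Evaluation [F] at [y] is universal: every functional on the fibre is a linear function of it.
   Vanishing of [F] thus implies vanishing of the coordinates in any other local basis. *)
have factor k y (W : lmodType R) (f : forall V, sec B V k -> W) V s :
    fibre_functional y f -> open V -> V y ->
    f V s = \sum_j F k V s y 0 j *: f (Uc k y) (ec k y k j).
  move=> hf oV Vy; have oVU := openI oV (oU k y).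
  have I1 : V `&` Uc k y `<=` V by move=> z [].
  have I2 : V `&` Uc k y `<=` Uc k y by move=> z [].
  have VUy : (V `&` Uc k y) y by split=> //; exact: Ux.
  rewrite -(ff_res hf s oV oVU I1)//.
  rewrite (fibre_functional_basis gB (eB k y) _ hf (kN k) oVU I2 VUy).
  by apply: eq_bigr => j _; rewrite mxE.
have span k x y V s : open V -> V `<=` Uc k x -> V y ->
    F k V s y = \sum_j local_coef (ec k x) s j y [::] *: F k (Uc k x) (ec k x k j) y.
  by move=> oV VU Vy; exact: (fibre_functional_basis gB (eB k x) _ (FF k y)).
(* Smooth sections are by definition those which locally come from sections of the sheaf. *)
pose sm k (f : M -> 'rV[R]_(r k)) x := exists V (s : sec B V k),
  [/\ open V, V x & forall y, V y -> F k V s y = f y].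
have frame k x : exists (U : set M) (e : 'I_(r k) -> M -> 'rV[R]_(r k)),
    [/\ open U, U x,
        forall y, U y -> forall v : 'rV[R]_(r k),
          exists! c : 'rV[R]_(r k), v = \sum_i c 0 i *: e i y
      & forall y, U y -> forall s : M -> 'rV[R]_(r k), sm k s y <->
          exists c : 'I_(r k) -> M -> R, (forall i, smooth_at (c i) y) /\
            \forall z \near y, s z = \sum_i c i z *: e i z].
  exists (Uc k x), (fun j y => F k (Uc k x) (ec k x k j) y); split=> // y Uy.
    move=> v; pose s := \sum_j v 0 j *: ec k y k j.
    have sv : F k (Uc k y) s y = v.
      rewrite /F (basis_functional_comb gB (eB k y) (fun j => v 0 j) (hN k) (Ux k y)).
      by apply/rowP => j; rewrite mxE.
    have oUU := openI (oU k y) (oU k x).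
    have I1 : Uc k y `&` Uc k x `<=` Uc k y by move=> z [].
    have I2 : Uc k y `&` Uc k x `<=` Uc k x by move=> z [].
    have yy : (Uc k y `&` Uc k x) y by split.
    exists (\row_j local_coef (ec k x) (res B _ (Uc k y `&` Uc k x) k s) j y [::]); split.
      rewrite -[LHS]sv -(ff_res (FF k y) s (oU k y) oUU I1 yy) (span k x)//.
      by apply: eq_bigr => j _; rewrite mxE.
    set d := \row_j _; move=> c vc; apply/eqP; rewrite -subr_eq0; apply/eqP/rowP => j.
    rewrite !mxE.
    (* The difference of two coordinate rows of [v] gives a section on which [F] vanishes at [y]; by
       [factor] its coordinates in the basis chosen around [x] vanish as well. *)
    pose t := \sum_j (d 0 j - c 0 j) *: ec k x k j.
    have lF := ff_lin (FF k y) (oU k x) Uy.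
    have t0 : F k (Uc k x) t y = 0.
      rewrite (lin_sum lF); under eq_bigr do rewrite (linZ lF) scalerBl.
      rewrite big_split /= sumrN -vc.
      apply/eqP; rewrite subr_eq0; apply/eqP.
      rewrite -[RHS]sv -(ff_res (FF k y) s (oU k y) oUU I1 yy) (span k x)//.
      by apply: eq_bigr => l _; rewrite mxE.
    have hl := basis_functionalP gB (eB k x) (hN k) Uy.
    have := factor k y _ _ (Uc k x) t hl (oU k x) Uy.
    rewrite (basis_functional_comb gB (eB k x) (fun j => d 0 j - c 0 j) (hN k) Uy).
    rewrite big1 => [/rowP/(_ j)|l _]; last by rewrite t0 mxE scale0r.
    by rewrite !mxE.
  move=> f; split=> [[V [s [oV Vy hs]]]|[c [sc ec']]].
    have oVU := openI oV (oU k x).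
    have I1 : V `&` Uc k x `<=` V by move=> z [].
    have I2 : V `&` Uc k x `<=` Uc k x by move=> z [].
    have VUy : (V `&` Uc k x) y by [].
    set s' := res B V (V `&` Uc k x) k s.
    exists (fun j z => local_coef (ec k x) s' j z [::]); split=> [j|].
      have [os _] := local_coefP gB (eB k x) oVU I2 (kN k) s'.
      have o0 : Omega (V `&` Uc k x) 0 (local_coef (ec k x) s' j).
        by move: j; have := os 0%N; rewrite subr0.
      have [fo _] := o0; have [_ so] := fo y VUy.
      by have := so (fun _ _ => 0) 0%N; apply => _; exact: vsmooth_0.
    have nV : nbhs y (V `&` Uc k x) by exact: open_nbhs_nbhs.
    apply: filterS nV => z Vz; have [Vz' _] := Vz; rewrite -hs//.
    by rewrite -(ff_res (FF k z) s oV oVU I1 Vz) (span k x).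
  have nsc : \forall z \near y, forall j, smooth_at (c j) z.
    by apply: filter_forall => j; exact: smooth_at_near.
  have nU : nbhs y (Uc k x) by exact: open_nbhs_nbhs.
  have /near_open_nbhs[V [oV Vy hV]] : \forall z \near y, [/\ Uc k x z,
      forall j, smooth_at (c j) z & f z = \sum_i c i z *: F k (Uc k x) (ec k x k i) z].
    by near=> z; split; near: z.
  have VU : V `<=` Uc k x by move=> z /hV[].
  exists V, (\sum_j act B V k k (funform (c j)) (res B (Uc k x) V k (ec k x k j))).
  split=> // z Vz; have [_ _ ->] := hV z Vz.
  rewrite (lin_sum (ff_lin (FF k z) oV Vz)); apply: eq_bigr => j _.
  rewrite (ff_act0 (FF k z))//; last by apply: Omega_funform => w /hV[].
  by rewrite (ff_res (FF k z)).
pose E k : vbundle M := @VBundle R n M (fun=> 'rV[R]_(r k)) (r k) (sm k) (frame k).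
exists E; split=> //; constructor.
apply: (@Standard _ _ _ _ _ E (fun U k s x => F k U s x)).
- by move=> U k s oU' x Ux'; exists U, s.
- by move=> U V k s oU' oV VU x Vx; exact: (ff_res (FF k x)).
- by move=> U k c s t oU' x Ux'; exact: (ff_lin (FF k x)).
- by move=> U k al s oU' oal x Ux'; exact: (ff_act0 (FF k x)).
- by move=> U k p al s oU' oal x Ux'; exact: (ff_act (FF _ x) _ oU' Ux' oal).
- by move=> k f x [V [s hs]]; exists V, s.
move=> U k s oU' s0 x Ux'.
have oVU := openI oU' (oU k x).
have I1 : U `&` Uc k x `<=` U by move=> z [].
have I2 : U `&` Uc k x `<=` Uc k x by move=> z [].
exists (U `&` Uc k x); split=> //.
set s' := res B U (U `&` Uc k x) k s.
have [os es] := local_coefP gB (eB k x) oVU I2 (kN k) s'.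
rewrite es; apply: (gcomb_positive gB _ oVU os) => j y VUy t.
have [Uy Uxy] := VUy.
have o0 : Omega (U `&` Uc k x) 0 (local_coef (ec k x) s' j).
  by move: j; have := os 0%N; rewrite subr0.
have [/size0nil ->|ht] := eqVneq (size t) 0%N; last first.
  by have [_ ->] := o0 => //; exact/eqP.
have hl := basis_functionalP gB (eB k x) (hN k) Uxy.
have /rowP/(_ j) := factor k y _ _ U s hl oU' Uy.
rewrite !mxE => ->; rewrite summxE big1// => l _.
by rewrite s0// !mxE mul0r.
Unshelve. all: by end_near. Qed.
End BundleOfSheaf.

(** * Decompositions *)

Section Decomposition.
Context {R : realType} {n : nat} {M : manifold R n} {A : vbundle M}.
Context {B : gsheaf A} {r : int -> nat} {E : int -> vbundle M}.
Hypothesis gB : is_gbundle B r.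
Variable std : standard B E.
Implicit Types (U V W : set M) (x y : M) (k : int).

Section LocalPart.
Context {i : int} {U : set M} {e : forall i, 'I_(r i) -> sec B U i}.
Let N := (absz i + vrk A)%N.
Hypothesis eB : local_basis e N.

Definition local_part V k (s : sec B V k) x (t : seq (A x)) : E i x :=
  \sum_(j < r i) local_coef e (res B V (V `&` U) k s) j x t *: ev std U i (e j) x.

Context {V : set M} {k : int}.
Hypotheses (oV : open V) (kN : (`|k| <= N%:Z)%R).

Let oU : open U. Proof. by have [] := eB. Qed.
Let oVU : open (V `&` U). Proof. exact: openI. Qed.
Let I1 : V `&` U `<=` V. Proof. by move=> z []. Qed.
Let I2 : V `&` U `<=` U. Proof. by move=> z []. Qed.

Lemma local_part_linear a (s t : sec B V k) x u : V x -> U x ->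
  local_part (a *: s + t) u = a *: local_part s u + local_part t u :> E i x.
Proof.
move=> Vx Ux; rewrite /local_part scaler_sumr -big_split; apply: eq_bigr => j _ /=.
rewrite (res_linear gB oV oVU I1) (local_coef_linear gB eB oVU I2 kN _ _ _ _ _ (conj Vx Ux)).
by rewrite scalerDl scalerA.
Qed.

Lemma local_part_res W (s : sec B V k) x u : open W -> W `<=` V -> W x -> U x ->
  local_part (res B V W k s) u = local_part s u :> E i x.
Proof.
move=> oW WV Wx Ux; apply: eq_bigr => j _.
have oWU := openI oW oU; have S : W `&` U `<=` V `&` U by move=> z [/WV].
rewrite (res_comp gB)//.
by rewrite -(res_comp gB _ oV oVU oWU)// (local_coef_res gB eB oVU I2 kN).
Qed.

Lemma local_part_act q l al (s : sec B V k) x u : (`|l| <= N%:Z)%R -> l = k + q%:Z ->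
  Omega V q al -> V x -> U x ->
  local_part (act B V k l al s) u = shuf (al x) (@local_part V k s x) u :> E i x.
Proof.
move=> lN kl oal Vx Ux; rewrite shuf_sumr; apply: eq_bigr => j _.
rewrite shuf_scale_cst (act_res_eq gB s oV oVU I1 oal kl).
by rewrite (local_coef_act gB eB _ _ _ oVU I2 kN lN kl (Omega_sub I1 oal) (conj Vx Ux)).
Qed.

Lemma local_part_form (s : sec B V k) :
  is_form (@vsmooth _ _ _ (E i)) (V `&` U) (@local_part V k s) /\
  forall x t, V x -> U x -> (size t)%:Z + i <> k -> local_part s t = 0 :> E i x.
Proof.
have [os _] := local_coefP gB eB oVU I2 kN (res B V (V `&` U) k s).
have [ik|ki] := leP i k; last first.
  have z x t : local_part s t = 0 :> E i x.
    by apply: big1 => j _; rewrite local_coef_gt// scale0r.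
  split=> // x _; split.
    by split=> *; rewrite !z ?scaler0 ?addr0.
  move=> a p _; apply: vsmooth_eq_near (vsmooth_0 (E i) x).
  by apply: nearW => y; rewrite z.
have [p ip] : exists p : nat, i = k - p%:Z by exists `|(k - i)%R|%N; lia.
have oi (j : 'I_(r i)) : Omega (V `&` U) p (local_coef e (res B V (V `&` U) k s) j).
  have h i' (j' : 'I_(r i')) : i' = k - p%:Z ->
      Omega (V `&` U) p (local_coef e (res B V (V `&` U) k s) j').
    by move=> ip'; subst i'; exact: os.
  exact: h.
split; last first.
  move=> x t Vx Ux ht; apply: big1 => j _; have [_ ->] := oi j => //.
    by rewrite scale0r.
  by move=> st; apply: ht; rewrite st ip; lia.
move=> x VUx; have [Vx Ux] := VUx; split.
  split=> [s' t c u v|s' t p' u].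
    rewrite /local_part scaler_sumr -big_split; apply: eq_bigr => j _ /=.
    have [fo _] := oi j; have [[lo _] _] := fo x VUx.
    by rewrite lo scalerDl scalerA.
  apply: big1 => j _; have [fo _] := oi j; have [[_ ao] _] := fo x VUx.
  by rewrite ao scale0r.
move=> a q sa; apply: vsmooth_sum => j; apply: vsmoothZ; last exact: (ev_smooth std).
by have [fo _] := oi j; have [_ so] := fo x VUx; exact: so.
Qed.
End LocalPart.
Arguments local_part {i U} e {V k} s x t.

Lemma local_part_ev i U (e : forall i, 'I_(r i) -> sec B U i) V (s : sec B V i) x :
  local_basis e (absz i + vrk A)%N -> open V -> V x -> U x ->
  local_part e s x [::] = ev std V i s x.
Proof.
move=> eB oV Vx Ux; have [oU _] := eB; have oVU := openI oV oU.
have I1 : V `&` U `<=` V by move=> z [].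
have I2 : V `&` U `<=` U by move=> z [].
have iN : (`|i| <= (absz i + vrk A)%N%:Z)%R by lia.
have ef := ev_functional std i x.
rewrite -(ff_res ef s oV oVU I1 (conj Vx Ux)).
by rewrite (fibre_functional_basis gB eB _ ef iN oVU I2 (conj Vx Ux)).
Qed.

(** As forms of degree above the rank of [A] vanish, the [E i]-component of a
    decomposition is nonzero in the degrees [i, ..., i + rank A] only, and there it
    can be read off from a local basis for the degrees bounded by
    [`|i| + rank A]; such local components are averaged by a partition of unity. *)
Lemma decomposition_component (i : int) :
  exists Th : forall V k, sec B V k -> forall x, seq (A x) -> E i x,
  let N := ((absz i + vrk A)%N%:Z)%R in
  (forall V k, open V -> (`|k| <= N)%R ->
  [/\ forall s, is_form (@vsmooth _ _ _ (E i)) V (Th V k s) /\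
        forall x t, V x -> (size t)%:Z + i <> k -> Th V k s x t = 0,
      forall a s t x u, V x -> Th V k (a *: s + t) x u = a *: Th V k s x u + Th V k t x u,
      forall W s x u, open W -> W `<=` V -> W x ->
        Th W k (res B V W k s) x u = Th V k s x u
    & forall q l al s x u, (`|l| <= N)%R -> l = k + q%:Z -> Omega V q al -> V x ->
        Th V l (act B V k l al s) x u = shuf (al x) (Th V k s x) u]) /\
  forall V (s : sec B V i) x, open V -> V x -> Th V i s x [::] = ev std V i s x.
Proof.
set N := (absz i + vrk A)%N.
have H x : exists Ue : {U : set M & forall i, 'I_(r i) -> sec B U i},
    tag Ue x /\ local_basis (tagged Ue) N.
  have [U [e [Ux eB]]] := local_basis_exists gB x N.
  by exists (existT _ U e).
pose C x := projT1 (cid (H x)).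
pose Uc x := tag (C x); pose ec x : forall i, 'I_(r i) -> sec B (Uc x) i := tagged (C x).
have Ux x : Uc x x by have [] := projT2 (cid (H x)).
have eB x : local_basis (ec x) N by have [] := projT2 (cid (H x)).
have oU x : open (Uc x) by have [] := eB x.
have [psi [z [spsi zP loc]]] := smooth_partition (fun x => conj (oU x) (Ux x)).
have zU a w x : z a = Some w -> ~ Uc w x -> \forall y \near x, psi a y = 0.
  move=> zw nU; have := zP a; rewrite zw => -[K [cK KU K0]].
  have : nbhs x (~` K) by apply: open_nbhs_nbhs; split; [exact: closed_openC|move=> /KU].
  by apply: filterS => y /K0.
have /choice[m hm] : forall x, exists m, \forall y \near x,
    (forall a, (m <= a)%N -> psi a y = 0) /\ \sum_(a < m) psi a y = 1.
  move=> x; have [V [m [oV Vx hV]]] := loc x; exists m.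
  have : nbhs x V by exact: open_nbhs_nbhs.
  by apply: filterS.
(* The value 0 outside [Uc w] is harmless, because [psi a] vanishes near every such point. *)
pose T a V k (s : sec B V k) x t : E i x := if z a is Some w then
  (if pselect (Uc w x) then local_part (ec w) s x t else 0) else 0.
pose Th V k (s : sec B V k) x t : E i x := \sum_(a < m x) psi a x *: T a V k s x t.
(* The bound [m y] may jump with [y]. Near [x], the fixed bound [m x] gives the same sums, which is
   what smoothness at [x] needs. *)
have ThE x y V k s t : (forall a, (m x <= a)%N -> psi a y = 0) ->
    Th V k s y t = \sum_(a < m x) psi a y *: T a V k s y t.
  move=> hx; have [hy _] := nbhs_singleton (hm y).
  pose F a := psi a y *: T a V k s y t.
  have big0 p q : (p <= q)%N -> (forall a, (p <= a)%N -> psi a y = 0) ->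
      \sum_(a < q) F a = \sum_(a < p) F a.
    move=> pq hp; rewrite -(big_mkord xpredT F) (big_cat_nat (n := p))//= big_mkord.
    rewrite -[RHS]addr0; congr (_ + _); rewrite big_nat big1// => a /andP[pa _].
    by rewrite /F hp// scale0r.
  have [le|/ltnW le] := leqP (m x) (m y); first exact: big0.
  exact/esym/big0.
exists Th; split=> [V k oV kN|V s x oV Vx]; last first.
  have [h0 h1] := nbhs_singleton (hm x).
  rewrite -[RHS]scale1r -h1 scaler_suml; apply: eq_bigr => a _.
  rewrite /T; case za : (z a) => [w|]; last first.
    by have := zP a; rewrite za => ->; rewrite !scale0r.
  case: pselect => [Uw|nU]; last by rewrite (nbhs_singleton (zU a w x za nU)) !scale0r.
  by rewrite (local_part_ev s (eB w) oV Vx Uw).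
split.
- move=> s; have Tz a x t : V x -> (size t)%:Z + i <> k -> T a V k s x t = 0.
    move=> Vx ht; rewrite /T; case: (z a) => // w; case: pselect => // Uw.
    by have [_ ->] := local_part_form (eB w) oV kN s.
  split=> [x Vx|x t Vx ht]; last by apply: big1 => a _; rewrite Tz// scaler0.
  split.
    apply: (alternating_sum (fun a : 'I_(m x) => psi a x)
      (w := fun (a : 'I_(m x)) t => T a V k s x t)) => a.
    rewrite /T; case: (z a) => [w|]; last by split=> *; rewrite ?scaler0 ?addr0.
    case: pselect => [Uw|nU]; last by split=> *; rewrite ?scaler0 ?addr0.
    have [f _] := local_part_form (eB w) oV kN s.
    by have [] := f x (conj Vx Uw).
  move=> b q sb.
  apply: (vsmooth_eq_near (s := fun y => \sum_(a < m x) psi a y *: T a V k s y (args b q y))).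
    have := hm x; apply: filterS => y [hy _]; exact/esym/ThE.
  apply: vsmooth_sum => a; rewrite /T; case za : (z a) => [w|]; last first.
    apply: vsmooth_eq_near (vsmooth_0 (E i) x); apply: nearW => y.
    by rewrite scaler0.
  have [Uw|nU] := pselect (Uc w x); last first.
    apply: vsmooth_eq_near (vsmooth_0 (E i) x); have := zU a w x za nU.
    by apply: filterS => y ->; rewrite scale0r.
  apply: vsmoothZ => //.
  have [f _] := local_part_form (eB w) oV kN s.
  have [_ sf] := f x (conj Vx Uw); apply: vsmooth_eq_near (sf b q sb).
  have : nbhs x (Uc w) by exact: open_nbhs_nbhs.
  by apply: filterS => y Uy; case: pselect.
- move=> a s t x u Vx; rewrite /Th scaler_sumr -big_split; apply: eq_bigr => b _ /=.
  rewrite scalerA mulrC -scalerA -scalerDr; congr (_ *: _).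
  rewrite /T; case: (z b) => [w|]; last by rewrite scaler0 addr0.
  case: pselect => [Uw|nU]; last by rewrite scaler0 addr0.
  by rewrite (local_part_linear (eB w)).
- move=> W s x u oW WV Wx; apply: eq_bigr => b _; congr (_ *: _).
  rewrite /T; case: (z b) => [w|]//; case: pselect => // Uw.
  by rewrite (local_part_res (eB w)).
- move=> q l al s x u lN kl oal Vx; rewrite /Th shuf_sumr; apply: eq_bigr => b _.
  rewrite shufZr; congr (_ *: _); rewrite /T; case: (z b) => [w|]; last by rewrite shuf0r.
  case: pselect => [Uw|nU]; last by rewrite shuf0r.
  by rewrite (local_part_act (eB w) oV kN _ _ lN kl oal).
Qed.
End Decomposition.

Lemma forall_choice (I : Type) (T : I -> Type) (P : forall i, T i -> Prop) :
  (forall i, exists t, P i t) -> exists f : forall i, T i, forall i, P i (f i).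
Proof.
move=> h; exists (fun i => projT1 (cid (h i))) => i.
exact: projT2 (cid (h i)).
Qed.

Section GmorGcomb.
Context {R : realType} {n : nat} {M : manifold R n} {A : vbundle M}.
Context {B B' : gsheaf A} {r : int -> nat}.
Implicit Types (U V W : set M).

Lemma gmor_gcomb (f : gmor B B') U (e : forall i, 'I_(r i) -> sec B U i) V k
    (c : forall i, 'I_(r i) -> sform A) : is_gmor f -> open U -> open V -> V `<=` U ->
  (forall (p : nat) j, Omega V p (c (k - p%:Z) j)) ->
  f V k (gcomb V e k c) = gcomb V (fun i j => f U i (e i j)) k c.
Proof.
move=> hf oU oV VU oc; have lf := gmor_linear hf (k := k) oV.
rewrite /gcomb (lin_sum lf); apply: eq_bigr => p _; rewrite (lin_sum lf).
apply: eq_bigr => j _; rewrite (gmor_act_eq _ hf oV (oc p j)) ?subrK//.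
by rewrite (gmor_res hf).
Qed.

Lemma gcomb_eq0 (gB : is_gbundle B r) U (e : forall i, 'I_(r i) -> sec B U i) V k
    (c : forall i, 'I_(r i) -> sform A) : open V ->
  (forall (p : nat) j x, V x -> forall t, c (k - p%:Z) j x t = 0) -> gcomb V e k c = 0.
Proof.
move=> oV c0; apply: big1 => p _; apply: big1 => j _.
by apply: (act0l gB (p := p)) => //; [rewrite subrK|exact: c0].
Qed.
End GmorGcomb.

Section DecompositionExists.
Context {R : realType} {n : nat} {M : manifold R n} {A : vbundle M}.
Context {B : gsheaf A} {r : int -> nat} {E : int -> vbundle M}.
Hypothesis gB : is_gbundle B r.
Variable std : standard B E.
Implicit Types (U V W : set M) (x y : M) (k : int).

Lemma psec_component_eq0 V k (w : psec A E V k) x i t : V x ->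
  (absz i + vrk A)%N%:Z < `|k|%R -> pval w x i t = 0.
Proof.
move=> Vx hk; have [e|ne] := pselect ((size t)%:Z + i = k); last exact: pval_degree.
by apply: alternating_rank; [exact: is_form_alternating|lia].
Qed.

Lemma decomposition_exists : exists (f : gmor B (pullback A E)) (g : gmor (pullback A E) B),
  inverse_gmor f g /\ forall U k s, open U -> forall x, U x ->
    pval (f U k s : psec A E U k) x k [::] = ev std U k s x.
Proof.
pose N (i : int) : int := (absz i + vrk A)%N%:Z.
have [Th hTh] := forall_choice (decomposition_component gB std).
(* The components from [hTh] are controlled only for |k| <= N i. Beyond this range the form degree k
   - i is negative or above the rank of [A], so 0 is forced. *)
pose raw V k (s : sec B V k) : rawform A E := fun x i t =>
  if x \in V then (if `|k|%R <= N i then Th i V k s x t else 0) else 0.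
have raw_psec V k (s : sec B V k) : open V -> is_psec V k (raw V k s).
  move=> oV; split; last 2 first.
  - move=> x i t ht; rewrite /raw; case: ifPn => // /set_mem Vx; case: ifPn => // kN.
    by have [/(_ V k oV kN)[/(_ s)[_ ->]]] := hTh i.
  - by move=> x nV i t; rewrite /raw memNset.
  move=> i; have [kN|kN] := boolP (`|k|%R <= N i).
    have [/(_ V k oV kN)[/(_ s)[fT _] _ _ _] _] := hTh i.
    apply: (is_form_eq (v := fun x => Th i V k s x)) => //.
      by move=> s' t x; exact: vsmooth_eq_near.
    by move=> x Vx t; rewrite /raw mem_set// kN.
  have z x t : raw V k s x i t = 0 by rewrite /raw (negbTE kN) if_same.
  move=> x Vx; split; first by split=> *; rewrite !z ?scaler0 ?addr0.
  move=> a p _; apply: vsmooth_eq_near (vsmooth_0 (E i) x).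
  by apply: nearW => y; rewrite z.
pose f : gmor B (pullback A E) := fun V k s => mk_psec V k (raw V k s).
have fE V k s x i t : open V -> V x -> pval (f V k s : psec A E V k) x i t =
    if `|k|%R <= N i then Th i V k s x t else 0.
  by move=> oV Vx; rewrite mk_psecE ?/raw ?mem_set//; exact: raw_psec.
have hf : is_gmor f.
  split.
  - move=> V k oV a s t; apply: psec_ext => x Vx i u.
    rewrite pval_linear !fE//; case: ifPn => kN; last by rewrite scaler0 addr0.
    by have [/(_ V k oV kN)[_ h _ _] _] := hTh i; exact: h.
  - move=> V k p al s oV oal; set l := k + p%:Z; apply: psec_ext => x Vx i u.
    have [lN|lN] := leP `|l|%R (N i); last by rewrite !psec_component_eq0.
    rewrite (pval_act _ _ _ oV oal)// fE// lN.
    have [kN|kN] := leP `|k|%R (N i).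
      rewrite (_ : pval _ x i = Th i V k s x); last first.
        by apply/funext => t; rewrite fE// kN.
      by have [/(_ V k oV kN)[_ _ _ h] _] := hTh i; rewrite (h p).
    rewrite (_ : pval _ x i = fun=> 0) ?shuf0r; last first.
      by apply/funext => t; rewrite psec_component_eq0.
    have [/(_ V l oV lN)[h1 h2 _ _] _] := hTh i.
    (* Here [l] is in the controlled range of degrees but [k] is not. Either l < i, where the form
       degree would be negative, or k < -|i| - [vrk A] and the degree [p] of [al] exceeds the
       rank. *)
    have [il|li] := leP i l; last first.
      by have [_ ->] := h1 (act B V k l al s); rewrite //; lia.
    rewrite (act_rank gB s oV oal)//; last by rewrite /l /N in kN il lN *; lia.
    by have := h2 (-1) 0 0 x u Vx; rewrite scaler0 addr0 scaleN1r addNr.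
  - move=> U V k s oU oV VU; apply: psec_ext => x Vx i u.
    rewrite pval_resV// !fE//; last exact: VU.
    case: ifPn => // kN.
    by have [/(_ U k oU kN)[_ _ h _] _] := hTh i; exact: h.
have fev U k s : open U -> forall x, U x ->
    pval (f U k s : psec A E U k) x k [::] = ev std U k s x.
  move=> oU x Ux; rewrite fE// ifT; last by rewrite /N; lia.
  by have [_ ->] := hTh k.
have gE := @pullback_gbundle _ _ _ A E.
have bij U k : open U -> injective (f U k) /\ forall w, exists s, f U k s = w.
  move=> oU; apply: (gmor_bijective_local gB gE hf oU) => x Ux.
  (* Twice the rank: once for the generators of degrees k - p occurring in degree [k], once more for
     the margin of [standard_frame] in each of these degrees. *)
  have [W [e [Wx eB]]] := local_basis_exists gB x (absz k + (vrk A + vrk A)).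
  have [oW eP] := eB; exists W; split=> // V oV VW.
  have kN : (`|k| <= (absz k + (vrk A + vrk A))%N%:Z)%R by lia.
  (* The image of the basis has as parts of form degree 0 the frames of [standard_frame], so it is a
     basis as well; as [f] keeps coefficients, it is bijective over [V]. *)
  pose b i (j : 'I_(r i)) : psec A E W i := f W i (e i j).
  have fb (p : nat) : (p <= vrk A)%N ->
      frame_on W (fun (j : 'I_(r (k - p%:Z))) y => pval (b _ j) y (k - p%:Z) [::]).
    move=> pA; have hN : (`|k - p%:Z| + (vrk A)%:Z <=
        (absz k + (vrk A + vrk A))%N%:Z)%R by lia.
    by apply: (frame_on_eq oW _ (standard_frame gB std eB hN)) => j y Wy; rewrite fev.
  have [gen free] := eP V k oV VW kN.
  split=> [s t st|w].
    apply/eqP; rewrite -subr_eq0; apply/eqP.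
    have [c [oc sc]] := gen (s - t).
    rewrite sc; apply: (gcomb_eq0 gB) => //.
    apply: (psec_coefs_unique oV VW fb oc).
    have <- := gmor_gcomb e hf oW oV VW oc.
    by rewrite -sc (linB (gmor_linear hf oV)) st subrr.
  have [c [oc wc]] := psec_coefs_exist oW oV VW fb w.
  exists (gcomb V e k c); rewrite (gmor_gcomb e hf oW oV VW oc).
  exact/esym.
have [g hg] := gmor_inverse hf bij.
by exists f, g.
Qed.
End DecompositionExists.

(** * Localisation of morphisms of global sections *)

Section Localisation.
Context {R : realType} {n : nat} {M : manifold R n} {A : vbundle M}.
Implicit Types (U V W : set M) (x y : M) (k : int).

Definition is_bump U x (f : M -> R) :=
  [/\ forall y, smooth_at f y, \forall y \near x, f y = 1
    & exists K, [/\ closed K, K `<=` U & forall y, ~ K y -> f y = 0]].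

Lemma is_bump_exists U x : open U -> U x -> exists f, is_bump U x f.
Proof.
move=> oU Ux; have [f [sf [W [oW Wx W1]] hK]] := smooth_bump oU Ux.
exists f; split=> //; have : nbhs x W by exact: open_nbhs_nbhs.
by apply: filterS.
Qed.

Lemma is_bump_out U x f y : is_bump U x f -> ~ U y -> \forall z \near y, f z = 0.
Proof.
move=> [_ _ [K [cK KU K0]]] nU.
have : nbhs y (~` K) by apply: open_nbhs_nbhs; split; [exact: closed_openC|move=> /KU].
by apply: filterS.
Qed.

Definition bump U x : M -> R := xget (fun=> 0) (is_bump U x).

Lemma bumpP U x : open U -> U x -> is_bump U x (bump U x).
Proof.
by move=> oU Ux; have [f hf] := is_bump_exists oU Ux; apply: xgetPex; exists f.
Qed.

Section Truncation.
Context {E : int -> vbundle M}.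

Definition truncate U k (f : M -> R) (w : psec A E U k) : psec A E setT k :=
  mk_psec setT k ((fun x i s => f x *: pval w x i s) : rawform A E).

Lemma truncateE U k x f (w : psec A E U k) y i s : open U -> is_bump U x f ->
  pval (truncate f w) y i s = f y *: pval w y i s.
Proof.
move=> oU bf; rewrite mk_psecE//; split=> [j y' _|y' j u hu|y' /(_ I)//]; last first.
  by rewrite pval_degree// scaler0.
have [sf _ _] := bf; have [Uy|nU] := pselect (U y').
  have [fw _ _] := psecP w; have [[lw aw] sw] := fw j y' Uy; split.
    split=> *; last by rewrite aw scaler0.
    by rewrite lw scalerDr !scalerA mulrC.
  by move=> a p sa; apply: vsmoothZ => //; exact: sw.
have f0 := is_bump_out bf nU; split.
  by split=> *; rewrite (nbhs_singleton f0) !scale0r ?scaler0 ?addr0.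
move=> a p sa; apply: vsmooth_eq_near (vsmooth_0 (E j) y').
by apply: filterS f0 => z ->; rewrite scale0r.
Qed.
End Truncation.

Context {E E' : int -> vbundle M}.
Let B := pullback A E.
Let B' := pullback A E'.

Section Extension.
Variable phi : forall k, sec B setT k -> sec B' setT k.
Hypothesis hphi : is_module_mor phi.
Let psi k (w : psec A E setT k) : psec A E' setT k := phi w.

(** For a bump f at [x] supported where w vanishes, f w = 0, so f phi(w) = phi(f w) = 0, while f is
    1 at [x]. *)
Lemma module_mor_support k (w : psec A E setT k) x i s :
  (\forall y \near x, forall i s, pval w y i s = 0) -> pval (psi w) x i s = 0.
Proof.
move=> /near_open_nbhs[V [oV Vx w0]]; have [lphi aphi] := hphi.
have [f [sf f1 [K [cK KV K0]]]] := is_bump_exists oV Vx.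
have of0 : Omega setT 0 (funform f : sform A) by apply: Omega_funform.
have z : act B setT k k (funform f) w = 0.
  apply: psec_ext => y _ j u; rewrite (pval_act _ _ _ openT of0) ?addr0//.
  rewrite shuf_deg0l//=; last by case.
  have [Vy|nV] := pselect (V y); first by rewrite w0// scaler0.
  by rewrite K0 ?scale0r// => /KV.
have := aphi k 0%N (funform f) w of0; rewrite addr0 z (lin0 (lphi k)).
move=> /(congr1 (fun w : psec A E' setT k => pval w x i s)).
rewrite pval0 (pval_act _ _ _ openT of0) ?addr0// shuf_deg0l//=; last by case.
by rewrite (nbhs_singleton f1) scale1r.
Qed.

Lemma module_mor_local k (v w : psec A E setT k) x i s :
  (\forall y \near x, forall i s, pval v y i s = pval w y i s) ->
  pval (psi v) x i s = pval (psi w) x i s.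
Proof.
move=> vw; have [lphi _] := hphi; apply/eqP; rewrite -subr_eq0 -pvalB.
rewrite -(linB (lphi k)); apply/eqP/module_mor_support.
by apply: filterS vw => y h j u; rewrite pvalB h subrr.
Qed.

(** The value of [phi w] at [x] only depends on [w] near [x]. *)
Definition localise : gmor B B' := fun U k w =>
  mk_psec U k ((fun x i s => if x \in U then
    pval (psi (truncate (bump U x) (w : psec A E U k))) x i s else 0) : rawform A E').

Lemma truncate_near U k f x (w : psec A E U k) : open U -> is_bump U x f ->
  \forall y \near x, forall i s, pval (truncate f w) y i s = pval w y i s.
Proof.
move=> oU bf; have [_ f1 _] := bf; apply: filterS f1 => y fy i s.
by rewrite (truncateE w i s oU bf) fy scale1r.
Qed.

Lemma localise_psec U k (w : psec A E U k) : open U ->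
  is_psec U k ((fun x i s => if x \in U then
    pval (psi (truncate (bump U x) w)) x i s else 0) : rawform A E').
Proof.
move=> oU; split=> [i x Ux|x i s hs|x nU i s]; last 2 first.
- by case: ifPn => // _; rewrite pval_degree.
- by rewrite memNset.
have [fw _ _] := psecP (psi (truncate (bump U x) w)).
have [aw sw] := fw i x I; split.
  by rewrite (_ : (fun s => _) = pval (psi (truncate (bump U x) w)) x i)// mem_set.
move=> a p sa; apply: vsmooth_eq_near (sw a p sa).
have nU : nbhs x U by exact: open_nbhs_nbhs.
(* The bump varies with the point. Near [x] the one chosen at [x] serves for all nearby points, by
   locality; the interior is taken since locality at [y] needs agreement around [y]. *)
have := truncate_near w oU (bumpP oU Ux) => /nbhs_interior h.
near=> y; have Uy : U y by near: y.
rewrite mem_set//; apply: module_mor_local.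
have hy : \forall z \near y, forall i s, pval (truncate (bump U x) w) z i s = pval w z i s.
  by near: y.
have hy' := truncate_near w oU (bumpP oU Uy).
by near=> z => j u; rewrite (near hy z)// (near hy' z).
Unshelve. all: by end_near. Qed.

Lemma localiseE U k (w : psec A E U k) (v : psec A E setT k) x i s : open U -> U x ->
  (\forall y \near x, forall i s, pval v y i s = pval w y i s) ->
  pval (localise w : psec A E' U k) x i s = pval (psi v) x i s.
Proof.
move=> oU Ux vw; rewrite mk_psecE; last exact: localise_psec.
rewrite mem_set//; apply: module_mor_local.
have tw := truncate_near w oU (bumpP oU Ux).
by near=> y => j u; rewrite (near tw y)// (near vw y).
Unshelve. all: by end_near. Qed.

Lemma localise_bump U k (w : psec A E U k) x i s : open U -> U x ->
  pval (localise w : psec A E' U k) x i s = pval (psi (truncate (bump U x) w)) x i s.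
Proof. by move=> oU Ux; apply: localiseE => //; apply: truncate_near => //; exact: bumpP. Qed.

Lemma localise_setT k (w : psec A E setT k) : localise w = psi w.
Proof. by apply: psec_ext => x _ i s; apply: localiseE openT I _; exact: nearW. Qed.

Lemma localise_gmor : is_gmor localise.
Proof.
have [lphi aphi] := hphi; split.
- move=> U k oU a s t; apply: psec_ext => x Ux i u; rewrite pval_linear !localise_bump//.
  rewrite -pval_linear; have lp : linear (@psi k) by exact: lphi.
  rewrite -lp -localise_bump//; apply: localiseE => //.
  have b := bumpP oU Ux.
  have h1 := truncate_near s oU b; have h2 := truncate_near t oU b.
  by near=> y => j v; rewrite !pval_linear (near h1 y)// (near h2 y).
- move=> U k p al s oU oal; apply: psec_ext => x Ux i u.
  have b := bumpP oU Ux; have [sf f1 [K [cK KU K0]]] := b.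
  (* The form [al] is given over [U] only, and [phi] is linear over global forms: [al] is replaced
     by its product with the bump, which agrees with it near [x]. *)
  have ofa := Omega_extend oU cK KU K0 sf oal.
  rewrite (pval_act _ _ _ oU oal)//.
  set f := bump U x in b sf f1 K0 ofa; set ws := truncate f s.
  have nU : nbhs x U by exact: open_nbhs_nbhs.
  have h := truncate_near s oU b.
  rewrite (localiseE (v := act B setT k (k + p%:Z) (fun y t => f y * al y t) ws) i u oU Ux).
    rewrite [psi _]aphi// (pval_act _ _ _ openT ofa)//.
    apply: shuf_eq => t _; last by rewrite localise_bump.
    by rewrite (nbhs_singleton f1) mul1r.
  near=> y => j v; have Uy : U y by near: y.
  rewrite (pval_act _ _ _ openT ofa)// (pval_act _ _ _ oU oal)//.
  apply: shuf_eq => t _; last by rewrite (near h y).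
  by rewrite (near f1 y)// mul1r.
- move=> U V k s oU oV VU; apply: psec_ext => x Vx i u.
  rewrite pval_resV// (localise_bump s i u oU (VU _ Vx)); apply: localiseE => //.
  have h := truncate_near s oU (bumpP oU (VU _ Vx)).
  have nV : nbhs x V by exact: open_nbhs_nbhs.
  near=> y => j v; rewrite (near h y)// pval_resV//; by near: y.
Unshelve. all: by end_near. Qed.
End Extension.
End Localisation.

Section LocaliseInverse.
Context {R : realType} {n : nat} {M : manifold R n} {A : vbundle M}.
Context {E E' : int -> vbundle M}.
Let B := pullback A E.
Let B' := pullback A E'.

Lemma localiseK (phi : forall k, sec B setT k -> sec B' setT k)
    (psi : forall k, sec B' setT k -> sec B setT k) U k :
  is_module_mor phi -> is_module_mor psi -> (forall k, cancel (@phi k) (@psi k)) ->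
  open U -> cancel (@localise _ _ _ _ _ _ phi U k) (@localise _ _ _ _ _ _ psi U k).
Proof.
move=> hphi hpsi phiK oU w; apply: psec_ext => x Ux i s.
have b := bumpP oU Ux; have h := truncate_near w oU b.
(* The image under [phi] of the truncation is a global section agreeing near [x] with the localised
   image of [w], so it can replace the latter. *)
rewrite (localiseE hpsi (v := phi k (truncate (bump U x) w)) i s oU Ux).
  by rewrite phiK (nbhs_singleton h).
have nU : nbhs x U by exact: open_nbhs_nbhs.
have h' := nbhs_interior h.
near=> y => j u; have Uy : U y by near: y.
by apply/esym/localiseE => //; near: y.
Unshelve. all: by end_near. Qed.

End LocaliseInverse.

Lemma localise_inverse R n (M : manifold R n) (A : vbundle M) (E E' : int -> vbundle M)
    (phi : forall k, sec (pullback A E) setT k -> sec (pullback A E') setT k)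
    (psi : forall k, sec (pullback A E') setT k -> sec (pullback A E) setT k) :
  inverse_module_mor phi psi ->
  inverse_gmor (localise phi : gmor (pullback A E) (pullback A E')) (localise psi).
Proof.
move=> [hphi hpsi K]; split; [exact: localise_gmor|exact: localise_gmor|].
move=> U k oU; split.
  exact: (localiseK hphi hpsi (fun k => (K k).1)).
exact: (localiseK hpsi hphi (fun k => (K k).2)).
Qed.

(** * The correspondence *)

Section Differential.
Context {R : realType} {n : nat} {M : manifold R n} {A : lie_algebroid M}.

Lemma size_del (T : Type) i (s : seq T) : (i < size s)%N -> size (del i s) = (size s).-1.
Proof.
move=> hi; rewrite /del size_cat size_takel 1?ltnW// size_drop.
by move: hi; case: (size s) => // m; rewrite subSS ltnS => /subnKC.
Qed.

Lemma anchor0 x (u : A x) : anchor u (fun=> 0) = 0.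
Proof.
have s0 y : smooth_at ((fun=> 0) : M -> R) y by exact: smooth_at_0.
have := anchor_tangent_linear u 1 s0 s0.
rewrite (_ : (fun=> _) = fun=> 0); last by apply/funext => y; rewrite mulr0 addr0.
by rewrite mul1r => /eqP; rewrite -subr_eq subrr => /eqP/esym.
Qed.

(** The Koszul formula determines the values of the differential on all
    sequences of vectors since these extend to global smooth sections. *)
Lemma dA_Omega p (al : sform A) : Omega setT p al -> Omega setT p.+1 (dA al).
Proof.
move=> [fal dal]; rewrite /dA; set P := [set be : sform A | _].
(* If no form satisfies the Koszul formula, the default value 0 of [dA] is still a form of the right
   degree. *)
have [[be Pbe]|nP] := pselect (exists be, P be); last first.
  rewrite xgetPN; first exact: Omega0.
  by move=> be Pbe; apply: nP; exists be.
have [fbe [be0 beK]] : P (xget (fun _ _ => 0) P) by apply: xgetPex; exists be.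
split=> // x _ [|v s]; first by rewrite be0.
move=> ps; have {}ps : size s <> p by move=> e; apply: ps; rewrite /= e.
have [a ga] : exists a : nat -> forall y, A y, forall i, gsmooth (a i) /\ a i x = nth 0 (v :: s) i.
  have /choice[a ha] : forall i, exists t : forall y, A y, gsmooth t /\ t x = nth 0 (v :: s) i.
    by move=> i; have [t gt tx] := gsmooth_through (nth 0 (v :: s) i); exists t.
  by exists a.
have as_ : args a (size s).+1 x = v :: s.
  rewrite -[RHS](mkseq_nth 0); apply: eq_mkseq => i.
  by have [_] := ga i.
rewrite -as_ beK; last by move=> i; have [] := ga i.
(* Every term of the formula, with the anchor or with the bracket, evaluates [al] on [size s]
   vectors, and this number differs from [p]. *)
rewrite /koszul big1 ?add0r => [|i _].
  apply: big1 => i _; apply: big1 => j ij; rewrite dal ?mulr0//.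
  rewrite /= size_del ?size_del ?size_mkseq ?ltn_ord//=; last first.
    by rewrite (leq_trans ij)// -ltnS ltn_ord.
  have := leq_ltn_trans (leq0n i) (leq_trans ij (ltn_ord j : (j <= size s)%N)).
  by case: (size s) ps.
rewrite (_ : (fun y => _) = fun=> 0) ?anchor0 ?mulr0//.
apply/funext => y; rewrite dal// size_del size_mkseq//=.
Qed.
End Differential.

Section Morphisms.
Context {R : realType} {n : nat} {M : manifold R n} {A : vbundle M}.
Implicit Types (B : gsheaf A).

Definition gmor_comp B B' B'' (g : gmor B' B'') (f : gmor B B') : gmor B B'' :=
  fun U k s => g U k (f U k s).

Lemma is_gmor_comp B B' B'' (g : gmor B' B'') (f : gmor B B') :
  is_gmor g -> is_gmor f -> is_gmor (gmor_comp g f).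
Proof.
move=> hg hf; split.
- by move=> U k oU a s t; rewrite /gmor_comp (gmor_linear hf oU) (gmor_linear hg oU).
- by move=> U k p al s oU oal; rewrite /gmor_comp (gmor_act hf)// (gmor_act hg).
- by move=> U V k s oU oV VU; rewrite /gmor_comp (gmor_res hf)// (gmor_res hg).
Qed.

Lemma inverse_gmor_id B : inverse_gmor (fun U k (s : sec B U k) => s) (fun U k s => s).
Proof. by split. Qed.

Lemma inverse_gmor_sym B B' (f : gmor B B') (g : gmor B' B) :
  inverse_gmor f g -> inverse_gmor g f.
Proof. by move=> [hf hg K]; split=> // U k oU; have [] := K U k oU. Qed.

Lemma inverse_gmor_comp B B' B'' (f : gmor B B') (g : gmor B' B)
    (f' : gmor B' B'') (g' : gmor B'' B') :
  inverse_gmor f g -> inverse_gmor f' g' ->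
  inverse_gmor (gmor_comp f' f) (gmor_comp g g').
Proof.
move=> [hf hg K] [hf' hg' K']; split; [exact: is_gmor_comp|exact: is_gmor_comp|].
move=> U k oU; have [k1 k2] := K U k oU; have [k1' k2'] := K' U k oU.
by split=> s; rewrite /gmor_comp ?k1' ?k1// ?k2 ?k2'.
Qed.

Lemma inverse_gmor_global B B' (f : gmor B B') (g : gmor B' B) :
  inverse_gmor f g -> inverse_module_mor (f setT) (g setT).
Proof.
move=> [hf hg K]; split.
- split; first by move=> k; exact: (gmor_linear hf openT).
  by move=> k p al s oal; exact: (gmor_act hf _ openT oal).
- split; first by move=> k; exact: (gmor_linear hg openT).
  by move=> k p al s oal; exact: (gmor_act hg _ openT oal).
- by move=> k; exact: (K setT k openT).
Qed.

Lemma inverse_module_mor_id B : inverse_module_mor (fun k (s : sec B setT k) => s) (fun k s => s).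
Proof. by split. Qed.

Lemma inverse_module_mor_sym B B' (f : forall k, sec B setT k -> sec B' setT k) g :
  inverse_module_mor f g -> inverse_module_mor g f.
Proof. by move=> [hf hg K]; split=> // k; have [] := K k. Qed.

Lemma inverse_module_mor_comp B B' B'' (f : forall k, sec B setT k -> sec B' setT k) g
    (f' : forall k, sec B' setT k -> sec B'' setT k) g' :
  inverse_module_mor f g -> inverse_module_mor f' g' ->
  inverse_module_mor (fun k s => f' k (f k s)) (fun k s => g k (g' k s)).
Proof.
move=> [[lf af] [lg ag] K] [[lf' af'] [lg' ag'] K']; split.
- by split=> [k a s t|k p al s oal]; [rewrite lf lf'|rewrite af// af'].
- by split=> [k a s t|k p al s oal]; [rewrite lg' lg|rewrite ag'// ag].
- move=> k; have [k1 k2] := K k; have [k1' k2'] := K' k.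
  by split=> s; rewrite ?k1' ?k1// ?k2 ?k2'.
Qed.
End Morphisms.

(** The Leibniz rule moves [f] past multiplication by [dA al]. Morphisms commute with forms of a
    definite degree only, so this rests on [dA_Omega]. *)
Lemma conjugate_module_op R n (M : manifold R n) (A : lie_algebroid M) (B B' : gsheaf A)
    (f : gmor B B') (g : gmor B' B) (Q : gop B) : inverse_gmor f g -> is_module_op Q ->
  is_module_op (fun k w => f setT (k + 1) (Q k (g setT k w))).
Proof.
move=> [hf hg K] [lQ QQ LQ]; have lf k := gmor_linear hf (k := k) openT.
split.
- by move=> k a s t; rewrite (gmor_linear hg openT) lQ lf.
- by move=> k s; have [-> _] := K setT (k + 1) openT; rewrite QQ (lin0 (lf _)).
- move=> k l p al s oal kl; rewrite (gmor_act_eq _ hg openT oal kl) (LQ _ _ p)//.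
  rewrite (linD (lf _)) (linZ (lf _)).
  rewrite (gmor_act_eq _ hf openT (dA_Omega oal)); last by rewrite kl -addrA -PoszD addn1.
  rewrite (gmor_act_eq _ hf openT oal); last by rewrite kl addrAC.
  have [_ K2] := K setT k openT.
  by rewrite K2.
Qed.

Section Main.
Context {R : realType} {n : nat} {M : manifold R n} {A : lie_algebroid M}.

Lemma decomposition_of (E : int -> vbundle M) (X : amodule_on A E) :
  exists T : decomposition X, True.
Proof.
have [f [g [K fev]]] := decomposition_exists (am_bundle X) (ao_std X).
by exists (Decomposition K fev).
Qed.

Lemma transport_module_op (E : int -> vbundle M) (X : amodule_on A E) (T : decomposition X) :
  is_module_op (transport T).
Proof. exact: conjugate_module_op (decK T) (am_opP X). Qed.

Lemma dec_transport (E : int -> vbundle M) (X : amodule_on A E) (T : decomposition X) k s :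
  dec T setT _ (am_op X k s) = transport T k (dec T setT k s).
Proof. by have [_ _ K] := decK T; rewrite /transport (K _ _ openT).1. Qed.

Lemma dec_inv_transport (E : int -> vbundle M) (X : amodule_on A E) (T : decomposition X) k w :
  dec_inv T setT _ (transport T k w) = am_op X k (dec_inv T setT k w).
Proof. by have [_ _ K] := decK T; rewrite /transport (K _ _ openT).1. Qed.

(** A representation is itself an A-module on the pullback, with the identity as decomposition; this
    gives the surjectivity of both correspondences. *)
Definition pullback_amodule (E : int -> vbundle M) (D : rep_on A E) : amodule_on A E :=
  @AModuleOn _ _ _ A E (AModule (pullback_gbundle (A := A) (E := E)) (rep_opP D))
    (pullback_standard (A := A) (E := E)).

Lemma pullback_induces (E : int -> vbundle M) (D : rep_on A E) :
  induces (pullback_amodule D) D.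
Proof.
have K : inverse_gmor (fun U k (s : sec (pullback A E) U k) => s) (fun U k s => s).
  exact: inverse_gmor_id.
by exists (@Decomposition _ _ _ A E (pullback_amodule D) _ _ K (fun _ _ _ _ _ _ => erefl)).
Qed.

Lemma amodule_iso_equivalence : Equivalence (@amodule_iso R n M A).
Proof.
split.
- move=> X; exists (fun U k s => s), (fun U k s => s); split=> //; exact: inverse_gmor_id.
- move=> X Y [f [g [K fQ]]]; exists g, f; split; first exact: inverse_gmor_sym.
  move=> k s; have [_ _ fgK] := K; have [_ gK] := fgK setT k openT.
  by rewrite -{1}(gK s) -fQ (fgK setT _ openT).1.
- move=> X Y Z [f [g [K fQ]]] [f' [g' [K' fQ']]].
  exists (gmor_comp f' f), (gmor_comp g g'); split; first exact: inverse_gmor_comp.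
  by move=> k s; rewrite /gmor_comp fQ fQ'.
Qed.

Lemma statomorphic_equivalence (E : int -> vbundle M) : Equivalence (@statomorphic R n M A E).
Proof.
split.
- move=> X; exists (fun U k s => s), (fun U k s => s); split=> //; exact: inverse_gmor_id.
- move=> X Y [f [g [K fQ fev]]]; have [_ _ fgK] := K.
  exists g, f; split; first exact: inverse_gmor_sym.
    move=> k s; have [_ gK] := fgK setT k openT.
    by rewrite -{1}(gK s) -fQ (fgK setT _ openT).1.
  by move=> U k s oU x Ux; rewrite -fev// (fgK U k oU).2.
- move=> X Y Z [f [g [K fQ fev]]] [f' [g' [K' fQ' fev']]].
  exists (gmor_comp f' f), (gmor_comp g g'); split; first exact: inverse_gmor_comp.
    by move=> k s; rewrite /gmor_comp fQ fQ'.
  by move=> U k s oU x Ux; rewrite /gmor_comp fev'// fev.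
Qed.

Lemma rep_iso_equivalence : Equivalence (@rep_iso R n M A).
Proof.
split.
- move=> D; exists (fun k s => s), (fun k s => s); split=> //; exact: inverse_module_mor_id.
- move=> D D' [f [g [K fD]]]; exists g, f; split; first exact: inverse_module_mor_sym.
  by move=> k s; have [_ _ fgK] := K; rewrite -{1}((fgK k).2 s) -fD (fgK _).1.
- move=> D D' D'' [f [g [K fD]]] [f' [g' [K' fD']]].
  exists (fun k s => f' k (f k s)), (fun k s => g k (g' k s)); split.
    exact: inverse_module_mor_comp.
  by move=> k s; rewrite fD fD'.
Qed.

Lemma gauge_equivalence (E : int -> vbundle M) : Equivalence (@gauge_equivalent R n M A E).
Proof.
split.
- move=> D; exists (fun k s => s), (fun k s => s); split=> //; exact: inverse_module_mor_id.
- move=> D D' [u [v [K u0 D'E]]]; have [_ _ uvK] := K.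
  exists v, u; split; first exact: inverse_module_mor_sym.
    by move=> k w x i; rewrite -u0 (uvK k).2.
  by move=> k w; rewrite D'E (uvK _).2 (uvK _).2.
- move=> D D' D'' [u [v [K u0 D'E]]] [u' [v' [K' u0' D''E]]].
  exists (fun k s => u k (u' k s)), (fun k s => v' k (v k s)); split.
  + exact: (inverse_module_mor_comp K' K).
  + by move=> k w x i; rewrite u0 u0'.
  + by move=> k w; rewrite D''E D'E.
Qed.

(** An isomorphism f of modules becomes T' f T^-1 on global sections; conversely u, once localised,
    becomes T'^-1 u T. The graded bundles of [D] and [D'] may differ. *)
Lemma amodule_iso_rep_iso (X X' : amodule A) (D D' : rep A) :
  corresponds X D -> corresponds X' D' -> (amodule_iso X X' <-> rep_iso D D').
Proof.
move=> [std [T DT]] [std' [T' DT']]; have [_ _ TK] := decK T; have [_ _ TK'] := decK T'.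
split=> [[f [g [K fQ]]]|[u [v [K uD]]]].
  have H := inverse_gmor_comp (inverse_gmor_comp (inverse_gmor_sym (decK T)) K) (decK T').
  eexists; eexists; split; first exact: (inverse_gmor_global H).
  move=> k w; rewrite /gmor_comp DT DT' dec_inv_transport.
  by rewrite [f _ _ _]fQ dec_transport.
have H := inverse_gmor_comp (inverse_gmor_comp (decK T) (localise_inverse K))
  (inverse_gmor_sym (decK T')).
eexists; eexists; split; first exact: H.
have [hu _ _] := K.
move=> k s; rewrite /gmor_comp [dec T _ _ _]dec_transport !(localise_setT hu) -DT uD DT'.
exact: (dec_inv_transport T').
Qed.

(** By the convention D' = u^-1 D u, the gauge transformation goes from [D'] to [D], hence u = T
    f^-1 T'^-1. Conversely the statomorphism is T'^-1 v T, with v the inverse of u, localised. *)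
Lemma statomorphic_gauge (E : int -> vbundle M) (X X' : amodule_on A E) (D D' : rep_on A E) :
  induces X D -> induces X' D' -> (statomorphic X X' <-> gauge_equivalent D D').
Proof.
move=> [T DT] [T' DT']; have [_ _ TK] := decK T; have [_ _ TK'] := decK T'.
split=> [[f [g [K fQ fev]]]|[u [v [K u0 D'E]]]].
  have [_ _ fgK] := K.
  have H := inverse_gmor_comp (inverse_gmor_comp (inverse_gmor_sym (decK T'))
    (inverse_gmor_sym K)) (decK T).
  eexists; eexists; split; first exact: (inverse_gmor_global H).
    (* In degree [k], a part of form degree 0 can be nonzero only in [E k], and there both
       decompositions read it off as [ev], which [f] preserves. *)
    move=> k w x i; have [e|ne] := pselect (i = k); last first.
      by rewrite !pval_degree//= add0r.
    subst i; transitivity (ev (ao_std X) setT k (g setT k (dec_inv T' setT k w)) x).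
      exact: (dec_ev T _ openT).
    rewrite -(fev _ _ _ openT)// (fgK _ _ openT).2 -(dec_ev T' _ openT)//.
    by rewrite (TK' _ _ openT).2.
  move=> k w; rewrite /gmor_comp DT DT' dec_inv_transport (TK _ _ openT).1.
  by rewrite [f _ _ _]fQ (fgK _ _ openT).2 [LHS]/transport.
have [hu hv uvK] := K.
have H := inverse_gmor_comp (inverse_gmor_comp (decK T)
  (localise_inverse (inverse_module_mor_sym K))) (inverse_gmor_sym (decK T')).
eexists; eexists; split; first exact: H.
  move=> k s; rewrite /gmor_comp [dec T _ _ _]dec_transport !(localise_setT hv) -DT.
  rewrite -dec_inv_transport -DT' D'E (uvK k).2.
  by [].
move=> U k s oU x Ux; rewrite /gmor_comp -(dec_ev T')// (TK' _ _ oU).2.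
(* At [x] the localised [v] is computed on a global truncation equal to the section near [x]; [u],
   hence [v], preserves the part of form degree 0. *)
rewrite -(dec_ev T)// (localise_bump hv)//.
rewrite -[LHS]u0 (uvK _).2.
have b := bumpP oU Ux.
exact: (nbhs_singleton (truncate_near _ oU b)).
Qed.
End Main.

Theorem theorem4p5 (R : realType) (n : nat) (M : manifold R n)
    (A : lie_algebroid M) :
  (forall P : (int -> nat) -> Prop, P = bounded_rk \/ P = semibounded_rk ->
     one_to_one (fun X : amodule A => P (am_rk X)) (@amodule_iso R n M A)
                (fun D : rep A => P (bundle_rk (rep_bundle D)))
                (@rep_iso R n M A)
                (@corresponds R n M A)) /\
  (forall E : int -> vbundle M,
     bounded_rk (bundle_rk E) \/ semibounded_rk (bundle_rk E) ->
     one_to_one (fun _ : amodule_on A E => True) (@statomorphic R n M A E)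
                (fun _ : rep_on A E => True) (@gauge_equivalent R n M A E)
                (@induces R n M A E) /\
     (forall (X : amodule_on A E) (T : decomposition X),
        is_module_op (transport T))).
Proof.
split=> [P _|E _].
  split.
  - by split; [exact: amodule_iso_equivalence|exact: rep_iso_equivalence].
  - move=> X PX; have [E [rE [std]]] := standard_exists (am_bundle X).
    have [T _] := decomposition_of (AModuleOn std).
    exists (@Rep _ _ _ A E (RepOn (transport_module_op T))); split.
      by rewrite /= (_ : bundle_rk E = am_rk X)//; apply/funext.
    by exists std, T.
  - move=> D PD; exists (pullback_amodule D); split=> //.
    by exists (pullback_standard (A := A)); exact: pullback_induces.
  - by move=> X X' D D' _ _ _ _; exact: amodule_iso_rep_iso.
split; last by move=> X T; exact: transport_module_op.
split.
- by split; [exact: statomorphic_equivalence|exact: gauge_equivalence].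
- move=> X _; have [T _] := decomposition_of X.
  by exists (RepOn (transport_module_op T)); split=> //; exists T.
- by move=> D _; exists (pullback_amodule D); split=> //; exact: pullback_induces.
- by move=> X X' D D' _ _ _ _; exact: statomorphic_gauge.
Qed.
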